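(* If $X$ is a (bounded) finite rank operator on $\mathcal{H}=L^2(\mathbb{R})$ and the set $\{w \in \mathbb{R}^2 : \alpha(X)(w) \ne 0\}$ has finite Lebesgue measure, then $X=0$.
   Context: Let $\mathcal{H}=L^2(\mathbb{R})$ (complex-valued functions). For $x,y\in\mathbb{R}$ and $z\in\mathbb{C}$ with $|z|=1$, let $\rho(x,y,z)$ be the unitary operator on $\mathcal{H}$ given by $(\rho(x,y,z)\phi)(t)=z e^{\pi i(xy+2yt)}\phi(t+x)$. For a trace class operator $X$ on $\mathcal{H}$, the modified Fourier-Wigner transform of $X$ is the function $\alpha(X):\mathbb{R}^2\to\mathbb{C}$ defined by $\alpha(X)(x,y)=\mathrm{tr}(X\rho(x,y,1)^* )$. *)

(* Defs.v *)
From HB Require Import structures.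
From mathcomp Require Import all_boot all_order all_algebra.
From mathcomp Require Import ring_quotient.
From mathcomp Require Import all_classical all_reals all_analysis.
From mathcomp Require Import measurable_realfun complex ring lra.

Set Implicit Arguments.
Unset Strict Implicit.
Unset Printing Implicit Defensive.

Import Order.TTheory GRing.Theory Num.Theory numFieldNormedType.Exports.

Local Open Scope classical_set_scope.
Local Open Scope ring_scope.
Local Open Scope complex_scope.
Local Open Scope quotient_scope.

(* [Re] alone denotes the numClosedFieldType projection, valued in R[i]. *)
Local Notation Re := (@complex.Re _).
Local Notation Im := (@complex.Im _).

Section SquareIntegrable.
Context (R : realType).
Local Notation mu := (@lebesgue_measure R).
Local Notation C := (R[i]^o).

Definition sqnorm (z : R[i]) : R := Re z ^+ 2 + Im z ^+ 2.

(* Complex functions carry no measurable structure in the library: Borel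
   measurability of f is that of its real and imaginary parts. *)
Definition square_integrable (f : R -> C) : Prop :=
  [/\ measurable_fun [set: R] (fun t => Re (f t)),
      measurable_fun [set: R] (fun t => Im (f t)) &
      (\int[mu]_t (sqnorm (f t))%:E < +oo)%E].

Lemma sqnorm_ge0 z : 0 <= sqnorm z.
Proof. by rewrite addr_ge0 ?sqr_ge0. Qed.

Lemma sqnormM z w : sqnorm (z * w) = sqnorm z * sqnorm w.
Proof. by case: z => a b; case: w => c d; rewrite /sqnorm /=; ring. Qed.

Lemma sqnormD z w : sqnorm (z + w) <= 2 * sqnorm z + 2 * sqnorm w.
Proof.
case: z => a b; case: w => c d; rewrite /sqnorm /=.
have := sqr_ge0 (a - c); have := sqr_ge0 (b - d); lra.
Qed.

Lemma measurable_sqnorm (f : R -> C) :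
  measurable_fun [set: R] (fun t => Re (f t)) ->
  measurable_fun [set: R] (fun t => Im (f t)) ->
  measurable_fun [set: R] (EFin \o (fun t => sqnorm (f t))).
Proof.
by move=> mr mi; apply/measurable_EFinP/measurable_funD; exact: measurable_funX.
Qed.

Lemma measurable_cmul (f g : R -> R[i]) :
  measurable_fun [set: R] (fun t => Re (f t)) ->
  measurable_fun [set: R] (fun t => Im (f t)) ->
  measurable_fun [set: R] (fun t => Re (g t)) ->
  measurable_fun [set: R] (fun t => Im (g t)) ->
  measurable_fun [set: R] (fun t => Re (f t * g t)) /\
  measurable_fun [set: R] (fun t => Im (f t * g t)).
Proof.
move=> fr fi gr gi.
have -> : (fun t => Re (f t * g t)) =
    (fun t => Re (f t) * Re (g t) - Im (f t) * Im (g t)).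
  by apply/funext => t; case: (f t) (g t) => a b [c d].
have -> : (fun t => Im (f t * g t)) =
    (fun t => Re (f t) * Im (g t) + Im (f t) * Re (g t)).
  by apply/funext => t; case: (f t) (g t) => a b [c d].
by split; [apply: measurable_funB|apply: measurable_funD];
  exact: measurable_funM.
Qed.

Definition L2pred : {pred R -> C} := mem [set f | square_integrable f].

Lemma L2predP (f : R -> C) : f \in L2pred <-> square_integrable f.
Proof. by rewrite inE. Qed.

Lemma L2pred_submod_closed : submod_closed L2pred.
Proof.
split.
  apply/L2predP; split; [exact: measurable_cst|exact: measurable_cst|].
  rewrite (eq_integral (cst 0%E)) ?integral0 ?ltry// => t _ /=.
  by rewrite /sqnorm /= expr0n addr0.
move=> a f g /L2predP[fr fi fL] /L2predP[gr gi gL]; apply/L2predP.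
have [ar ai] := @measurable_cmul (cst a) f
  (measurable_cst (Re a)) (measurable_cst (Im a)) fr fi.
have ReD (z w : R[i]) : Re (z + w) = Re z + Re w by case: z w => ? ? [? ?].
have ImD (z w : R[i]) : Im (z + w) = Im z + Im w by case: z w => ? ? [? ?].
have hr : measurable_fun [set: R] (fun t => Re ((a *: f + g) t)).
  have -> : (fun t => Re ((a *: f + g) t)) =
      (fun t => Re (a * f t) + Re (g t)) by apply/funext => t; exact: ReD.
  exact: measurable_funD.
have hi : measurable_fun [set: R] (fun t => Im ((a *: f + g) t)).
  have -> : (fun t => Im ((a *: f + g) t)) =
      (fun t => Im (a * f t) + Im (g t)) by apply/funext => t; exact: ImD.
  exact: measurable_funD.
split => //.
apply: (@le_lt_trans _ _ (\int[mu]_t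
   ((2 * sqnorm a)%:E * (sqnorm (f t))%:E + 2%:E * (sqnorm (g t))%:E))%E).
  apply: ge0_le_integral => //.
  - by move=> t _; rewrite lee_fin sqnorm_ge0.
  - exact: measurable_sqnorm.
  - by apply: emeasurable_funD; apply: measurable_funeM;
      exact: measurable_sqnorm.
  - move=> t _; rewrite lee_fin -mulrA -sqnormM; exact: sqnormD.
rewrite ge0_integralD//; first last.
- by apply: measurable_funeM; exact: measurable_sqnorm.
- by move=> t _; rewrite lee_fin mulr_ge0 ?sqnorm_ge0.
- by apply: measurable_funeM; exact: measurable_sqnorm.
- by move=> t _; rewrite lee_fin !mulr_ge0 ?sqnorm_ge0.
rewrite !ge0_integralZl//; try exact: measurable_sqnorm;
  try (by move=> t _; rewrite lee_fin sqnorm_ge0);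
  try (by rewrite lee_fin ?mulr_ge0// sqnorm_ge0).
by rewrite lte_add_pinfty// lte_mul_pinfty// ?lee_fin ?mulr_ge0 ?sqnorm_ge0.
Qed.

HB.instance Definition _ := GRing.isSubmodClosed.Build _ _ L2pred
  L2pred_submod_closed.

Record L2fun := MkL2fun { L2val :> R -> C; L2valP : L2val \in L2pred }.

HB.instance Definition _ := [isSub for L2val].
HB.instance Definition _ := [Choice of L2fun by <:].
HB.instance Definition _ := [SubChoice_isSubLmodule of L2fun by <:].

Definition L2null : {pred L2fun} :=
  mem [set f : L2fun | {ae mu, forall t, f t = 0}].

Lemma L2null_submod_closed : submod_closed L2null.
Proof.
split; first by rewrite inE /=; apply: aeW.
move=> a f g; rewrite !inE /= => f0 g0.
have aeF := ae_filter_ringOfSetsType mu.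
apply: filterS2 f0 g0 => t /= ft gt.
by rewrite -[LHS]/(a *: f t + g t) ft gt scaler0 addr0.
Qed.

HB.instance Definition _ := GRing.isSubmodClosed.Build _ _ L2null
  L2null_submod_closed.

(* {ideal_quot _} is the quotient of the additive group by a subgroup; the
   scalar multiplication is added below. *)
Definition L2 := {ideal_quot L2null}.
HB.instance Definition _ := GRing.Zmodule.on L2.
HB.instance Definition _ := EqQuotient.on L2.

Lemma L2_eqP (f g : L2fun) :
  reflect (\pi_L2 f = \pi_L2 g) `[< {ae mu, forall t, f t = g t} >].
Proof.
have -> : `[< {ae mu, forall t, f t = g t} >] = (f - g \in L2null).
  have aeF := ae_filter_ringOfSetsType mu.
  apply/asboolP/idP => [fg|].
    rewrite inE /=; apply: filterS fg => t fgt.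
    by rewrite -[LHS]/(f t - g t) fgt subrr.
  rewrite inE /= => fg; apply: filterS fg => t fgt.
  by apply/eqP; rewrite -subr_eq0; apply/eqP; exact: fgt.
by rewrite Quotient.idealrBE; exact: eqP.
Qed.

Lemma L2_ae_repr (f : L2fun) : {ae mu, forall t, repr (\pi_L2 f) t = f t}.
Proof. by apply/asboolP/L2_eqP; rewrite reprK. Qed.

Definition L2scale (a : R[i]) (f : L2) : L2 := \pi_L2 (a *: repr f).

Lemma L2scale_pi a (f : L2fun) : L2scale a (\pi_L2 f) = \pi_L2 (a *: f).
Proof.
apply/eqP; rewrite /L2scale -Quotient.idealrBE -scalerBr rpredZ//.
by rewrite Quotient.idealrBE reprK.
Qed.

Let L2scaleA a b f : L2scale a (L2scale b f) = L2scale (a * b) f.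
Proof. by elim/quotW: f => f; rewrite (L2scale_pi b) !L2scale_pi scalerA. Qed.

Let L2scale1 : left_id 1 L2scale.
Proof. by elim/quotW=> f; rewrite L2scale_pi scale1r. Qed.

Let L2scaleDr : right_distributive L2scale +%R.
Proof.
move=> a; elim/quotW=> f; elim/quotW=> g; rewrite !L2scale_pi.
by rewrite -raddfD L2scale_pi scalerDr raddfD.
Qed.

Let L2scaleDl f : {morph L2scale^~ f : a b / a + b}.
Proof. by move=> a b; elim/quotW: f => f; rewrite !L2scale_pi scalerDl raddfD. Qed.

HB.instance Definition _ := GRing.Zmodule_isLmodule.Build R[i] L2
  L2scaleA L2scale1 L2scaleDr L2scaleDl.

End SquareIntegrable.

Arguments L2 : clear implicits.
Arguments L2fun : clear implicits.

Section InnerProduct.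
Context (R : realType).
Local Notation mu := (@lebesgue_measure R).

Definition dot_fun (f g : R -> R[i]) : R[i] :=
  (\int[mu]_t Re (f t * (g t)^*)) +i* (\int[mu]_t Im (f t * (g t)^*)).

(* [dot_pi] shows that the choice of representatives is irrelevant. *)
Definition dot (f g : L2 R) : R[i] := dot_fun (repr f) (repr g).

Definition norm2 (f : L2 R) : R := Num.sqrt (Re (dot f f)).

Lemma dot_pi (f g : L2fun R) : dot (\pi_(L2 R) f) (\pi_(L2 R) g) = dot_fun f g.
Proof.
have aeF := ae_filter_ringOfSetsType mu.
have mdot (f' g' : L2fun R) :
    measurable_fun [set: R] (fun t => Re (f' t * (g' t)^*)) /\
    measurable_fun [set: R] (fun t => Im (f' t * (g' t)^*)).
  case: f' g' => f' /= /L2predP[fr fi _] [g' /= /L2predP[gr gi _]].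
  apply: measurable_cmul => //.
    have -> : (fun t => Re (g' t)^*) = (fun t => Re (g' t)) => //.
    by apply/funext => t; case: (g' t).
  have -> : (fun t => Im (g' t)^*) = (fun t => - Im (g' t)).
    by apply/funext => t; case: (g' t).
  exact: measurableT_comp.
have [mr mi] := mdot f g.
have [mr' mi'] := mdot (repr (\pi_(L2 R) f)) (repr (\pi_(L2 R) g)).
have fE := L2_ae_repr f; have gE := L2_ae_repr g.
rewrite /dot /dot_fun /Rintegral.
congr (fine _ +i* fine _); apply: ae_eq_integral => //;
  try exact/measurable_EFinP.
- by apply: filterS2 fE gE => t /= ft gt _; rewrite ft gt.
- by apply: filterS2 fE gE => t /= ft gt _; rewrite ft gt.
Qed.

End InnerProduct.

Section Rho.
Context (R : realType).
Local Notation mu := (@lebesgue_measure R).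

Section Translation.
Variable x : R.

Definition translate (t : measurableTypeR R) : measurableTypeR R := t + x.

Lemma measurable_translate : measurable_fun [set: measurableTypeR R] translate.
Proof. exact: measurable_funD. Qed.

HB.instance Definition _ := isMeasurableFun.Build _ _ _ _ translate
  measurable_translate.

Lemma lebesgue_translate (A : set (measurableTypeR R)) : measurable A ->
  pushforward mu translate A = mu A.
Proof.
move=> mA; apply/esym/lebesgue_measure_unique => //= _ [[a b]] _ <-.
rewrite /pushforward.
have -> : translate @^-1` `]a, b] = `]a - x, b - x]%classic.
  by apply/seteqP; split => t /=; rewrite !in_itv/= /translate;
    rewrite ltrBlDr lerBrDr.
rewrite !lebesgue_measure_itv/= !lte_fin.
by rewrite ltrD2r; case: ifP => // _; rewrite -!EFinB; congr EFin; lra.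
Qed.

Lemma ae_translate (P : set R) :
  {ae mu, forall t, P t} -> {ae mu, forall t, P (t + x)}.
Proof.
move=> [N [mN N0 PN]]; exists (translate @^-1` N); split.
- by rewrite -[X in measurable X]setTI; exact: measurable_translate.
- by rewrite -[LHS]/(pushforward mu translate N) lebesgue_translate.
- by move=> t /= Pt; apply: PN.
Qed.

Lemma ge0_integral_translate (f : R -> \bar R) :
  measurable_fun [set: R] f -> (forall t, (0 <= f t)%E) ->
  (\int[mu]_t f (t + x)%R = \int[mu]_t f t)%E.
Proof.
move=> mf f0; rewrite -[LHS]/(\int[mu]_(t in translate @^-1` setT)
  (f \o translate) t)%E.
rewrite -(@ge0_integral_pushforward _ _ _ _ _ _ measurable_translate)//.
by apply: eq_measure_integral => //= A mA _; exact: lebesgue_translate.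
Qed.

End Translation.

(* cis theta = exp (i theta) *)
Definition cis (theta : R) : R[i] := cos theta +i* sin theta.

Definition rho_fun (x y : R) (z : R[i]) (f : R -> R[i]^o) : R -> R[i]^o :=
  fun t => z * cis (pi * (x * y + 2 * y * t)) * f (t + x).

Lemma sqnorm_cis theta : sqnorm (cis theta) = 1.
Proof. by rewrite /sqnorm /= cos2Dsin2. Qed.

Lemma measurable_rho_fun x y z (f : R -> R[i]^o) :
  measurable_fun [set: R] (fun t => Re (f t)) ->
  measurable_fun [set: R] (fun t => Im (f t)) ->
  measurable_fun [set: R] (fun t => Re (rho_fun x y z f t)) /\
  measurable_fun [set: R] (fun t => Im (rho_fun x y z f t)).
Proof.
move=> fr fi.
have mlin : measurable_fun [set: R] (fun t : R => pi * (x * y + 2 * y * t)).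
  by apply: measurable_funM => //; apply: measurable_funD => //;
    exact: measurable_funM.
have mcos : measurable_fun [set: R] (@cos R).
  by apply: continuous_measurable_fun; exact: continuous_cos.
have msin : measurable_fun [set: R] (@sin R).
  by apply: continuous_measurable_fun; exact: continuous_sin.
have [cr ci] := @measurable_cmul R (cst z)
  (fun t => cis (pi * (x * y + 2 * y * t)))
  (measurable_cst _) (measurable_cst _)
  (measurableT_comp mcos mlin) (measurableT_comp msin mlin).
have mt := measurable_translate x.
exact: (measurable_cmul cr ci (measurableT_comp fr mt)
  (measurableT_comp fi mt)).
Qed.

Lemma rho_fun_L2 x y z (f : L2fun R) : rho_fun x y z f \in @L2pred R.
Proof.
case: f => f /= /L2predP[fr fi fL]; apply/L2predP.
have [mr mi] := measurable_rho_fun x y z fr fi; split => //.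
under eq_integral do rewrite !sqnormM sqnorm_cis mulr1 EFinM.
have mf := measurable_sqnorm fr fi.
rewrite ge0_integralZl//; first last.
- by rewrite lee_fin sqnorm_ge0.
- by move=> t _; rewrite lee_fin sqnorm_ge0.
- exact: (measurableT_comp mf (measurable_translate x)).
rewrite (@ge0_integral_translate x (EFin \o (@sqnorm R \o f)))//; last first.
  by move=> t; rewrite lee_fin sqnorm_ge0.
by rewrite lte_mul_pinfty// lee_fin sqnorm_ge0.
Qed.

(* [rho_pi] shows that the choice of representative is irrelevant. *)
Definition rho (x y : R) (z : R[i]) (phi : L2 R) : L2 R :=
  \pi_(L2 R) (MkL2fun (rho_fun_L2 x y z (repr phi))).

Lemma rho_pi x y z (f : L2fun R) :
  rho x y z (\pi_(L2 R) f) = \pi_(L2 R) (MkL2fun (rho_fun_L2 x y z f)).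
Proof.
have aeF := ae_filter_ringOfSetsType mu.
apply/L2_eqP/asboolP; have := ae_translate x (L2_ae_repr f).
by move=> fE; apply: filterS fE => t /= ft; rewrite /rho_fun ft.
Qed.

End Rho.

Section Operators.
Context (R : realType).
Local Notation mu := (@lebesgue_measure R).

Definition bounded_op (T : L2 R -> L2 R) : Prop :=
  exists M : R, forall f, norm2 (T f) <= M * norm2 f.

Definition finite_rank (T : L2 R -> L2 R) : Prop :=
  exists (n : nat) (v : 'I_n -> L2 R), forall f, exists c : 'I_n -> R[i],
    T f = \sum_(i < n) c i *: v i.

(* Riesz representative of f |-> <T f, g>: it exists whenever T is bounded and
   linear, and it is unique because dot is definite. *)
Definition adjoint (T : L2 R -> L2 R) (g : L2 R) : L2 R :=
  xget 0 [set h | forall f, dot (T f) g = dot f h].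

Definition orthonormal_basis (e : nat -> L2 R) : Prop :=
  (forall m n, dot (e m) (e n) = (m == n)%:R) /\
  (forall f, (forall n, dot f (e n) = 0) -> f = 0).

(* The common value of the sums \sum_n <T e_n, e_n> over all orthonormal bases
   (e_n); it exists for trace class T, and it is unique because L2 R has an
   orthonormal basis. The default 0 is only returned otherwise. *)
Definition trace (T : L2 R -> L2 R) : R[i]^o :=
  xget 0 [set c : R[i]^o | forall e, orthonormal_basis e ->
    series (fun n => dot (T (e n)) (e n) : R[i]^o) @ \oo --> c].

Definition fourier_wigner (X : L2 R -> L2 R) (w : R * R) : R[i] :=
  trace (X \o adjoint (rho w.1 w.2 1)).

End Operators.

(* Main.v *)
(** The proof is a dimension count in the style of Amrein and Berthier.

A bounded operator of finite rank is [X = \sum_i <., g_i> v_i] with orthonormal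
[v_i], [i < N], and then [alpha(X)(w) = A_G(w) := \sum_i <v_i, rho(w) g_i>] with
[G = (g_i)].  For fixed [x], [|A_G(x, .)|] is the modulus of the Fourier
transform of [t |-> \sum_i v_i(t) conj(g_i(t + x))].  Two facts are opposed:
- Bessel: if [H_1, ..., H_n] are orthonormal in [L2^N], then
  [\sum_k |A_(H_k)(w)|^2 <= \sum_i |v_i|^2 = N] for every [w], because [A_H(w)]
  is the inner product of [(rho(w)^* v_i)_i] with [H];
- Plancherel: [|H|^2 <= 4 \int |A_H|^2].
If [G != 0], the modulates [exp(-2 pi i k delta t) G], [k < n], are linearly
independent, since a nonzero trigonometric polynomial has a null zero set.
Modulation by [k delta] translates the support [E] of [A_G] by [(0, k delta)];
as [A_G] is continuous in [y], for small [delta] the union of the [n] translates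
of [E] has measure at most [|E| + 1].  Orthonormalizing the modulates and
integrating over this union, [n <= 4 N (|E| + 1)] for all [n], a contradiction. *)

Require Import Defs.
From HB Require Import structures.
From mathcomp Require Import all_boot all_order all_algebra.
From mathcomp Require Import ring_quotient.
From mathcomp Require Import all_classical all_reals all_analysis.
From mathcomp Require Import measurable_realfun complex ring lra.

Set Implicit Arguments.
Unset Strict Implicit.
Unset Printing Implicit Defensive.

Import Order.TTheory GRing.Theory Num.Theory numFieldNormedType.Exports.

Local Open Scope classical_set_scope.
Local Open Scope ring_scope.
Local Open Scope complex_scope.
Local Open Scope quotient_scope.

Local Notation Re := (@complex.Re _).
Local Notation Im := (@complex.Im _).

(** * Complex numbers and inner products *)

(** Only the tuple [G] is modulated, while the [v_i] stay fixed. The Bessel bound [N] involves the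
    [v_i] alone, so it does not grow with the number of modulates; and [A_G] is conjugate-linear in
    [G], so orthonormalizing the modulates does not lead out of the union of the translated
    supports.

    A set of finite measure may be unbounded, so the overlap of its translates comes from dominated
    convergence and not from compactness.

    Plancherel is derived from Fourier series. Parseval on an interval, averaged over the shifts of
    the frequency lattice, gives an isometry on functions supported there; truncation carries it to
    the line as an inequality, which is all that the count needs. Completeness of the exponentials
    rests on the sign of a shifted cosine: it is a bounded limit of trigonometric polynomials and
    produces the indicators of arcs. The same exponentials on unit intervals form an orthonormal
    basis of [L2 R], on which both the Riesz representation and the uniqueness of the trace
    depend. *)

Section ComplexFacts.
Context (R : realType).
Implicit Types z w : R[i].

Lemma ReD z w : Re (z + w) = Re z + Re w. Proof. by case: z w => ? ? []. Qed.
Lemma ImD z w : Im (z + w) = Im z + Im w. Proof. by case: z w => ? ? []. Qed.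
Lemma ReN z : Re (- z) = - Re z. Proof. by case: z. Qed.
Lemma ImN z : Im (- z) = - Im z. Proof. by case: z. Qed.
Lemma ReM z w : Re (z * w) = Re z * Re w - Im z * Im w.
Proof. by case: z w => ? ? []. Qed.
Lemma ImM z w : Im (z * w) = Re z * Im w + Im z * Re w.
Proof. by case: z w => ? ? []. Qed.
Lemma Re_conjc z : Re (conjc z) = Re z. Proof. by case: z. Qed.
Lemma Im_conjc z : Im (conjc z) = - Im z. Proof. by case: z. Qed.
Lemma complex_ext z w : Re z = Re w -> Im z = Im w -> z = w.
Proof. by case: z w => ? ? [? ?] /= -> ->. Qed.

Lemma Re_sum I (s : seq I) (P : pred I) (F : I -> R[i]) :
  Re (\sum_(i <- s | P i) F i) = \sum_(i <- s | P i) Re (F i).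
Proof. by apply: (big_morph _ ReD). Qed.

Lemma Im_sum I (s : seq I) (P : pred I) (F : I -> R[i]) :
  Im (\sum_(i <- s | P i) F i) = \sum_(i <- s | P i) Im (F i).
Proof. by apply: (big_morph _ ImD). Qed.

Lemma mul_conjc z : z * conjc z = (sqnorm z)%:C.
Proof. by case: z => a b; apply: complex_ext; rewrite /sqnorm /=; ring. Qed.

Lemma sqnorm_eq0 z : sqnorm z = 0 -> z = 0.
Proof.
case: z => a b; rewrite /sqnorm /= => h.
have a0 : a ^+ 2 = 0 by have := sqr_ge0 a; have := sqr_ge0 b; lra.
have b0 : b ^+ 2 = 0 by have := sqr_ge0 a; have := sqr_ge0 b; lra.
by move/eqP: a0; move/eqP: b0; rewrite !sqrf_eq0 => /eqP -> /eqP ->.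
Qed.

Lemma sqnorm0 : sqnorm (0 : R[i]) = 0.
Proof. by rewrite /sqnorm /= expr0n addr0. Qed.

Lemma sqnorm_conj z : sqnorm (conjc z) = sqnorm z.
Proof. by rewrite /sqnorm Re_conjc Im_conjc sqrrN. Qed.

Lemma sqnormN z : sqnorm (- z) = sqnorm z.
Proof. by rewrite /sqnorm ReN ImN !sqrrN. Qed.

Lemma conjcD z w : conjc (z + w) = conjc z + conjc w.
Proof. by case: z w => a b [c d]; apply: complex_ext => //=; rewrite opprD. Qed.

Lemma conjcM z w : conjc (z * w) = conjc z * conjc w.
Proof. by case: z w => a b [c d]; apply: complex_ext => //=; ring. Qed.

Lemma conjcN z : conjc (- z) = - conjc z.
Proof. by case: z. Qed.

Lemma conjc0 : conjc (0 : R[i]) = 0.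
Proof. by apply: complex_ext; rewrite /= ?oppr0. Qed.

Lemma conjc_sum I (s : seq I) (P : pred I) (F : I -> R[i]) :
  conjc (\sum_(i <- s | P i) F i) = \sum_(i <- s | P i) conjc (F i).
Proof. by apply: (big_morph _ conjcD); exact: conjc0. Qed.

End ComplexFacts.

(** Kept abstract because it is instantiated twice: on [L2 R], and on the [N]-tuples of its
    elements, where the modulates are orthonormalized. Positivity and definiteness speak of the real
    part only, since [ipC] makes [ip x x] real. *)
Record inner_product (R : realType) (V : lmodType R[i]) := InnerProduct {
  ip :> V -> V -> R[i];
  ipDl : forall x y z, ip (x + y) z = ip x z + ip y z;
  ipZl : forall a x z, ip (a *: x) z = a * ip x z;
  ipC : forall x y, ip y x = conjc (ip x y);
  ip_ge0 : forall x, 0 <= Re (ip x x);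
  ip_eq0 : forall x, Re (ip x x) = 0 -> x = 0 }.

Section InnerProductTheory.
Context (R : realType) (V : lmodType R[i]) (d : inner_product V).
Implicit Types (x y z f g : V) (e : nat -> V).

Definition nsq x : R := Re (d x x).

Lemma nsqE x : d x x = (nsq x)%:C.
Proof.
apply: complex_ext => //=; have := congr1 Im (ipC d x x).
rewrite Im_conjc => h; lra.
Qed.

Lemma ip0l z : d 0 z = 0.
Proof. by rewrite -(scale0r 0) ipZl mul0r. Qed.

Lemma ipNl x z : d (- x) z = - d x z.
Proof. by rewrite -scaleN1r ipZl mulN1r. Qed.

Lemma ipBl x y z : d (x - y) z = d x z - d y z.
Proof. by rewrite ipDl ipNl. Qed.

Lemma ip0r z : d z 0 = 0.
Proof. by rewrite ipC ip0l conjc0. Qed.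

Lemma ipDr x y z : d z (x + y) = d z x + d z y.
Proof. by rewrite ipC ipDl conjcD -!ipC. Qed.

Lemma ipZr a x z : d z (a *: x) = conjc a * d z x.
Proof. by rewrite ipC ipZl conjcM -ipC. Qed.

Lemma ipNr x z : d z (- x) = - d z x.
Proof. by rewrite ipC ipNl conjcN -ipC. Qed.

Lemma ipBr x y z : d z (x - y) = d z x - d z y.
Proof. by rewrite ipDr ipNr. Qed.

Lemma ip_suml I (s : seq I) (P : pred I) (F : I -> V) z :
  d (\sum_(i <- s | P i) F i) z = \sum_(i <- s | P i) d (F i) z.
Proof. by apply: (big_morph (fun u => d u z)) => [x y|]; rewrite ?ipDl ?ip0l. Qed.

Lemma ip_sumr I (s : seq I) (P : pred I) (F : I -> V) z :
  d z (\sum_(i <- s | P i) F i) = \sum_(i <- s | P i) d z (F i).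
Proof. by apply: (big_morph (d z)) => [x y|]; rewrite ?ipDr ?ip0r. Qed.

Lemma nsq_ge0 x : 0 <= nsq x. Proof. exact: ip_ge0. Qed.

Lemma nsqN x : nsq (- x) = nsq x.
Proof. by rewrite /nsq ipNl ipNr opprK. Qed.

Lemma nsqB x y : nsq (x - y) = nsq x + nsq y - 2 * Re (d x y).
Proof.
rewrite /nsq ipBl !ipBr !(ReD, ReN, ReM) (ipC d x y) Re_conjc; lra.
Qed.

Lemma nsqZ a x : nsq (a *: x) = sqnorm a * nsq x.
Proof.
by rewrite /nsq ipZl ipZr mulrA mul_conjc nsqE /= mul0r subr0.
Qed.

Definition orthonormal e (n : nat) := forall i j, (i < n)%N -> (j < n)%N ->
  d (e i) (e j) = (i == j)%:R.

Definition partial_sum e (x : V) n := \sum_(k < n) d x (e k) *: e k.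

Lemma ip_comb_on e n (a : nat -> R[i]) k : orthonormal e n -> (k < n)%N ->
  d (\sum_(j < n) a j *: e j) (e k) = a k.
Proof.
move=> on kn; rewrite ip_suml (bigD1 (Ordinal kn)) //= ipZl on // eqxx mulr1.
rewrite big1 ?addr0 // => j /eqP jk; rewrite ipZl on //.
case: eqP => [jk'|_]; last by rewrite mulr0.
by exfalso; apply: jk; apply/val_inj.
Qed.

Lemma nsq_comb e n (a : nat -> R[i]) : orthonormal e n ->
  nsq (\sum_(k < n) a k *: e k) = \sum_(k < n) sqnorm (a k).
Proof.
move=> on; rewrite /nsq ip_sumr Re_sum; apply: eq_bigr => k _.
rewrite ipZr ip_comb_on // mulrC mul_conjc //.
Qed.

Lemma nsq_residual e n x : orthonormal e n ->
  nsq (x - partial_sum e x n) = nsq x - \sum_(k < n) sqnorm (d x (e k)).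
Proof.
move=> on; rewrite nsqB /partial_sum (nsq_comb (fun k => d x (e k)) on) ip_sumr Re_sum.
have -> : \sum_(i < n) Re (d x (d x (e i) *: e i)) = \sum_(k < n) sqnorm (d x (e k)).
  by apply: eq_bigr => k _; rewrite ipZr mulrC mul_conjc.
lra.
Qed.

Lemma bessel e n x : orthonormal e n ->
  \sum_(k < n) sqnorm (d x (e k)) <= nsq x.
Proof. by move=> on; rewrite -subr_ge0 -(nsq_residual _ on) nsq_ge0. Qed.

Lemma cauchy_schwarz x y : sqnorm (d x y) <= nsq x * nsq y.
Proof.
have [y0|y0] := eqVneq (nsq y) 0.
  by rewrite (ip_eq0 y0) ip0r sqnorm0 mulr_ge0 ?nsq_ge0.
have yp : 0 < nsq y by rewrite lt_def y0 nsq_ge0.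
have := nsq_ge0 (x - (d x y * ((nsq y)^-1)%:C) *: y).
rewrite nsqB nsqZ ipZr sqnormM conjcM.
case: (d x y) => u v; rewrite /sqnorm /= => h.
rewrite -ler_pdivrMr //; set c := (nsq y)^-1 in h *.
suff : (u ^+ 2 + v ^+ 2) * (c ^+ 2 * nsq y) = (u ^+ 2 + v ^+ 2) * c by move: h; lra.
by rewrite /c; field.
Qed.

Definition in_span (G : nat -> V) n x := exists c : nat -> R[i], x = \sum_(k < n) c k *: G k.

Lemma in_spanD G n x y : in_span G n x -> in_span G n y -> in_span G n (x + y).
Proof.
move=> [a ->] [b ->]; exists (fun k => a k + b k); rewrite -big_split /=.
by apply: eq_bigr => k _; rewrite scalerDl.
Qed.

Lemma in_spanZ G n a x : in_span G n x -> in_span G n (a *: x).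
Proof.
move=> [b ->]; exists (fun k => a * b k); rewrite scaler_sumr.
by apply: eq_bigr => k _; rewrite scalerA.
Qed.

Lemma in_span0 G n : in_span G n 0.
Proof. by exists (fun=> 0); rewrite big1 // => k _; rewrite scale0r. Qed.

Lemma in_span_sum G n m (F : nat -> V) : (forall k, (k < m)%N -> in_span G n (F k)) ->
  in_span G n (\sum_(k < m) F k).
Proof.
move=> h; apply: (big_ind (in_span G n)); [exact: in_span0|by move=> *; apply: in_spanD|].
by move=> k _; apply: h.
Qed.

Lemma in_span_trans G n H m x : (forall k, (k < m)%N -> in_span G n (H k)) ->
  in_span H m x -> in_span G n x.
Proof.
by move=> h [c ->]; apply: (@in_span_sum G n m (fun k => c k *: H k)) => k km; exact/in_spanZ/h.
Qed.

Lemma in_span_gen G n k : (k < n)%N -> in_span G n (G k).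
Proof.
move=> kn; exists (fun j => (j == k)%:R); rewrite (bigD1 (Ordinal kn)) //= eqxx scale1r.
rewrite big1 ?addr0 // => j jk; rewrite (_ : (j == k :> nat) = false) ?scale0r //.
by apply/negbTE; apply: contra jk => /eqP jk; apply/eqP/val_inj.
Qed.

Lemma in_spanW G n m x : (n <= m)%N -> in_span G n x -> in_span G m x.
Proof.
by move=> nm; apply: in_span_trans => k kn; apply: in_span_gen; exact: leq_trans nm.
Qed.

Definition independent (G : nat -> V) n := forall c : nat -> R[i],
  \sum_(k < n) c k *: G k = 0 -> forall k, (k < n)%N -> c k = 0.

Lemma partial_sum_span e n x : orthonormal e n -> in_span e n x -> x = partial_sum e x n.
Proof.
move=> on [c ->]; apply: eq_bigr => k _; by rewrite ip_comb_on.
Qed.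

(** A vector that depends on the previous ones is skipped, so that [m] is the dimension of the span.
    The reduction of a finite rank operator uses the span of [H] without independence; the dimension
    count uses the converse inclusion and [m = n]. *)
Lemma gram_schmidt (G : nat -> V) n : exists m (H : nat -> V),
  [/\ orthonormal H m,
      forall k, (k < n)%N -> in_span H m (G k),
      forall k, (k < m)%N -> in_span G n (H k) &
      independent G n -> m = n].
Proof.
elim: n => [|n [m [H [on GH HG mn]]]].
  by exists 0%N, (fun=> 0); split => //.
pose r := G n - partial_sum H (G n) m.
have HGn k : (k < m)%N -> in_span G n.+1 (H k) by move=> km; apply: in_spanW (HG _ km).
have psG : in_span G n (partial_sum H (G n) m).
  by apply: (in_span_trans HG); exists (fun k => d (G n) (H k)).
have rG : in_span G n.+1 r.
  rewrite /r -scaleN1r; apply: in_spanD; first exact: in_span_gen.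
  exact/in_spanZ/in_spanW/psG.
have [r0|r0] := eqVneq (nsq r) 0.
  have GnE : G n = partial_sum H (G n) m by apply/eqP; rewrite -subr_eq0; apply/eqP/(ip_eq0 r0).
  exists m, H; split => //.
  - move=> k; rewrite ltnS leq_eqVlt => /orP[/eqP ->|]; last exact: GH.
    by rewrite GnE; exists (fun k => d (G n) (H k)).
  - move=> ind; exfalso.
    have [c cE] := psG.
    (* A vanishing residual writes [G n] through the previous vectors; with -1 as the coefficient of
       [G n] this is a nontrivial relation. *)
    have := ind (fun k => if k == n then -1 else c k) _ n (leqnn _).
    rewrite eqxx => /(_ _)/eqP; rewrite oppr_eq0 oner_eq0 => /(_ _)/negP; apply=> //.
    rewrite big_ord_recr /= eqxx scaleN1r GnE cE -sumrB big1 // => k _.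
    by rewrite (ltn_eqF (ltn_ord k)) subrr.
have rp : 0 < nsq r by rewrite lt_def r0 nsq_ge0.
pose s := (Num.sqrt (nsq r))^-1.
have s2 : s * s * nsq r = 1.
  have h : Num.sqrt (nsq r) != 0 by rewrite gt_eqF // sqrtr_gt0.
  by rewrite /s -{3}[nsq r]sqr_sqrtr ?nsq_ge0 //; field.
pose h := s%:C *: r.
pose H' k := if k == m then h else H k.
have H'm k : (k < m)%N -> H' k = H k by move=> km; rewrite /H' (ltn_eqF km).
have rH k : (k < m)%N -> d r (H k) = 0.
  by move=> km; rewrite /r ipBl /partial_sum (ip_comb_on (fun k => d (G n) (H k)) on) // subrr.
have hH k : (k < m)%N -> d h (H k) = 0 by move=> km; rewrite ipZl rH // mulr0.
have hh : d h h = 1.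
  rewrite ipZl ipZr nsqE; apply: complex_ext; rewrite /=; last by ring.
  by rewrite -[RHS]s2; ring.
have HH' x : in_span H m x -> in_span H' m.+1 x.
  apply: in_span_trans => k km; rewrite -H'm //; apply: in_span_gen; exact: ltnW.
exists m.+1, H'; split.
- move=> i j; rewrite !ltnS /H' => im jm.
  case: (eqVneq i m) im => [->|im'] im; case: (eqVneq j m) jm => [->|jm'] jm.
  + by rewrite hh.
  + by rewrite hH // ltn_neqAle jm'.
  + by rewrite (negbTE im') ipC hH ?conjc0 // ltn_neqAle im'.
  + by rewrite on // ltn_neqAle ?im' ?jm'.
- move=> k; rewrite ltnS leq_eqVlt => /orP[/eqP ->|kn]; last exact/HH'/GH.
  have -> : G n = (Num.sqrt (nsq r))%:C *: h + partial_sum H (G n) m.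
    rewrite /h scalerA (_ : _ * _ = 1) ?scale1r ?subrK //.
    apply: complex_ext; rewrite /=; last by ring.
    rewrite !mulr0 subr0 /s divff // gt_eqF // sqrtr_gt0 //.
  apply: in_spanD; last by apply: HH'; exists (fun k => d (G n) (H k)).
  by apply: in_spanZ; have := @in_span_gen H' m.+1 m (leqnn _); rewrite /H' eqxx.
- move=> k; rewrite ltnS leq_eqVlt /H' => /orP[/eqP ->|km].
    by rewrite eqxx; exact: in_spanZ.
  by rewrite (ltn_eqF km); exact: HGn.
- move=> ind; congr S; apply: mn => c cG k kn.
  have := ind (fun k => if (k < n)%N then c k else 0) _ k (ltnW kn).
  rewrite kn; apply; rewrite big_ord_recr /= ltnn scale0r addr0 -[RHS]cG.
  by apply: eq_bigr => j _; rewrite ltn_ord.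
Qed.

End InnerProductTheory.

(** * Orthonormal series, Parseval and Riesz representation in a complete inner product space *)

Section Completeness.
Context (R : realType) (V : lmodType R[i]) (d : inner_product V).
Implicit Types (x y z f g : V) (e u : nat -> V).

(** Convergence in norm, stated through [nsq] so that [V] carries no topology. *)
Definition tends u x := nsq d (x - u n) @[n --> \oo] --> (0 : R).

Definition complete_ip := forall u,
  (forall eps : R, 0 < eps -> exists N, forall m n,
    (N <= m)%N -> (N <= n)%N -> nsq d (u m - u n) <= eps) ->
  exists x, tends u x.

(** Identities pass to the limit in this form: the squared modulus of the defect is at most a
    constant times a squared distance that tends to 0. *)
Lemma cvg0_le (a c : R) (v : nat -> R) : v @ \oo --> (0 : R) ->
  (\forall n \near \oo, a <= c * v n) -> a <= 0.
Proof.
move=> v0 h; have cv : (fun n => c * v n) @ \oo --> (0 : R).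
  by rewrite -[X in _ --> X](mulr0 c); apply: cvgMr.
by apply: (cvgr_to_ge cv).
Qed.

Lemma tends_ip_eq0 u x z (c : R[i]) : tends u x ->
  (\forall n \near \oo, d (u n) z = c) -> d x z = c.
Proof.
move=> ux uc; apply/eqP; rewrite -subr_eq0; apply/eqP/sqnorm_eq0.
apply/eqP; rewrite eq_le sqnorm_ge0 andbT.
apply: (cvg0_le (c := nsq d z) ux); near=> n.
have <- : d (u n) z = c by near: n.
by rewrite -ipBl mulrC cauchy_schwarz.
Unshelve. all: by end_near. Qed.

Definition on_seq e := forall i j, d (e i) (e j) = (i == j)%:R.

Lemma on_seqW e n : on_seq e -> orthonormal d e n.
Proof. by move=> on i j _ _; apply: on. Qed.

Lemma nsq_combB e (b : nat -> R[i]) m n : on_seq e -> (n <= m)%N ->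
  nsq d (\sum_(k < m) b k *: e k - \sum_(k < n) b k *: e k)
   = \sum_(k < m) sqnorm (b k) - \sum_(k < n) sqnorm (b k).
Proof.
move=> on nm.
have E : \sum_(k < m) b k *: e k - \sum_(k < n) b k *: e k
    = \sum_(k < m) (if (k < n)%N then 0 else b k) *: e k.
  rewrite (big_ord_widen _ (fun k => b k *: e k) nm) [X in _ - X]big_mkcond -sumrB.
  by apply: eq_bigr => k _; case: ifP; rewrite ?subrr ?scale0r ?subr0.
rewrite E (nsq_comb (fun k => if (k < n)%N then 0 else b k) (on_seqW on)).
rewrite (big_ord_widen _ (fun k => sqnorm (b k)) nm) [X in _ - X]big_mkcond -sumrB.
by apply: eq_bigr => k _; case: ifP; rewrite ?subrr ?sqnorm0 ?subr0.
Qed.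

(** The squared distance of two partial sums is a difference of terms of a bounded monotone
    sequence, so the partial sums are Cauchy. *)
Lemma riesz_fischer e (b : nat -> R[i]) (B : R) : complete_ip -> on_seq e ->
  (forall n, \sum_(k < n) sqnorm (b k) <= B) ->
  exists x, tends (fun n => \sum_(k < n) b k *: e k) x /\
    forall k, d x (e k) = b k.
Proof.
move=> cpl on bB.
pose s n := \sum_(k < n) sqnorm (b k).
have s_nd : nondecreasing_seq s.
  by apply/nondecreasing_seqP => n; rewrite /s big_ord_recr /= lerDl sqnorm_ge0.
have s_cvg : cvgn s.
  by apply: nondecreasing_is_cvgn => //; exists B => _ [n _ <-]; exact: bB.
have s_le n : s n <= limn s by exact: nondecreasing_cvgn_le.
have [x ux] : exists x, tends (fun n => \sum_(k < n) b k *: e k) x.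
  apply: cpl => eps eps0.
  have [N _ hN] : \forall n \near \oo, limn s - s n <= eps.
    move/cvgrPdist_le : s_cvg => /(_ _ eps0); apply: filterS => n.
    by apply: le_trans; exact: ler_norm.
  exists N; suff W m n : (N <= n)%N -> (n <= m)%N ->
      nsq d (\sum_(k < m) b k *: e k - \sum_(k < n) b k *: e k) <= eps.
    move=> m n Nm Nn; case/orP: (leq_total n m) => nm; first exact: W.
    by rewrite -nsqN opprB; exact: W.
  move=> Nn nm; rewrite nsq_combB //; apply: le_trans (hN _ Nn).
  by rewrite lerD2r; exact: s_le.
(* The [k]-th coefficient of the partial sums is constant from [k.+1] on. *)
exists x; split=> // k; apply: (tends_ip_eq0 ux); exists k.+1 => // n /= kn.
by rewrite (ip_comb_on b (on_seqW on)).
Qed.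

(* [f] need only be orthogonal to the orthogonal complement of [e]: this covers
   both orthonormal bases and functions supported in one block of exponentials. *)
Lemma parseval e f : complete_ip -> on_seq e ->
  (forall g, (forall n, d g (e n) = 0) -> d f g = 0) ->
  tends (partial_sum d e f) f.
Proof.
move=> cpl on tot.
(* The expansion of [f] sums to some [x]. Then [f - x] is orthogonal to every [e n], hence to [x] as
   a limit of combinations and to [f] by [tot], hence to itself. *)
have [x [ux xe]] := riesz_fischer (b := fun k => d f (e k)) cpl on
  (fun n => bessel f (on_seqW on (n := n))).
suff xf : x = f by move: ux; rewrite xf.
have go n : d (f - x) (e n) = 0 by rewrite ipBl xe subrr.
have xg : d x (f - x) = 0.
  apply: (tends_ip_eq0 ux); apply: nearW => n; rewrite ip_suml big1 // => k _.
  by rewrite ipZl [d (e k) _]ipC go conjc0 mulr0.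
by apply/esym/eqP; rewrite -subr_eq0; apply/eqP/(@ip_eq0 _ _ d); rewrite ipBl xg tot // subrr.
Qed.

Lemma parseval_nsq e f : on_seq e -> tends (partial_sum d e f) f ->
  (fun n => \sum_(k < n) sqnorm (d f (e k))) @ \oo --> nsq d f.
Proof.
move=> on ft.
have -> : (fun n => \sum_(k < n) sqnorm (d f (e k))) =
    (fun n => nsq d f - nsq d (f - partial_sum d e f n)).
  by apply/funext => n; rewrite (nsq_residual f (on_seqW on)) subKr.
by rewrite -[X in _ --> X]subr0; apply: cvgB => //; exact: cvg_cst.
Qed.

Lemma parseval_ip e f g : tends (partial_sum d e f) f ->
  sqnorm (d f g - \sum_(k < n) d f (e k) * d (e k) g) @[n --> \oo] --> (0 : R).
Proof.
move=> ft; apply: (squeeze_cvgr _ (cvg_cst (0 : R))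
  (h := fun n => nsq d (f - partial_sum d e f n) * nsq d g)).
  apply: nearW => n; rewrite sqnorm_ge0 /=.
  have -> : d f g - \sum_(k < n) d f (e k) * d (e k) g = d (f - partial_sum d e f n) g.
    by rewrite ipBl ip_suml; congr (_ - _); apply: eq_bigr => k _; rewrite ipZl.
  exact: cauchy_schwarz.
by rewrite -[X in _ --> X](mul0r (nsq d g)); apply: cvgMl.
Qed.

(** The representative is the series of the [conjc (l (e k)) *: e k], which converges as soon as its
    coefficients are square summable. *)
Lemma riesz e (l : V -> R[i]) (B : R) : complete_ip -> on_seq e ->
  (forall a x y, l (a *: x + y) = a * l x + l y) ->
  (forall g, (forall n, d g (e n) = 0) -> g = 0) ->
  (forall x, sqnorm (l x) <= B * nsq d x) ->
  exists g, forall f, l f = d f g.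
Proof.
move=> cpl on lin tot lB.
have lD x y : l (x + y) = l x + l y by have := lin 1 x y; rewrite scale1r mul1r.
have l0 : l 0 = 0 by apply: (addrI (l 0)); rewrite -lD !addr0.
have lZ a x : l (a *: x) = a * l x by have := lin a x 0; rewrite l0 !addr0.
pose b k : R[i] := conjc (l (e k)).
have l_comb (a : nat -> R[i]) n : l (\sum_(k < n) a k *: e k) = \sum_(k < n) a k * l (e k).
  by rewrite (big_morph l lD l0); apply: eq_bigr => k _; rewrite lZ.
(* Testing [l] on the partial sum itself gives [S ^ 2 <= B * S]. The absolute value covers the case
   [S = 0], where [B] may be negative. *)
have bB n : \sum_(k < n) sqnorm (b k) <= `|B|.
  set S := \sum_(k < n) _.
  have S0 : 0 <= S by apply: sumr_ge0 => k _; exact: sqnorm_ge0.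
  have := lB (\sum_(k < n) b k *: e k).
  rewrite (nsq_comb b (on_seqW on)) -/S l_comb.
  have -> : \sum_(k < n) b k * l (e k) = S%:C.
    apply: complex_ext; rewrite ?Re_sum ?Im_sum /=.
      by apply: eq_bigr => k _; rewrite /b mulrC mul_conjc sqnorm_conj.
    by apply: big1 => k _; rewrite /b mulrC mul_conjc.
  rewrite /sqnorm /= expr0n addr0 => h.
  have [->//|Sn0] := eqVneq S 0.
  have Sp : 0 < S by rewrite lt_def Sn0.
  by apply: (le_trans _ (ler_norm B)); move: h; rewrite expr2 ler_pM2r.
have [g [_ ge]] := riesz_fischer cpl on bB.
exists g => f.
have ft : tends (partial_sum d e f) f.
  by apply: parseval => // h hn; rewrite (tot h hn) ip0r.
apply/eqP; rewrite -subr_eq0; apply/eqP/sqnorm_eq0/eqP; rewrite eq_le sqnorm_ge0 andbT.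
(* Both functionals agree on the partial sum [p], so their difference at [f] is their difference at
   [f - p]; the constant collects their bounds through [sqnormD]. *)
apply: (cvg0_le (c := 2 * B + 2 * nsq d g) ft); apply: nearW => n.
set p := partial_sum d e f n.
have lp : l p = d p g.
  rewrite /p /partial_sum (l_comb (fun k => d f (e k))) ip_suml; apply: eq_bigr => k _.
  by rewrite ipZl [d (e k) g]ipC ge /b conjcK.
have -> : l f - d f g = l (f - p) - d (f - p) g.
  by rewrite lD -scaleN1r lZ mulN1r ipDl ipZl mulN1r lp; ring.
apply: le_trans (sqnormD _ _) _; rewrite sqnormN.
have := lB (f - p); have := cauchy_schwarz d (f - p) g; nra.
Qed.

End Completeness.

(** * Complex integrals and the Hilbert space L2 *)

Section ComplexIntegral.
Context d (T : measurableType d) (R : realType).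
Variable m : {measure set T -> \bar R}.
Implicit Types f g : T -> R[i].

Definition cmeas f := measurable_fun [set: T] (fun t => Re (f t)) /\
  measurable_fun [set: T] (fun t => Im (f t)).

Definition cintegrable f := m.-integrable [set: T] (EFin \o (fun t => Re (f t))) /\
  m.-integrable [set: T] (EFin \o (fun t => Im (f t))).

Definition cint f : R[i] := (\int[m]_t Re (f t)) +i* (\int[m]_t Im (f t)).

Lemma cintegrable_meas f : cintegrable f -> cmeas f.
Proof. by move=> [/measurable_int/measurable_EFinP ? /measurable_int/measurable_EFinP ?]. Qed.

Lemma cmeas_cst z : cmeas (cst z).
Proof. by split; exact: measurable_cst. Qed.

Lemma cmeasD f g : cmeas f -> cmeas g -> cmeas (fun t => f t + g t).
Proof.
move=> [fr fi] [gr gi]; split.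
  by under eq_fun do rewrite ReD; exact: measurable_funD.
by under eq_fun do rewrite ImD; exact: measurable_funD.
Qed.

Lemma cmeasN f : cmeas f -> cmeas (fun t => - f t).
Proof.
move=> [fr fi]; split.
  by under eq_fun do rewrite ReN; exact: measurableT_comp.
by under eq_fun do rewrite ImN; exact: measurableT_comp.
Qed.

Lemma cmeasB f g : cmeas f -> cmeas g -> cmeas (fun t => f t - g t).
Proof. by move=> mf mg; apply: cmeasD => //; apply: cmeasN. Qed.

Lemma cmeas_conj f : cmeas f -> cmeas (fun t => conjc (f t)).
Proof.
move=> [fr fi]; split; first by under eq_fun do rewrite Re_conjc.
by under eq_fun do rewrite Im_conjc; exact: measurableT_comp.
Qed.

Lemma cmeasM f g : cmeas f -> cmeas g -> cmeas (fun t => f t * g t).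
Proof.
move=> [fr fi] [gr gi]; split.
  under eq_fun do rewrite ReM.
  by apply: measurable_funB; exact: measurable_funM.
under eq_fun do rewrite ImM.
by apply: measurable_funD; exact: measurable_funM.
Qed.

Lemma cmeas_sum I (s : seq I) (F : I -> T -> R[i]) : (forall i, cmeas (F i)) ->
  cmeas (fun t => \sum_(i <- s) F i t).
Proof.
move=> h; elim: s => [|i s ih].
  by under eq_fun do rewrite big_nil; exact: cmeas_cst.
by under eq_fun do rewrite big_cons; apply: cmeasD.
Qed.

Lemma cmeas_sqnorm f : cmeas f -> measurable_fun [set: T] (fun t => (sqnorm (f t))%:E).
Proof.
by move=> [mr mi]; apply/measurable_EFinP/measurable_funD; exact: measurable_funX.
Qed.

Lemma cmeas_re (r : T -> R) : measurable_fun [set: T] r -> cmeas (fun t => (r t)%:C).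
Proof. by move=> mr; split => //=; exact: measurable_cst. Qed.

(** Domination is stated between squares, which keeps square roots out of the later estimates. *)
Lemma cintegrable_le f (g : T -> R) : cmeas f -> m.-integrable [set: T] (EFin \o g) ->
  (forall t, sqnorm (f t) <= g t ^+ 2) -> cintegrable f.
Proof.
move=> [mr mi] ig fg.
have h (a : T -> R) : measurable_fun [set: T] a -> (forall t, a t ^+ 2 <= sqnorm (f t)) ->
    m.-integrable [set: T] (EFin \o a).
  move=> ma af; apply: (le_integrable _ _ _ ig) => //; first exact/measurable_EFinP.
  move=> t _; rewrite /= lee_fin -ler_sqr ?nnegrE // !real_normK ?num_real //.
  exact: le_trans (af t) (fg t).
by split; apply: h => // t; rewrite /sqnorm ?lerDl ?lerDr sqr_ge0.
Qed.

Lemma cintegrableD f g : cintegrable f -> cintegrable g -> cintegrable (fun t => f t + g t).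
Proof.
move=> [fr fi] [gr gi]; split.
  by apply: eq_integrable (integrableD _ fr gr) => // t _ /=; rewrite ReD.
by apply: eq_integrable (integrableD _ fi gi) => // t _ /=; rewrite ImD.
Qed.

Lemma cintegrableZ (a : R[i]) f : cintegrable f -> cintegrable (fun t => a * f t).
Proof.
move=> [fr fi]; split.
  have := integrableB measurableT (integrableZl measurableT (Re a) fr)
    (integrableZl measurableT (Im a) fi).
  by apply: eq_integrable => // t _ /=; rewrite ReM.
have := integrableD measurableT (integrableZl measurableT (Re a) fi)
  (integrableZl measurableT (Im a) fr).
by apply: eq_integrable => // t _ /=; rewrite ImM.
Qed.

Lemma cintegrable_sum I (s : seq I) (F : I -> T -> R[i]) : (forall i, cintegrable (F i)) ->
  cintegrable (fun t => \sum_(i <- s) F i t).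
Proof.
move=> h; elim: s => [|i s ih].
  under eq_fun do rewrite big_nil.
  by split; apply: eq_integrable (integrable0 _ _).
by under eq_fun do rewrite big_cons; apply: cintegrableD.
Qed.

Lemma cintD f g : cintegrable f -> cintegrable g ->
  cint (fun t => f t + g t) = cint f + cint g.
Proof.
move=> [fr fi] [gr gi]; rewrite /cint; apply: complex_ext; rewrite ?ReD ?ImD /=.
  by rewrite -RintegralD //; apply: eq_Rintegral => t _; rewrite ReD.
by rewrite -RintegralD //; apply: eq_Rintegral => t _; rewrite ImD.
Qed.

Lemma cintZ (a : R[i]) f : cintegrable f -> cint (fun t => a * f t) = a * cint f.
Proof.
move=> [fr fi]; apply: complex_ext; rewrite ?ReM ?ImM /=.
  rewrite -!RintegralZl // -RintegralB //; last 2 first.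
  - exact: (integrableZl measurableT (Re a) fr).
  - exact: (integrableZl measurableT (Im a) fi).
  by apply: eq_Rintegral => t _; rewrite ReM.
rewrite -!RintegralZl // -RintegralD //; last 2 first.
- exact: (integrableZl measurableT (Re a) fi).
- exact: (integrableZl measurableT (Im a) fr).
by apply: eq_Rintegral => t _; rewrite ImM.
Qed.

Lemma cint_conj f : cintegrable f -> cint (fun t => conjc (f t)) = conjc (cint f).
Proof.
move=> [fr fi]; apply: complex_ext => /=.
  by apply: eq_Rintegral => t _; rewrite Re_conjc.
rewrite -mulN1r -RintegralZl //.
by apply: eq_Rintegral => t _; rewrite Im_conjc mulN1r.
Qed.

Lemma cint_sum I (s : seq I) (F : I -> T -> R[i]) : (forall i, cintegrable (F i)) ->
  cint (fun t => \sum_(i <- s) F i t) = \sum_(i <- s) cint (F i).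
Proof.
move=> h; elim: s => [|i s ih].
  rewrite big_nil; under eq_fun do rewrite big_nil.
  rewrite /cint /Rintegral /= !integral0 /=; exact: complex_ext.
rewrite big_cons -ih -cintD //; last exact: cintegrable_sum.
by under eq_fun do rewrite big_cons.
Qed.

Lemma eq_cint f g : (forall t, f t = g t) -> cint f = cint g.
Proof. by move=> /funext ->. Qed.

Lemma ae_eq_cint f g : cmeas f -> cmeas g -> {ae m, forall t, f t = g t} ->
  cint f = cint g.
Proof.
have aeF := ae_filter_ringOfSetsType m.
move=> [fr fi] [gr gi] fg; rewrite /cint /Rintegral.
congr (fine _ +i* fine _); apply: ae_eq_integral => //;
  try exact/measurable_EFinP; apply: filterS fg => t ft _; by rewrite ft.
Qed.

Definition ccvg (z : nat -> R[i]) (w : R[i]) :=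
  (fun n => Re (z n)) @ \oo --> Re w /\ (fun n => Im (z n)) @ \oo --> Im w.

Lemma ccvg_sqnorm z w : ccvg z w -> (fun n => sqnorm (z n)) @ \oo --> sqnorm w.
Proof. by move=> [zr zi]; apply: cvgD; [exact: (cvgM zr zr)|exact: (cvgM zi zi)]. Qed.

Lemma dominated_cint (f_ : nat -> T -> R[i]) f (g : T -> R) :
  (forall n, cmeas (f_ n)) -> cmeas f ->
  (forall t, ccvg (f_ ^~ t) (f t)) ->
  m.-integrable [set: T] (EFin \o g) ->
  (forall n t, `|Re (f_ n t)| <= g t /\ `|Im (f_ n t)| <= g t) ->
  ccvg (fun n => cint (f_ n)) (cint f).
Proof.
move=> mf_ mf cf ig fg.
have h (a_ : nat -> T -> R) (a : T -> R) : (forall n, measurable_fun [set: T] (a_ n)) ->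
    measurable_fun [set: T] a -> (forall t, a_ ^~ t @ \oo --> a t) ->
    (forall n t, `|a_ n t| <= g t) ->
    (fun n => \int[m]_t a_ n t) @ \oo --> \int[m]_t a t.
  move=> ma_ ma ca ag.
  have cE : {ae m, forall t, [set: T] t -> (EFin \o a_ ^~ t) @ \oo --> (a t)%:E}.
    by apply: aeW => t _; apply: cvg_EFin; [exact: nearW|exact: ca].
  have bE : {ae m, forall t n, [set: T] t -> `|(a_ n t)%:E| <= (g t)%:E}%E.
    by apply: aeW => t n _; rewrite lee_fin.
  have [ia _ cvi] := @dominated_convergence _ _ _ m _ measurableT
    (fun n => EFin \o a_ n) (EFin \o a) (EFin \o g)
    (fun n => (measurable_EFinP _ _).2 (ma_ n)) ((measurable_EFinP _ _).2 ma) cE ig bE.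
  apply: fine_cvg; rewrite fineK; first exact: cvi.
  exact: integrable_fin_num ia.
split; apply: h => //=.
- by move=> n; case: (mf_ n).
- by case: mf.
- by move=> t; case: (cf t).
- by move=> n t; case: (fg n t).
- by move=> n; case: (mf_ n).
- by case: mf.
- by move=> t; case: (cf t).
- by move=> n t; case: (fg n t).
Qed.

End ComplexIntegral.

Section L2InnerProduct.
Context (R : realType).
Local Notation mu := (@lebesgue_measure R).
Implicit Types f g : L2fun R.

(* The carrier of a realType also has a default measurable structure; the domain
   of [mu] is [measurableTypeR R], whence the annotations below. *)
Lemma square_integrableP (f : R -> R[i]) : square_integrable f <->
  @cmeas _ (measurableTypeR R) R f /\ (\int[mu]_t (sqnorm (f t))%:E < +oo)%E.
Proof. by split=> [[]|[[]]]. Qed.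

Lemma L2fun_sq f : square_integrable f.
Proof. by case: f => f /= /L2predP. Qed.

Lemma L2fun_meas f : @cmeas _ (measurableTypeR R) R f.
Proof. by have [] := L2fun_sq f. Qed.

Lemma square_integrable_sqnorm (f : R -> R[i]) : square_integrable f ->
  mu.-integrable [set: R] (EFin \o (fun t => sqnorm (f t))).
Proof.
move=> /square_integrableP[mf lf]; apply/integrableP; split; first exact: cmeas_sqnorm.
by under eq_integral do rewrite /= ger0_norm ?sqnorm_ge0 //.
Qed.

(** The dominating function is [|f|^2 + |g|^2], because [a * b <= (a + b) ^ 2] for nonnegative [a]
    and [b]. *)
Lemma L2_prod_int (f g : R -> R[i]) : square_integrable f -> square_integrable g ->
  cintegrable mu (fun t => f t * conjc (g t)).
Proof.
move=> sf sg; have [mf _] := (square_integrableP f).1 sf.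
have [mg _] := (square_integrableP g).1 sg.
have ig : mu.-integrable [set: R] (EFin \o (fun t => sqnorm (f t) + sqnorm (g t))) :=
  integrableD measurableT (square_integrable_sqnorm sf) (square_integrable_sqnorm sg).
apply: (cintegrable_le _ ig).
  by apply: cmeasM => //; exact: cmeas_conj.
move=> t; rewrite sqnormM sqnorm_conj.
have := sqnorm_ge0 (f t); have := sqnorm_ge0 (g t); nra.
Qed.

Lemma dot_piE f g : dot (\pi_(L2 R) f) (\pi_(L2 R) g) = cint mu (fun t => f t * conjc (g t)).
Proof. by rewrite dot_pi. Qed.

Lemma piD f g : \pi_(L2 R) f + \pi_(L2 R) g = \pi_(L2 R) (f + g).
Proof. by rewrite raddfD. Qed.

Lemma piB f g : \pi_(L2 R) f - \pi_(L2 R) g = \pi_(L2 R) (f - g).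
Proof. by rewrite raddfB. Qed.

Lemma piZ (a : R[i]) f : a *: \pi_(L2 R) f = \pi_(L2 R) (a *: f).
Proof. exact: L2scale_pi. Qed.

Lemma pi_sum I (s : seq I) (F : I -> L2fun R) :
  \sum_(i <- s) \pi_(L2 R) (F i) = \pi_(L2 R) (\sum_(i <- s) F i).
Proof. by rewrite raddf_sum. Qed.

Lemma L2fun_sumE I (s : seq I) (F : I -> L2fun R) t :
  (\sum_(i <- s) F i) t = \sum_(i <- s) F i t.
Proof.
elim: s => [|i s ih]; first by rewrite !big_nil.
by rewrite !big_cons -ih.
Qed.

Lemma dotDl (x y z : L2 R) : dot (x + y) z = dot x z + dot y z.
Proof.
elim/quotW: x => x; elim/quotW: y => y; elim/quotW: z => z.
rewrite piD !dot_piE -cintD; try exact: L2_prod_int (L2fun_sq _) (L2fun_sq _).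
by apply: eq_cint => t; rewrite -mulrDl.
Qed.

Lemma dotZl a (x z : L2 R) : dot (a *: x) z = a * dot x z.
Proof.
elim/quotW: x => x; elim/quotW: z => z.
rewrite piZ !dot_piE -cintZ; last exact: L2_prod_int (L2fun_sq _) (L2fun_sq _).
by apply: eq_cint => t; rewrite mulrA.
Qed.

Lemma dotC (x y : L2 R) : dot y x = conjc (dot x y).
Proof.
elim/quotW: x => x; elim/quotW: y => y.
rewrite !dot_piE -cint_conj; last exact: L2_prod_int (L2fun_sq _) (L2fun_sq _).
by apply: eq_cint => t; rewrite conjcM conjcK mulrC.
Qed.

Lemma Re_dot_pi f : (Re (dot (\pi_(L2 R) f) (\pi_(L2 R) f)))%:E = (\int[mu]_t (sqnorm (f t))%:E)%E.
Proof.
rewrite dot_piE /= /Rintegral; under eq_integral do rewrite mul_conjc /=.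
rewrite fineK //; apply: integrable_fin_num => //.
exact: (square_integrable_sqnorm (L2fun_sq f)).
Qed.

Lemma dot_ge0 (x : L2 R) : 0 <= Re (dot x x).
Proof.
elim/quotW: x => x; rewrite -lee_fin Re_dot_pi.
by apply: integral_ge0 => t _; rewrite lee_fin sqnorm_ge0.
Qed.

Lemma L2_pi0 f : {ae mu, forall t, f t = 0} -> \pi_(L2 R) f = 0.
Proof.
move=> f0; rewrite -(raddf0 (\pi_(L2 R))); apply/L2_eqP/asboolP; exact: f0.
Qed.

Lemma L2_ae_eq f g : {ae mu, forall t, f t = g t} -> \pi_(L2 R) f = \pi_(L2 R) g.
Proof. by move=> fg; apply/L2_eqP/asboolP. Qed.

Lemma ae_sqnorm0 (f : R -> R[i]) : @cmeas _ (measurableTypeR R) R f ->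
  (\int[mu]_t (sqnorm (f t))%:E)%E = 0%E -> {ae mu, forall t, f t = 0}.
Proof.
have aeF := ae_filter_ringOfSetsType mu.
move=> mf; under eq_integral do rewrite -(@gee0_abs _ (_%:E)) ?lee_fin ?sqnorm_ge0 //.
move/(@ae_eq_integral_abs _ _ _ mu _ measurableT _ (cmeas_sqnorm mf)).1.
by apply: filterS => t /(_ I) [] /sqnorm_eq0.
Qed.

Lemma dot_eq0 (x : L2 R) : Re (dot x x) = 0 -> x = 0.
Proof.
elim/quotW: x => x h; apply/L2_pi0/ae_sqnorm0; first exact: L2fun_meas.
by rewrite -Re_dot_pi h.
Qed.

Definition L2ip : inner_product (L2 R) :=
  @InnerProduct R (L2 R) (@dot R) dotDl dotZl dotC dot_ge0 dot_eq0.

Lemma nsq_pi f : (nsq L2ip (\pi_(L2 R) f))%:E = (\int[mu]_t (sqnorm (f t))%:E)%E.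
Proof. exact: Re_dot_pi. Qed.

Lemma integral_sqnorm_ge0 (f : R -> R[i]) : (0 <= \int[mu]_t (sqnorm (f t))%:E)%E.
Proof. by apply: integral_ge0 => t _; rewrite lee_fin sqnorm_ge0. Qed.

Lemma integral_sqnormD (f g : R -> R[i]) :
  @cmeas _ (measurableTypeR R) R f -> @cmeas _ (measurableTypeR R) R g ->
  (\int[mu]_t (sqnorm (f t + g t))%:E <=
   2%:E * \int[mu]_t (sqnorm (f t))%:E + 2%:E * \int[mu]_t (sqnorm (g t))%:E)%E.
Proof.
move=> mf mg.
have m1 := cmeas_sqnorm mf; have m2 := cmeas_sqnorm mg.
apply: (@le_trans _ _ (\int[mu]_t (2%:E * (sqnorm (f t))%:E + 2%:E * (sqnorm (g t))%:E))%E).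
  apply: ge0_le_integral => //.
  - by move=> t _; rewrite lee_fin sqnorm_ge0.
  - by apply: cmeas_sqnorm; exact: cmeasD.
  - by apply: emeasurable_funD; exact: measurable_funeM.
  - by move=> t _; rewrite lee_fin sqnormD.
rewrite ge0_integralD //; first last.
- exact: measurable_funeM.
- by move=> t _; rewrite lee_fin mulr_ge0 ?sqnorm_ge0.
- exact: measurable_funeM.
- by move=> t _; rewrite lee_fin mulr_ge0 ?sqnorm_ge0.
by rewrite !ge0_integralZl_EFin // => t _; rewrite lee_fin sqnorm_ge0.
Qed.

Lemma square_integrable_le (f g : R -> R[i]) : square_integrable g ->
  @cmeas _ (measurableTypeR R) R f ->
  (forall t, sqnorm (f t) <= sqnorm (g t)) -> square_integrable f.
Proof.
move=> /square_integrableP[mg lg] mf fg; apply/square_integrableP; split => //.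
apply: le_lt_trans lg; apply: ge0_le_integral => //.
- by move=> t _; rewrite lee_fin sqnorm_ge0.
- exact: cmeas_sqnorm.
- exact: cmeas_sqnorm.
- by move=> t _; rewrite lee_fin.
Qed.

Lemma L2fun_integral_fin f : (\int[mu]_t (sqnorm (f t))%:E)%E \is a fin_num.
Proof.
rewrite ge0_fin_numE ?integral_sqnorm_ge0 //.
by have [_] := (square_integrableP _).1 (L2fun_sq f).
Qed.

End L2InnerProduct.

Section FatouBound.
Context d (T : measurableType d) (R : realType).
Variable m : {measure set T -> \bar R}.

(** Fatou's lemma for a pointwise limit. The bound holds only from some [N] on, so the lemma is
    applied to the sequence shifted by [N]. *)
Lemma fatou_le (g_ : nat -> T -> R) (g : T -> R) (c : \bar R) :
  (forall n, measurable_fun [set: T] (g_ n)) -> (forall n t, 0 <= g_ n t) ->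
  (forall t, g_ ^~ t @ \oo --> g t) ->
  (\forall n \near \oo, \int[m]_t (g_ n t)%:E <= c)%E ->
  (\int[m]_t (g t)%:E <= c)%E.
Proof.
move=> mg g0 gg [N _ hN].
have -> : (\int[m]_t (g t)%:E = \int[m]_t limn_einf (fun n => (g_ (n + N)%N t)%:E))%E.
  apply: eq_integral => t _; apply/esym.
  have cg : (fun n => (g_ (n + N)%N t)%:E) @ \oo --> (g t)%:E.
    apply: cvg_EFin; first exact: nearW.
    by have := gg t; rewrite -(cvg_shiftn N).
  exact: (cvg_limn_einf_sup cg).1.
apply: le_trans (fatou _ _ _ _) _ => //.
- by move=> n; apply/measurable_EFinP.
- by move=> n t _; rewrite lee_fin.
rewrite limn_einf_lim; apply: lime_le; first exact: is_cvg_einfs.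
apply: nearW => n; apply: le_trans (hN (n + N)%N _); last by rewrite /= leq_addl.
by apply: ereal_inf_lbound; exists n => /=.
Qed.

End FatouBound.

Lemma geometric_increment_cvg (R : realType) (x : nat -> R) (C : R) :
  (forall j, `|x j.+1 - x j| <= C * 2^-1 ^+ j) -> cvgn x.
Proof.
move=> h.
have -> : x = (fun n => x 0%N + series (telescope x) n).
  by apply/funext => n; rewrite -eq_sum_telescope.
apply: is_cvgD; first exact: is_cvg_cst.
apply: normed_cvg; apply: (@series_le_cvg _ _ (geometric C 2^-1)).
- by move=> n; rewrite /= normr_ge0.
- by move=> n; apply: le_trans (h n); rewrite normr_ge0.
- by move=> n /=; exact: h.
- by apply: is_cvg_geometric_series; rewrite ger0_norm ?invr_ge0 // invf_lt1 // ltr1n.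
Qed.

Section L2Complete.
Context (R : realType).
Local Notation mu := (@lebesgue_measure R).

(** The rate is split as [8 = 4 * 2]: after weighting the [j]-th squared increment by [4 ^ j] the
    integrals are still bounded by [2 ^ - j], hence summable, and the weight makes the increments
    themselves at most a multiple of [2 ^ - j] at almost every point. *)
Lemma ae_cvg_fast (r : nat -> L2fun R) :
  (forall j, (\int[mu]_t (sqnorm (r j.+1 t - r j t))%:E <= ((8^-1) ^+ j)%:E)%E) ->
  exists A : set R, [/\ measurable A, mu (~` A) = 0%E &
    forall t, A t -> cvgn (fun j => Re (r j t)) /\ cvgn (fun j => Im (r j t))].
Proof.
move=> h.
pose D j t := sqnorm (r j.+1 t - r j t).
pose a j t := ((4 ^+ j)%:E * (D j t)%:E)%E.
have mD j : measurable_fun [set: R] (fun t => (D j t)%:E).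
  by apply: cmeas_sqnorm; apply: cmeasB; exact: L2fun_meas.
have a0 j t : (0 <= a j t)%E by rewrite lee_fin mulr_ge0 ?exprn_ge0 ?sqnorm_ge0.
have ma j : measurable_fun [set: R] (a j) by exact: measurable_funeM.
(* [w] is integrable, hence finite almost everywhere, and where it is finite the
   increments of [r] decay geometrically. *)
pose w t := (\sum_(j <oo) a j t)%E.
have w0 t : (0 <= w t)%E by apply: nneseries_ge0 => ? _ _.
have mw : measurable_fun [set: R] w by exact: ge0_emeasurable_sum.
have iw : (\int[mu]_t w t < +oo)%E.
  rewrite integral_nneseries //.
  apply: (@le_lt_trans _ _ (\sum_(j <oo) (geometric 1 (2^-1) j)%:E)%E).
    apply: lee_nneseries; first by move=> j _ _; exact: integral_ge0.
    move=> j _.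
    rewrite ge0_integralZl_EFin // ?exprn_ge0 //; last 2 first.
    - by move=> t _; rewrite lee_fin sqnorm_ge0.
    - exact: mD.
    apply: le_trans (lee_wpmul2l _ (h j)) _; first by rewrite lee_fin exprn_ge0.
    rewrite -EFinM lee_fin -exprMn /= mul1r.
    by rewrite (_ : 4 * 8^-1 = 2^-1 :> R) //; lra.
  under eq_fun do rewrite sumEFin.
  have cg : cvgn (series (geometric (1 : R) 2^-1)).
    by apply: is_cvg_geometric_series; rewrite ger0_norm ?invr_ge0 // invf_lt1 // ltr1n.
  rewrite (_ : limn _ = (limn (series (geometric (1 : R) 2^-1)))%:E) ?ltry //.
  by apply/cvg_lim => //; apply: cvg_EFin => //; exact: nearW.
exists (w @^-1` [set x | x < +oo]%E); split.
- by rewrite -[X in measurable X]setTI; exact: emeasurable_fun_infty_o.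
- have wi : mu.-integrable [set: R] w.
    apply/integrableP; split => //.
    by under eq_integral do rewrite gee0_abs //.
  have [N [mN N0 sN]] := integrable_ae measurableT wi.
  apply: (subset_measure0 _ mN _ N0).
    apply: measurableC; rewrite -[X in measurable X]setTI; exact: emeasurable_fun_infty_o.
  move=> t /= wt; apply: sN => /= /(_ I); rewrite ge0_fin_numE //.
- move=> t /= wt.
  have W j : 4 ^+ j * D j t <= fine (w t).
    rewrite -lee_fin fineK ?ge0_fin_numE // EFinM.
    apply: le_trans (nneseries_lim_ge j.+1 _) => //.
    rewrite big_mkord big_ord_recr /= -[X in (X <= _)%E]add0e.
    by apply: leeD => //; apply: sume_ge0.
  have key (f : R[i] -> R) : (forall z w, f (z - w) = f z - f w) ->
      (forall z, f z ^+ 2 <= sqnorm z) -> cvgn (fun j => f (r j t)).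
    move=> fB fs; apply: (@geometric_increment_cvg _ _ (Num.sqrt (fine (w t)))) => j.
    rewrite -fB -[X in X <= _]sqrtr_sqr -[2^-1 ^+ j]ger0_norm ?exprn_ge0 ?invr_ge0 //.
    rewrite -[X in _ <= _ * X]sqrtr_sqr -sqrtrM ?fine_ge0 //.
    apply: ler_wsqrtr; apply: le_trans (fs _) _; rewrite -/(D j t).
    rewrite exprAC (_ : 2^-1 ^+ 2 = 4^-1 :> R); last by lra.
    by rewrite exprVn ler_pdivlMr ?exprn_gt0 // mulrC.
  by split; apply: key => [z v|z]; rewrite ?ReD ?ReN ?ImD ?ImN // /sqnorm ?lerDl ?lerDr sqr_ge0.
Qed.

Lemma L2_complete : complete_ip (L2ip R).
Proof.
move=> u cau.
have /choice[N hN] : forall j, exists N, forall m n, (N <= m)%N -> (N <= n)%N ->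
    nsq (L2ip R) (u m - u n) <= (8^-1) ^+ j.
  by move=> j; apply: cau; rewrite exprn_gt0 // invr_gt0.
(* The sum makes [phi] monotone and at least [N j]; the summand [j] makes it at least [j], which is
   needed to compare with late terms of [u]. *)
pose phi j := (j + \sum_(i < j.+1) N i)%N.
have phiN j : (N j <= phi j)%N.
  by rewrite /phi big_ord_recr /= addnA leq_addl.
have phiS j : (phi j <= phi j.+1)%N.
  by rewrite /phi [X in (_ <= _ + X)%N]big_ord_recr /= addSn leqW // addnA leq_addr.
pose rep n : L2fun R := repr (u n).
have nsq_rep m n : (nsq (L2ip R) (u m - u n))%:E = (\int[mu]_t (sqnorm (rep m t - rep n t))%:E)%E.
  by rewrite -[u m]reprK -[u n]reprK piB nsq_pi.
have [|A [mA A0 cA]] := @ae_cvg_fast (fun j => rep (phi j)).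
  move=> j; rewrite -nsq_rep lee_fin; apply: hN; last exact: phiN.
  exact: leq_trans (phiN j) (phiS j).
(* Cutting off to [A] changes the representatives on a null set only, and makes them converge at
   every point, as the measurability of the limit and [fatou_le] require. *)
pose v j t := (\1_A t)%:C * rep (phi j) t.
have mv j : @cmeas _ (measurableTypeR R) R (v j).
  apply: cmeasM; last exact: L2fun_meas.
  by apply: cmeas_re; exact: measurable_indic.
have vA j t : A t -> v j t = rep (phi j) t by move=> At; rewrite /v indicE mem_set // mul1r.
have vAC j t : ~ A t -> v j t = 0 by move=> At; rewrite /v indicE memNset // mul0r.
pose f t : R[i] := limn (fun j => Re (v j t)) +i* limn (fun j => Im (v j t)).
have cf t : ccvg (v ^~ t) (f t).
  rewrite /f; have [At|At] := pselect (A t).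
    have [cr ci] := cA t At.
    by split => /=; under eq_fun do rewrite vA //; [exact: cr|exact: ci].
  have E : v ^~ t = (fun=> 0) by apply/funext => j; rewrite vAC.
  split => /=.
    rewrite (_ : (fun j => Re (v j t)) = cst 0); first exact: is_cvg_cst.
    by apply/funext => j; rewrite vAC.
  rewrite (_ : (fun j => Im (v j t)) = cst 0); first exact: is_cvg_cst.
  by apply/funext => j; rewrite vAC.
have mf : @cmeas _ (measurableTypeR R) R f.
  split.
    apply: (measurable_fun_cvg (fun j => (mv j).1)) => t _; exact: (cf t).1.
  apply: (measurable_fun_cvg (fun j => (mv j).2)) => t _; exact: (cf t).2.
(* Fatou along the subsequence bounds the distance from [f] to every late term of [u], so the whole
   sequence converges. *)
have close eps : 0 < eps -> exists M, forall n, (M <= n)%N ->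
    (\int[mu]_t (sqnorm (f t - rep n t))%:E <= eps%:E)%E.
  move=> eps0; have [M hM] := cau _ eps0; exists M => n Mn.
  apply: (@fatou_le _ _ R mu (fun j t => sqnorm (v j t - rep n t))
    (fun t => sqnorm (f t - rep n t))).
  - by move=> j; apply/measurable_EFinP/cmeas_sqnorm/cmeasB; [exact: mv|exact: L2fun_meas].
  - by move=> j t; exact: sqnorm_ge0.
  - move=> t; apply: ccvg_sqnorm; have [cr ci] := cf t; split.
      by rewrite ReD; under eq_fun do rewrite ReD; apply: cvgD cr (cvg_cst _).
    by rewrite ImD; under eq_fun do rewrite ImD; apply: cvgD ci (cvg_cst _).
  - exists M => // j /= Mj.
    have -> : (\int[mu]_t (sqnorm (v j t - rep n t))%:E =
        \int[mu]_t (sqnorm (rep (phi j) t - rep n t))%:E)%E.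
      apply: ge0_ae_eq_integral => //.
      + by apply/cmeas_sqnorm/cmeasB; [exact: mv|exact: L2fun_meas].
      + by apply/cmeas_sqnorm/cmeasB; exact: L2fun_meas.
      + by move=> t _; rewrite lee_fin sqnorm_ge0.
      + by move=> t _; rewrite lee_fin sqnorm_ge0.
      exists (~` A); split => //; first exact: measurableC.
      by move=> t /=; apply: contra_not => At _; rewrite vA.
    rewrite -nsq_rep lee_fin; apply: hM => //.
    by apply: leq_trans Mj _; rewrite /phi leq_addr.
have [M hM] := close 1 ltr01.
have sqf : square_integrable f.
  apply/square_integrableP; split => //.
  have mM := L2fun_meas (rep M); have mB := cmeasB mf mM.
  rewrite (_ : (\int[mu]_t _ = \int[mu]_t (sqnorm ((f t - rep M t) + rep M t))%:E)%E).
    apply: le_lt_trans (integral_sqnormD mB mM) _.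
    apply: lte_add_pinfty; apply: lte_mul_pinfty => //.
    - exact: le_lt_trans (hM M (leqnn _)) (ltry _).
    - by have [_] := (square_integrableP _).1 (L2fun_sq (rep M)).
  by apply: eq_integral => t _; rewrite subrK.
exists (\pi_(L2 R) (MkL2fun ((L2predP f).2 sqf))).
apply/cvgrPdist_le => eps eps0; have [K hK] := close eps eps0.
exists K => // n /= Kn; rewrite sub0r normrN ger0_norm ?nsq_ge0 //.
by rewrite -[u n]reprK piB -lee_fin nsq_pi; exact: hK.
Qed.

End L2Complete.

(** * Fourier series on an interval *)

Section RealComplex.
Context (R : realType).
Implicit Types a b : R.

Lemma real_complexD a b : (a + b)%:C = a%:C + b%:C.
Proof. by apply: complex_ext; rewrite /= ?addr0. Qed.

Lemma real_complexM a b : (a * b)%:C = a%:C * b%:C.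
Proof. by apply: complex_ext; rewrite /=; ring. Qed.

Lemma sqnorm_real a : sqnorm (a%:C) = a * a.
Proof. by rewrite /sqnorm /= expr0n addr0 expr2. Qed.

End RealComplex.

Section SignPolynomials.
Context (R : realType).

(* On [-1, 1] the iterates of [(3 x - x ^ 3) / 2], whose fixed points are [-1], [0]
   and [1], stay bounded by [1] and converge to the sign of [x]. *)
Fixpoint sgpoly n : {poly R} :=
  if n is n'.+1 then (3 / 2) *: sgpoly n' - (1 / 2) *: sgpoly n' ^+ 3 else 'X.

Lemma sgpolyS n x : (sgpoly n.+1).[x] =
  3 / 2 * (sgpoly n).[x] - 1 / 2 * (sgpoly n).[x] ^+ 3.
Proof. by rewrite /= !(hornerE, horner_exp). Qed.

Lemma sgpolyN n x : (sgpoly n).[- x] = - (sgpoly n).[x].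
Proof.
elim: n => [|n ih]; first by rewrite /= !hornerX.
by rewrite !sgpolyS ih exprNn -signr_odd /= expr1; ring.
Qed.

(** With [y] the current iterate and [y'] the next, [1 - y' = (1 - y) * (1 - (y + y ^ 2) / 2)]. As
    the iterates increase from [x], the last factor is at most [1 - x / 2]. *)
Lemma sgpoly_bound n x : 0 <= x <= 1 ->
  [/\ x <= (sgpoly n).[x], (sgpoly n).[x] <= 1 & 1 - (sgpoly n).[x] <= (1 - x / 2) ^+ n].
Proof.
move=> /andP[x0 x1]; elim: n => [|n [h1 h2 h3]].
  by rewrite /= hornerX expr0; split => //; lra.
rewrite sgpolyS; set y := (sgpoly n).[x] in h1 h2 h3 *.
have y0 : 0 <= y by lra.
have e0 : 0 <= (1 - x / 2) ^+ n by apply: exprn_ge0; lra.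
have y2 : 0 <= y ^+ 2 by exact: sqr_ge0.
split.
- have : 0 <= y * (1 - y) * (1 + y) by rewrite !mulr_ge0 //; lra.
  by nra.
- have : 0 <= (1 - y) * (1 - y) * (2 + y) by rewrite !mulr_ge0 //; lra.
  by nra.
- apply: (@le_trans _ _ ((1 - x / 2) * (1 - y))).
    have : 0 <= (1 - y) * (y - x + y ^+ 2) by rewrite mulr_ge0 //; lra.
    by nra.
  by rewrite exprS ler_wpM2l //; lra.
Qed.

Lemma sgpoly_norm n x : `|x| <= 1 -> `|(sgpoly n).[x]| <= 1.
Proof.
wlog x0 : x / 0 <= x => [W h|].
  have [x0|x0] := leP 0 x; first exact: W.
  by rewrite -[x]opprK sgpolyN normrN; apply: W; rewrite ?normrN // oppr_ge0 ltW.
rewrite ger0_norm // => x1.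
have [|h1 h2 _] := @sgpoly_bound n x; first by rewrite x0.
by rewrite ger0_norm // (le_trans x0).
Qed.

Lemma sgpoly_cvg x : `|x| <= 1 -> (fun n => (sgpoly n).[x]) @ \oo --> Num.sg x.
Proof.
wlog x0 : x / 0 <= x => [W h|].
  have [x0|x0] := leP 0 x; first exact: W.
  rewrite -[x]opprK sgrN; under eq_fun do rewrite sgpolyN.
  by apply: cvgN; apply: W; rewrite ?normrN // oppr_ge0 ltW.
rewrite ger0_norm // => x1.
have [->|xn0] := eqVneq x 0.
  rewrite sgr0 (_ : (fun n => _) = cst 0); first exact: cvg_cst.
  apply/funext => n /=; have := sgpolyN n 0; rewrite oppr0 => h; lra.
have xp : 0 < x by rewrite lt_def xn0.
rewrite gtr0_sg //.
have c0 : (fun n => (1 - x / 2) ^+ n) @ \oo --> (0 : R).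
  by apply: cvg_expr; rewrite ger0_norm; lra.
apply: (@squeeze_cvgr _ _ _ _ (fun n => 1 - (1 - x / 2) ^+ n) (cst 1)).
- by apply: nearW => n; have [|_ h2 h3] := @sgpoly_bound n x; rewrite ?x0 // h2 andbT; lra.
- by rewrite -[X in _ --> X]subr0; apply: cvgB => //; exact: cvg_cst.
- exact: cvg_cst.
Qed.

End SignPolynomials.

Section Cis.
Context (R : realType).
Implicit Types x y : R.

Lemma cisD x y : cis (x + y) = cis x * cis y.
Proof. by apply: complex_ext; rewrite /= ?cosD ?sinD; ring. Qed.

Lemma cis0 : cis (0 : R) = 1.
Proof. by rewrite /cis cos0 sin0. Qed.

Lemma conjc_cis x : conjc (cis x) = cis (- x).
Proof. by rewrite /cis cosN sinN. Qed.

Lemma cisNK x : cis (- x) * cis x = 1.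
Proof. by rewrite -cisD addNr cis0. Qed.

Lemma cisX x n : cis x ^+ n = cis (n%:R * x).
Proof.
elim: n => [|n ih]; first by rewrite expr0 mul0r cis0.
by rewrite exprS ih -cisD -[n.+1%:R]natr1; congr cis; ring.
Qed.

Lemma cis_2pi (k : int) x : cis (x + k%:~R * (2 * pi)) = cis x.
Proof.
have H n y : cis (y + n%:R * (2 * pi)) = cis y.
  have E : n%:R * (2 * pi) = (pi *+ 2) *+ n :> R by rewrite !mulr_natl.
  rewrite /cis E; congr (_ +i* _).
    exact: (periodicn (@cosD2pi R)).
  exact: (periodicn (@sinD2pi R)).
case: k => n; first exact: H.
by rewrite NegzE mulrNz mulNr -{1}(H n.+1) subrK.
Qed.

Lemma cmeas_cis d (T : measurableType d) (f : T -> R) : measurable_fun [set: T] f ->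
  cmeas (fun t => cis (f t)).
Proof.
move=> mf; split => /=; apply: measurableT_comp => //; apply: continuous_measurable_fun.
  exact: continuous_cos.
exact: continuous_sin.
Qed.

End Cis.

Section BoundedMultiplier.
Context d (T : measurableType d) (R : realType).
Variable m : {measure set T -> \bar R}.

Lemma cintegrableM_bdd (F g : T -> R[i]) (B : R) : cintegrable m F -> cmeas g ->
  (forall t, sqnorm (g t) <= B) -> cintegrable m (fun t => F t * g t).
Proof.
move=> iF mg gB; have [iFr iFi] := iF.
(* On an empty [T] the bound [B] may be negative, and then [Num.sqrt B] would be of no use. *)
have [t0|B0] := pselect (exists t : T, True); last first.
  by apply: (cintegrable_le (cmeasM (cintegrable_meas iF) mg) iFr) => t; case: B0; exists t.
have B0 : 0 <= B by have [t _] := t0; exact: le_trans (sqnorm_ge0 _) (gB t).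
have iG : m.-integrable [set: T] (EFin \o (fun t => Num.sqrt B * (`|Re (F t)| + `|Im (F t)|))).
  have iS : m.-integrable [set: T] (fun t => (`|Re (F t)|)%:E + (`|Im (F t)|)%:E)%E :=
    integrableD measurableT (integrable_norm iFr) (integrable_norm iFi).
  exact: (integrableZl measurableT (Num.sqrt B) iS).
apply: (cintegrable_le _ iG).
  by apply: cmeasM => //; exact: cintegrable_meas iF.
move=> t; rewrite sqnormM exprMn sqr_sqrtr // mulrC ler_pM ?sqnorm_ge0 //.
rewrite /sqnorm sqrrD !real_normK ?num_real // addrAC lerDl.
by rewrite mulrn_wge0 // mulr_ge0.
Qed.

End BoundedMultiplier.

(** * Uniqueness of Fourier coefficients on a period *)

Section Circle.
Context (R : realType).
Local Notation mu := (@lebesgue_measure R).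

Lemma cos_gt_arc (x y : R) : y <= pi -> `|x| < y -> cos y < cos x.
Proof.
move=> ypi xy; have y0 := le_lt_trans (normr_ge0 x) xy.
by rewrite -(cos_norm x) ltr_cos // in_itv /= ?normr_ge0 ?(ltW y0) //= ltW // (lt_le_trans xy).
Qed.

Lemma cos_lt_arc (x y : R) : 0 <= y -> y < x -> x < 2 * pi - y -> cos x < cos y.
Proof.
move=> y0 yx xy; have [xpi|pix] := leP x pi.
  by rewrite ltr_cos // in_itv /=; apply/andP; split => //; lra.
have -> : cos x = cos (2 * pi - x).
  by rewrite -[RHS]cosN opprB mulr_natl -[RHS]cosD2pi subrK.
by rewrite ltr_cos ?in_itv /=; try (apply/andP; split); lra.
Qed.

(** Multiplication by the cosine moves the frequency [k] to [k + 1] and [k - 1], so the induction on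
    [q] has to carry all frequencies at once. *)
Lemma cint_trig_poly (F : R -> R[i]) (w phi : R) (q : {poly R}) : cintegrable mu F ->
  (forall k : int, cint mu (fun t => F t * cis (k%:~R * w * t)) = 0) ->
  cintegrable mu (fun t => F t * (q.[cos (w * t - phi)])%:C) /\
  forall k : int, cint mu (fun t => F t * (q.[cos (w * t - phi)])%:C * cis (k%:~R * w * t)) = 0.
Proof.
move=> iF F0; set u := fun t : R => cos (w * t - phi).
have mlin (b c : R) : measurable_fun [set: R] (fun t : R => b * t - c).
  by apply: measurable_funB => //; exact: measurable_funM.
have mcis (b : R) : cmeas (fun t : measurableTypeR R => cis (b * t)).
  by apply: cmeas_cis; exact: measurable_funM.
have mcu : cmeas (fun t : measurableTypeR R => (u t)%:C).
  apply: cmeas_re; apply: measurableT_comp (mlin w phi) => //.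
  by apply: continuous_measurable_fun; exact: continuous_cos.
have icis (G : R -> R[i]) (b : R) : cintegrable mu G -> cintegrable mu (fun t => G t * cis (b * t)).
  by move=> iG; apply: (cintegrableM_bdd (B := 1) iG (mcis b)) => t; rewrite sqnorm_cis.
have iq (p : {poly R}) : cintegrable mu (fun t => F t * (p.[u t])%:C).
  elim/poly_ind: p => [|p c ip].
    under eq_fun do rewrite horner0 mulr0.
    by split; apply: eq_integrable (integrable0 _ _).
  under eq_fun do rewrite hornerMXaddC real_complexD real_complexM mulrDr mulrA [_ * c%:C]mulrC.
  apply: cintegrableD; last exact: cintegrableZ.
  apply: (cintegrableM_bdd (B := 1) ip mcu) => t.
  by rewrite /sqnorm /= expr0n addr0 -real_normK ?num_real // expr_le1 // cos_max.
split; first exact: iq.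
elim/poly_ind: q => [|p c ip] k.
  under eq_fun do rewrite horner0 mulr0 mul0r.
  by rewrite /cint /Rintegral /= !integral0.
have E t : F t * ((p * 'X + c%:P).[u t])%:C * cis (k%:~R * w * t) =
    ((1 / 2)%:C * cis (- phi)) * (F t * (p.[u t])%:C * cis ((k + 1)%:~R * w * t)) +
    (((1 / 2)%:C * cis phi) * (F t * (p.[u t])%:C * cis ((k - 1)%:~R * w * t)) +
     c%:C * (F t * cis (k%:~R * w * t))).
  rewrite hornerMXaddC real_complexD real_complexM.
  have -> : (u t)%:C = (1 / 2)%:C * cis (- phi) * cis (w * t) +
      (1 / 2)%:C * cis phi * cis (- (w * t)).
    rewrite -!mulrA -!cisD /u; apply: complex_ext; rewrite /= ?(addrC phi).
      by rewrite !(cosD, cosN, sinN, sinD); field.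
    by rewrite !(cosD, cosN, sinN, sinD); ring.
  have -> : cis ((k + 1)%:~R * w * t) = cis (k%:~R * w * t) * cis (w * t).
    by rewrite -cisD intrD; congr cis; ring.
  have -> : cis ((k - 1)%:~R * w * t) = cis (k%:~R * w * t) * cis (- (w * t)).
    by rewrite -cisD intrB; congr cis; ring.
  ring.
under eq_fun do rewrite E.
have i1 b : cintegrable mu (fun t => F t * (p.[u t])%:C * cis (b * t)) by exact/icis/iq.
have i2 b : cintegrable mu (fun t => F t * cis (b * t)) by exact: icis.
rewrite cintD; [|exact: cintegrableZ (i1 _)|
  exact: cintegrableD (cintegrableZ _ (i1 _)) (cintegrableZ _ (i2 _))].
rewrite cintD; [|exact: cintegrableZ (i1 _)|exact: cintegrableZ (i2 _)].
rewrite !cintZ; [|exact: i2|exact: i1|exact: i1].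
by rewrite !ip F0 !mulr0 !addr0.
Qed.

(* The sign is a bounded pointwise limit of polynomials in the cosine, that is, of
   trigonometric polynomials. *)
Lemma cint_sg_cos (F : R -> R[i]) (w phi c : R) : cintegrable mu F -> `|c| <= 1 ->
  (forall k : int, cint mu (fun t => F t * cis (k%:~R * w * t)) = 0) ->
  cintegrable mu (fun t => F t * (Num.sg (cos (w * t - phi) - c))%:C) /\
  cint mu (fun t => F t * (Num.sg (cos (w * t - phi) - c))%:C) = 0.
Proof.
move=> iF c1 F0.
(* The factor 1/2 brings the argument into [-1, 1], where the iterates are controlled, and leaves
   its sign unchanged. *)
pose x t : R := 2^-1 * (cos (w * t - phi) - c).
have x1 t : `|x t| <= 1.
  rewrite normrM ger0_norm ?invr_ge0 // ler_pdivrMl // mulr1.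
  by apply: le_trans (ler_normB _ _) _; rewrite -[2]/(1 + 1) lerD // cos_max.
have sgx t : Num.sg (x t) = Num.sg (cos (w * t - phi) - c).
  by rewrite sgrM gtr0_sg ?mul1r // invr_gt0.
pose f_ n t := F t * ((sgpoly R n).[x t])%:C.
pose q n := sgpoly R n \Po (2^-1 *: ('X - c%:P)).
have qE n t : (q n).[cos (w * t - phi)] = (sgpoly R n).[x t].
  by rewrite /q horner_comp !(hornerE, hornerZ).
have if_ n : cintegrable mu (f_ n).
  have [+ _] := cint_trig_poly phi (q n) iF F0.
  by under eq_fun do rewrite qE.
have f_0 n : cint mu (f_ n) = 0.
  have [_ /(_ 0) <-] := cint_trig_poly phi (q n) iF F0.
  by apply: eq_cint => t; rewrite qE !mul0r cis0 mulr1.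
have mF := cintegrable_meas iF.
pose f t := F t * (Num.sg (cos (w * t - phi) - c))%:C.
have cf t : ccvg (f_ ^~ t) (f t).
  have h := sgpoly_cvg (x1 t); rewrite sgx in h.
  split; rewrite ?ReM ?ImM /=; under eq_fun do rewrite ?ReM ?ImM /= !mulr0.
    by rewrite mulr0; apply: cvgB; [exact: cvgMr|exact: cvg_cst].
  by rewrite mulr0; apply: cvgD; [exact: cvg_cst|exact: cvgMr].
have mf : @cmeas _ (measurableTypeR R) R f.
  split.
    apply: (measurable_fun_cvg (fun n => (cintegrable_meas (if_ n)).1)) => t _; exact: (cf t).1.
  apply: (measurable_fun_cvg (fun n => (cintegrable_meas (if_ n)).2)) => t _; exact: (cf t).2.
have [iFr iFi] := iF.
split.
  have ms : cmeas (fun t : measurableTypeR R => (Num.sg (cos (w * t - phi) - c))%:C).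
    apply: cmeas_re; apply: (measurable_fun_cvg (h := fun n t => (sgpoly R n).[x t])).
      move=> n; have E : (fun t => (sgpoly R n).[x t]) = (horner (sgpoly R n)) \o x by [].
      rewrite E; apply: measurableT_comp.
        by apply: continuous_measurable_fun; exact: continuous_horner.
      apply: measurable_funM => //; apply: measurable_funB => //.
      apply: measurableT_comp; first by apply: continuous_measurable_fun; exact: continuous_cos.
      by apply: measurable_funB => //; exact: measurable_funM.
    by move=> t _; rewrite -sgx; exact: sgpoly_cvg.
  apply: (cintegrableM_bdd (B := 1) iF ms) => t.
  rewrite /sqnorm /= expr0n addr0 -real_normK ?num_real // expr_le1 //.
  by rewrite normr_sg; case: eqP.
have ig : mu.-integrable [set: R] (EFin \o (fun t => `|Re (F t)| + `|Im (F t)|)) :=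
  integrableD measurableT (integrable_norm iFr) (integrable_norm iFi).
have [] := @dominated_cint _ _ _ mu f_ f _ (fun n => cintegrable_meas (if_ n)) mf cf ig.
  move=> n t; rewrite /f_ ReM ImM /= !mulr0 subr0 add0r !normrM.
  split; (apply: le_trans (ler_wpM2l _ (sgpoly_norm n (x1 t))) _); rewrite // mulr1.
    by rewrite lerDl.
  by rewrite lerDr.
under eq_fun do rewrite f_0; move=> h1.
under eq_fun do rewrite f_0; move=> h2.
apply: complex_ext => /=.
  by apply/esym/(cvg_unique _ (cvg_cst (0 : R)) h1).
by apply/esym/(cvg_unique _ (cvg_cst (0 : R)) h2).
Qed.

(** Signs of shifted cosines give the indicators of arcs, so [F] integrates to 0 over every
    half-line; Lebesgue differentiation of this constant primitive then gives [F = 0] almost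
    everywhere. *)
Lemma circle_unique (F : R -> R[i]) (a P : R) : 0 < P -> cintegrable mu F ->
  (forall t, ~~ (a <= t < a + P) -> F t = 0) ->
  (forall k : int, cint mu (fun t => F t * cis (k%:~R * (2 * pi / P) * t)) = 0) ->
  {ae mu, forall t, F t = 0}.
Proof.
move=> P0 iF Fout F0; set w := 2 * pi / P in F0.
have aeF := ae_filter_ringOfSetsType mu.
have mF := cintegrable_meas iF.
have wP : w * P = 2 * pi by rewrite /w mulfVK // gt_eqF.
have w0 : 0 < w by rewrite /w divr_gt0 // mulr_gt0 // pi_gt0.
(* The sign is 0 at the two endpoints of an arc, where it does not match the indicator. *)
have null2 (x y : R) (Q : R -> Prop) : (forall t, t != x -> t != y -> Q t) ->
    {ae mu, forall t, Q t}.
  move=> h; exists [set x; y]; split.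
  - by apply: measurableU; exact: measurable_set1.
  - by rewrite measureU0; [exact: lebesgue_measure_set1|exact: measurable_set1|
      exact: measurable_set1|exact: lebesgue_measure_set1].
  - move=> t /=; apply: contra_notP => /not_orP[tx ty].
    by apply: h; apply/eqP.
have cF : cint mu F = 0.
  by rewrite -(F0 0); apply: eq_cint => t; rewrite !mul0r cis0 mulr1.
have half (d : R) : cint mu (fun t => F t * (\1_(`]-oo, d]%classic : set R) t)%:C) = 0.
  have mind : cmeas (fun t : measurableTypeR R => F t * (\1_(`]-oo, d]%classic : set R) t)%:C).
    by apply: cmeasM => //; apply: cmeas_re; apply: measurable_indic; exact: measurable_itv.
  have indE (t : R) : (\1_(`]-oo, d]%classic : set R) t : R) = (t <= d)%R%:R.
    by rewrite indicE mem_setE in_itv.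
  have [da|ad] := leP d a.
    have -> : 0 = cint mu (cst (0 : R[i])) by rewrite /cint /Rintegral /= !integral0.
    have mc : @cmeas _ (measurableTypeR R) R (cst 0) by exact: cmeas_cst.
    apply: (ae_eq_cint mind mc).
    apply: (null2 a a) => t ta _; rewrite indE; have [td|] := leP t d; last by rewrite mulr0.
    rewrite Fout ?mul0r //; apply: contra ta => /andP[h _]; rewrite eq_le h andbT; lra.
  have [Pd|dP] := leP (a + P) d.
    rewrite -[RHS]cF; apply: eq_cint => t; rewrite indE.
    have [td|dt] := leP t d; first by rewrite mulr1.
    by rewrite Fout ?mul0r //; apply/negP => /andP[_ h]; lra.
  (* On one period, [cos (w * t - phi) - c] is positive exactly on ]a, d[. *)
  pose h := (d - a) / 2; pose c := cos (w * h); pose phi := w * ((a + d) / 2).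
  have [isg s0] := cint_sg_cos phi iF (cos_max (w * h) : `|c| <= 1) F0.
  (* Off the endpoints the indicator of the arc is [(1 + sg) / 2], and both [F] and its product with
     the sign integrate to 0. *)
  have -> : 0 = cint mu (fun t => (1 / 2)%:C * (F t + F t * (Num.sg (cos (w * t - phi) - c))%:C)).
    by rewrite cintZ ?cintD ?s0 ?cF ?addr0 ?mulr0 //; exact: cintegrableD.
  have msg := cmeasM (cmeas_cst (measurableTypeR R) (1 / 2)%:C) (cmeasD mF (cintegrable_meas isg)).
  apply: (ae_eq_cint mind msg).
  apply: (null2 a d) => t ta td; rewrite indE.
  have [|/Fout ->] := boolP (a <= t < a + P); last by rewrite !mul0r addr0 mulr0.
  move=> /andP[at_ tP].
  have {ta}at_ : a < t by rewrite lt_neqAle eq_sym ta.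
  have wh : w * h <= pi.
    have : w * h <= w * (P / 2) by rewrite ler_wpM2l ?(ltW w0) // /h; lra.
    by rewrite mulrA wP; lra.
  have wh0 : 0 <= w * h by rewrite mulr_ge0 ?(ltW w0) // /h; lra.
  have E : w * t - phi = w * (t - (a + d) / 2) by rewrite /phi; ring.
  rewrite E.
  case: (ltgtP t d) td => // td _.
    have cc : c < cos (w * (t - (a + d) / 2)).
      apply: cos_gt_arc => //; rewrite normrM gtr0_norm // ltr_pM2l // ltr_norml /h.
      by apply/andP; split; lra.
    by rewrite gtr0_sg ?subr_gt0 //; apply: complex_ext; rewrite !(ReM, ImM, ReD, ImD) /=; field.
  have cc : cos (w * (t - (a + d) / 2)) < c.
    apply: cos_lt_arc => //; first by rewrite ltr_pM2l // /h; lra.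
    by rewrite -wP -mulrBr ltr_pM2l // /h; lra.
  by rewrite ltr0_sg ?subr_lt0 //; apply: complex_ext; rewrite !(ReM, ImM, ReD, ImD) /=; field.
have key (G : R -> R) : mu.-integrable [set: R] (EFin \o G) ->
    (forall d, \int[mu]_t (G t * \1_(`]-oo, d]%classic : set R) t) = 0) ->
    {ae mu, forall t, G t = 0}.
  move=> iG G0.
  have lG : locally_integrable [set: R] G.
    by apply: open_integrable_locally => //; exact: openT.
  have iGd y : mu.-integrable `]-oo, y] (EFin \o G) by exact: integrableS iG.
  have := FTC1Ny iGd lG; apply: filterS => t [_ <-].
  rewrite (_ : (fun x : R => _) = cst 0); first by rewrite derive1_cst.
  apply/funext => x /=; rewrite -[RHS](G0 x) [LHS]Rintegral_mkcond.
  apply: eq_Rintegral => y _; rewrite patchE indicE.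
  by case: ifP => _; rewrite ?mulr1 ?mulr0.
have [iFr iFi] := iF.
have hr : {ae mu, forall t, Re (F t) = 0}.
  apply: key => // d; have /= h := congr1 Re (half d); rewrite -[RHS]h.
  by apply: eq_Rintegral => t _; rewrite ReM /= mulr0 subr0.
have hi : {ae mu, forall t, Im (F t) = 0}.
  apply: key => // d; have /= h := congr1 Im (half d); rewrite -[RHS]h.
  by apply: eq_Rintegral => t _; rewrite ImM /= mulr0 add0r.
by apply: filterS2 hr hi => t rt it; apply: complex_ext.
Qed.

End Circle.

Section Exponentials.
Context (R : realType).
Local Notation mu := (@lebesgue_measure R).

Lemma integral_derive (F f : R -> R) (a b : R) : a < b ->
  (forall x : R, is_derive x 1 F (f x)) -> continuous f ->
  (\int[mu]_(t in `[a, b]) f t) = F b - F a.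
Proof.
move=> ab dF cf.
have contF : continuous F.
  by move=> x; apply/differentiable_continuous/derivable1_diffP; exact: (dF x).(ex_derive).
rewrite /Rintegral (@continuous_FTC2 _ f F) //.
- by apply: continuous_subspaceT => x; exact: cf.
- split.
  + by move=> x _; have [] := dF x.
  + by apply: cvg_at_right_filter; exact: contF.
  + by apply: cvg_at_left_filter; exact: contF.
- by move=> x _; rewrite derive1E; exact: derive_val.
Qed.

Lemma Rintegral_indicM (f : R -> R) (A : set (measurableTypeR R)) : measurable A ->
  \int[mu]_t (\1_A t * f t) = \int[mu]_(t in A) f t.
Proof.
move=> mA; rewrite [RHS]Rintegral_mkcond; apply: eq_Rintegral => t _.
by rewrite patchE indicE; case: ifP => _; rewrite ?mul1r ?mul0r.
Qed.

Lemma integral_cis_period (a P b : R) (j : int) : 0 < P -> b * P = j%:~R * (2 * pi) -> j != 0 ->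
  \int[mu]_(t in `[a, a + P[) cos (b * t) = 0 /\
  \int[mu]_(t in `[a, a + P[) sin (b * t) = 0.
Proof.
move=> P0 bP j0.
have b0 : b != 0.
  apply: contra_neq j0 => b0; move: bP; rewrite b0 mul0r => /esym/eqP.
  by rewrite mulf_eq0 intr_eq0 => /orP[/eqP //|]; rewrite gt_eqF // mulr_gt0 // pi_gt0.
have aP : a < a + P by rewrite ltrDl.
have per : cis (b * (a + P)) = cis (b * a) by rewrite mulrDr bP cis_2pi.
have lin : continuous (fun t : R => b * t) by move=> x; apply: cvgMr; exact: cvg_id.
have ccos : continuous (fun t : R => cos (b * t)).
  by move=> x; apply: continuous_comp; [exact: lin|exact: continuous_cos].
have csin : continuous (fun t : R => sin (b * t)).
  by move=> x; apply: continuous_comp; [exact: lin|exact: continuous_sin].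
have opn (f : R -> R) : continuous f ->
    \int[mu]_(t in `[a, a + P[) f t = \int[mu]_(t in `[a, a + P]) f t.
  move=> cf; apply: Rintegral_itv_bndo_bndc.
  have iC : mu.-integrable `[a, a + P] (EFin \o f).
    apply: continuous_compact_integrable; first exact: segment_compact.
    by apply: continuous_subspaceT.
  apply: integrableS iC => //; by apply: subset_itvl; rewrite bnd_simp.
rewrite !opn //; split.
  have D (x : R) : is_derive x 1 (fun t : R => b^-1 * sin (b * t)) (cos (b * x)).
    by apply: is_derive_eq; rewrite /GRing.scale /=; field.
  have -> := integral_derive aP D ccos.
  by have /= -> := congr1 Im per; rewrite subrr.
have D (x : R) : is_derive x 1 (fun t : R => - b^-1 * cos (b * t)) (sin (b * x)).
  by apply: is_derive_eq; rewrite /GRing.scale /=; field.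
have -> := integral_derive aP D csin.
by have /= -> := congr1 Re per; rewrite subrr.
Qed.

End Exponentials.

(** Enumerates the integers as 0, -1, 1, -2, ...; orthonormal systems and series are indexed by
    [nat], frequencies by [int]. *)
Definition int_of_nat (n : nat) : int := if odd n then Negz n./2 else Posz n./2.
Definition nat_of_int (k : int) : nat :=
  match k with Posz n => n.*2 | Negz n => n.*2.+1 end.

Lemma nat_of_intK : cancel nat_of_int int_of_nat.
Proof.
by case=> n; rewrite /int_of_nat /= odd_double ?doubleK //= uphalf_double.
Qed.

Lemma int_of_natK : cancel int_of_nat nat_of_int.
Proof.
by move=> n; rewrite /int_of_nat -[RHS]odd_double_half; case: (odd n).
Qed.

Lemma nat_int_pair_bij : exists f : nat -> int * int, injective f /\ forall p, exists n, f n = p.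
Proof.
have /card_set_bijP[f [_ finj fsurj]] : ([set: nat] #= [set: nat * nat])%card.
  by rewrite card_eq_sym card_nat2.
exists (fun n => (int_of_nat (f n).1, int_of_nat (f n).2)); split.
  move=> m n [/(can_inj int_of_natK) h1 /(can_inj int_of_natK) h2].
  apply: finj; rewrite ?inE //.
  by move: h1 h2; case: (f m) => ? ?; case: (f n) => ? ? /= -> ->.
move=> [k l]; have [n _ fn] := fsurj (nat_of_int k, nat_of_int l) I.
by exists n; rewrite fn !nat_of_intK.
Qed.

Section ExponentialSystem.
Context (R : realType).
Local Notation mu := (@lebesgue_measure R).
Variables (P : R) (P0 : 0 < P).
Local Notation block a := (`[a, a + P[%classic : set (measurableTypeR R)).

(** The exponential of frequency [k / P], normalized in L2 of the block. Blocks are half-open so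
    that their translates by multiples of [P] tile the line. *)
Definition expo (a : R) (k : int) : R -> R[i] := fun t =>
  ((Num.sqrt P)^-1 * \1_(block a) t)%:C * cis (k%:~R * (2 * pi / P) * t).

Lemma measurable_block a : measurable (block a).
Proof. exact: measurable_itv. Qed.

Lemma measurable_block_indic a :
  measurable_fun [set: measurableTypeR R] (\1_(block a) : measurableTypeR R -> R).
Proof. exact: (@measurable_indic _ (measurableTypeR R) R setT _ (measurable_block a)). Qed.

Lemma cmeas_linear_cis (b : R) : cmeas (fun t : measurableTypeR R => cis (b * t)).
Proof. by apply: cmeas_cis; exact: measurable_funM. Qed.

Lemma cmeas_indic (A : set (measurableTypeR R)) : measurable A ->
  cmeas (fun t : measurableTypeR R => (\1_A t : R)%:C).
Proof. by move=> mA; apply: cmeas_re; exact: measurable_indic. Qed.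

Lemma cmeas_expo a k : @cmeas _ (measurableTypeR R) R (expo a k).
Proof.
apply: cmeasM; last exact: cmeas_linear_cis.
apply: cmeas_re; apply: measurable_funM => //; exact: measurable_block_indic.
Qed.

Lemma lebesgue_block a : mu (block a) = P%:E.
Proof.
rewrite lebesgue_measure_itv /= lte_fin ltrDl P0 -EFinB; congr EFin; ring.
Qed.

Lemma sqrtP2 : (Num.sqrt P)^-1 * (Num.sqrt P)^-1 = P^-1.
Proof. by rewrite -invfM -expr2 sqr_sqrtr ?ltW. Qed.

Lemma sqr_indic (A : set R) t : (\1_A t : R) * \1_A t = \1_A t.
Proof. by rewrite indicE -natrM mulnb andbb. Qed.

Lemma square_integrable_block (F : R -> R[i]) a (B : R) : @cmeas _ (measurableTypeR R) R F ->
  (forall t, sqnorm (F t) <= B * \1_(block a) t) -> square_integrable F.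
Proof.
move=> mF FB; apply/square_integrableP; split=> //.
have mI : measurable_fun [set: measurableTypeR R] (fun t => (\1_(block a) t : R)%:E).
  by apply/measurable_EFinP; exact: measurable_block_indic.
apply: (@le_lt_trans _ _ (\int[mu]_t (`|B|%:E * (\1_(block a) t)%:E))%E).
  apply: ge0_le_integral => //.
  - by move=> t _; rewrite lee_fin sqnorm_ge0.
  - exact: cmeas_sqnorm.
  - exact: measurable_funeM.
  - move=> t _; rewrite -EFinM lee_fin; apply: le_trans (FB t) _.
    by rewrite ler_wpM2r // ler_norm.
rewrite ge0_integralZl_EFin //.
rewrite (integral_indic mu measurableT (measurable_block a)).
by rewrite setIT [X in (_ * X)%E](_ : _ = P%:E) -?EFinM ?ltry //; exact: lebesgue_block.
Qed.

Lemma sqnorm_expo a k t : sqnorm (expo a k t) = P^-1 * \1_(block a) t.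
Proof.
rewrite sqnormM sqnorm_cis mulr1 /sqnorm /= expr0n addr0 expr2 mulrACA sqrtP2.
by rewrite sqr_indic.
Qed.

Lemma square_integrable_expo a k : square_integrable (expo a k).
Proof.
apply: (@square_integrable_block _ a P^-1); first exact: cmeas_expo.
by move=> t; rewrite sqnorm_expo.
Qed.

Definition expoL a k : L2fun R := MkL2fun ((L2predP _).2 (square_integrable_expo a k)).

Definition expo2 a k : L2 R := \pi_(L2 R) (expoL a k).

Lemma expo_ip a k l : dot (expo2 a k) (expo2 a l) = (k == l)%:R.
Proof.
rewrite dot_piE /=.
have E t : expo a k t * conjc (expo a l t) =
    (P^-1 * \1_(block a) t)%:C * cis ((k - l)%:~R * (2 * pi / P) * t).
  have -> : cis ((k - l)%:~R * (2 * pi / P) * t) =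
      cis (k%:~R * (2 * pi / P) * t) * conjc (cis (l%:~R * (2 * pi / P) * t)).
    by rewrite conjc_cis -cisD intrB; congr cis; ring.
  rewrite /expo conjcM mulrACA; congr (_ * _).
  have -> : conjc ((Num.sqrt P)^-1 * \1_(block a) t)%:C = ((Num.sqrt P)^-1 * \1_(block a) t)%:C.
    by apply: complex_ext; rewrite /= ?oppr0.
  by rewrite -real_complexM mulrACA sqrtP2 sqr_indic.
have -> : cint mu (fun t => expo a k t * conjc (expo a l t)) =
   (P^-1 * \int[mu]_(t in block a) cos ((k - l)%:~R * (2 * pi / P) * t)) +i*
   (P^-1 * \int[mu]_(t in block a) sin ((k - l)%:~R * (2 * pi / P) * t)).
  under eq_fun do rewrite E.
  have iE : cintegrable mu (fun t =>
      (\1_(block a) t : R)%:C * cis ((k - l)%:~R * (2 * pi / P) * t)).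
    apply: (cintegrableM_bdd (B := 1)) (cmeas_linear_cis _) _ => [|t]; last by rewrite sqnorm_cis.
    split => /=; last by apply: eq_integrable (integrable0 _ _).
    by apply: integrable_indic_itv.
  have -> : (fun t => (P^-1 * \1_(block a) t)%:C * cis ((k - l)%:~R * (2 * pi / P) * t)) =
     (fun t => (P^-1)%:C * ((\1_(block a) t)%:C * cis ((k - l)%:~R * (2 * pi / P) * t))).
    by apply/funext => t; rewrite real_complexM mulrA.
  rewrite (cintZ _ iE) -!(Rintegral_indicM _ (measurable_block a)).
  apply: complex_ext; rewrite /= !mul0r ?subr0 ?addr0; congr (_ * _);
    by apply: eq_Rintegral => t _; rewrite mul0r ?subr0 ?addr0.
have [->|kl] := eqVneq k l.
  rewrite subrr; under eq_Rintegral do rewrite mul0r mul0r cos0.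
  under [in X in _ +i* X]eq_Rintegral do rewrite mul0r mul0r sin0.
  rewrite !Rintegral_cst; try exact: measurable_block.
  rewrite (_ : fine _ = P); last exact: (congr1 fine (lebesgue_block a)).
  by rewrite mul0r mulr0 mul1r mulVf ?gt_eqF.
have [| |h1 h2] := @integral_cis_period _ a P ((k - l)%:~R * (2 * pi / P)) (k - l) P0.
- by rewrite -[LHS]mulrA mulfVK // gt_eqF.
- by rewrite subr_eq0.
by rewrite h1 h2 !mulr0.
Qed.

Lemma expo_ip_disjoint a b k l : block a `&` block b = set0 ->
  dot (expo2 a k) (expo2 b l) = 0.
Proof.
move=> ab0; rewrite dot_piE /=.
have E t : expo a k t * conjc (expo b l t) = 0.
  rewrite /expo; have [ta|ta] := pselect (block a t); last first.
    by rewrite indicE memNset // mulr0 !mul0r.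
  have tb : ~ block b t by move=> tb; have : (block a `&` block b) t by []; rewrite ab0.
  by rewrite [\1_(block b) t]indicE memNset // mulr0 mul0r conjc0 mulr0.
under eq_fun do rewrite E.
by rewrite /cint /Rintegral /= !integral0.
Qed.

Definition restr (A : set (measurableTypeR R)) (f : R -> R[i]) : R -> R[i] :=
  fun t => f t * (\1_A t)%:C.

Lemma expo_coef (f : L2fun R) a k : dot (\pi_(L2 R) f) (expo2 a k) =
  ((Num.sqrt P)^-1)%:C *
    cint mu (fun t => restr (block a) f t * cis ((- k)%:~R * (2 * pi / P) * t)).
Proof.
have i1 : square_integrable (fun t => (\1_(block a) t)%:C * cis (k%:~R * (2 * pi / P) * t)).
  apply: (@square_integrable_block _ a 1).
    apply: cmeasM; last exact: cmeas_linear_cis.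
    by apply: cmeas_indic; exact: measurable_block.
  by move=> t; rewrite sqnormM sqnorm_cis mulr1 /sqnorm /= expr0n addr0 expr2 sqr_indic mul1r.
have E t : conjc ((\1_(block a) t)%:C * cis (k%:~R * (2 * pi / P) * t)) =
    (\1_(block a) t)%:C * cis ((- k)%:~R * (2 * pi / P) * t).
  rewrite conjcM conjc_cis intrN !mulNr; congr (_ * _).
  by apply: complex_ext; rewrite /= ?oppr0.
have := L2_prod_int (L2fun_sq f) i1; under eq_fun do rewrite E mulrA.
move=> i2; rewrite dot_piE -cintZ //; apply: eq_cint => t.
rewrite -[expoL _ _ t]/(expo a k t).
have -> : expo a k t =
    ((Num.sqrt P)^-1)%:C * ((\1_(block a) t)%:C * cis (k%:~R * (2 * pi / P) * t)).
  by rewrite /expo real_complexM [RHS]mulrA.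
rewrite conjcM E /restr.
have -> : conjc ((Num.sqrt P)^-1)%:C = ((Num.sqrt P)^-1)%:C.
  by apply: complex_ext; rewrite /= ?oppr0.
by rewrite mulrCA; congr (_ * _); rewrite mulrA.
Qed.

Lemma expo_total (f : L2fun R) a : (forall k, dot (\pi_(L2 R) f) (expo2 a k) = 0) ->
  {ae mu, forall t, restr (block a) f t = 0}.
Proof.
move=> f0; apply: (@circle_unique R (restr (block a) f) a P P0).
- have i1 : square_integrable (fun t => (\1_(block a) t : R)%:C).
    apply: (@square_integrable_block _ a 1).
      by apply: cmeas_indic; exact: measurable_block.
    by move=> t; rewrite /sqnorm /= expr0n addr0 expr2 sqr_indic mul1r.
  have E t : f t * conjc (\1_(block a) t : R)%:C = restr (block a) f t.
    by congr (_ * _); apply: complex_ext; rewrite /= ?oppr0.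
  by have := L2_prod_int (L2fun_sq f) i1; under eq_fun do rewrite E.
- by move=> t ta; rewrite /restr indicE memNset ?mulr0 // => /=; rewrite in_itv /=; apply/negP.
- move=> k; have := f0 (- k); rewrite expo_coef opprK => /eqP.
  rewrite mulf_eq0 => /orP[|/eqP //].
  rewrite eq_complex /= => /andP[]; rewrite invr_eq0 gt_eqF // sqrtr_gt0 //.
Qed.

End ExponentialSystem.

Section Basis.
Context (R : realType).
Local Notation mu := (@lebesgue_measure R).

(** The exponentials of integer frequency on the unit blocks with integer endpoints, indexed by the
    pair of block and frequency. A function orthogonal to all of them vanishes almost everywhere on
    each of countably many blocks. *)
Lemma L2_has_orthonormal_basis : exists e : nat -> L2 R, orthonormal_basis e.
Proof.
have aeF := ae_filter_ringOfSetsType mu.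
have [g [ginj gsurj]] := nat_int_pair_bij.
exists (fun n => expo2 (@ltr01 R) ((g n).1%:~R) (g n).2); split.
  move=> m n; have [mn|mn] := eqVneq (g m).1 (g n).1.
    rewrite mn expo_ip; congr (_%:R); congr nat_of_bool.
    apply/eqP/eqP => [mn2|->//]; apply: ginj.
    by move: mn mn2; case: (g m) => ? ?; case: (g n) => ? ? /= -> ->.
  have -> : (m == n) = false by apply: contra_neqF mn => /eqP ->.
  apply: expo_ip_disjoint; rewrite -subset0 => t [] /=; rewrite !in_itv /=.
  move=> /andP[h1 h2] /andP[h3 h4].
  have h5 : (g m).1%:~R < (g n).1%:~R + 1 :> R by lra.
  have h6 : (g n).1%:~R < (g m).1%:~R + 1 :> R by lra.
  move: h5 h6; rewrite -(intrD _ _ 1) -(intrD _ (g m).1 1) !ltr_int !ltzD1 => h5 h6.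
  by move: mn; rewrite eq_le h5 h6.
elim/quotW => f f0; apply: L2_pi0.
have h (m : int) : {ae mu, forall t, restr (`[m%:~R, m%:~R + 1[%classic) f t = 0}.
  apply: (@expo_total R 1 ltr01 f m%:~R) => k.
  by have [n gn] := gsurj (m, k); have := f0 n; rewrite gn.
have hn : {ae mu, forall t, forall n,
    restr (`[(int_of_nat n)%:~R, (int_of_nat n)%:~R + 1[%classic) f t = 0}.
  by apply/ae_foralln => n; exact: h.
apply: filterS hn => t /(_ (nat_of_int (Num.floor t))); rewrite nat_of_intK /restr indicE.
by rewrite mem_set ?mulr1 //= in_itv /= floor_le -(intrD _ _ 1) floorD1_gt.
Qed.

End Basis.

(** * Plancherel *)

Section ParametricIntegral.
Context d1 (T1 : measurableType d1) (R : realType).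
Local Notation mu := (@lebesgue_measure R).

(** Tonelli applies to the positive and the negative part separately; where the difference is
    infinite, [fine] returns 0, which preserves measurability. *)
Lemma measurable_Rintegral (g : T1 * measurableTypeR R -> R) :
  measurable_fun [set: T1 * measurableTypeR R] g ->
  measurable_fun [set: T1] (fun z => \int[mu]_t g (z, t)).
Proof.
move=> mg; rewrite /Rintegral; apply: measurableT_comp => //.
under eq_fun do rewrite integralE.
have mE : measurable_fun [set: T1 * measurableTypeR R] (EFin \o g) by exact/measurable_EFinP.
have mp := measurable_funepos mE; have mn := measurable_funeneg mE.
have p0 z : (0 <= (EFin \o g)^\+ z)%E by exact: funepos_ge0.
have n0 z : (0 <= (EFin \o g)^\- z)%E by exact: funeneg_ge0.
apply: emeasurable_funB.
  apply: eq_measurable_fun (measurable_fun_fubini_tonelli_F (m2 := mu) _ mp p0) => z _.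
  by apply: eq_integral => t _; rewrite !funeposE.
apply: eq_measurable_fun (measurable_fun_fubini_tonelli_F (m2 := mu) _ mn n0) => z _.
by apply: eq_integral => t _; rewrite !funenegE.
Qed.

Lemma cmeas_cint (G : T1 * measurableTypeR R -> R[i]) : cmeas G ->
  cmeas (fun z => cint mu (fun t => G (z, t))).
Proof.
by move=> [mr mi]; split => /=; [exact: (measurable_Rintegral mr)|exact: (measurable_Rintegral mi)].
Qed.

End ParametricIntegral.

Section Fourier.
Context (R : realType).
Local Notation mu := (@lebesgue_measure R).

Definition fhat (f : R -> R[i]) (y : R) : R[i] :=
  cint mu (fun t => f t * cis (- (2 * pi * y) * t)).

Lemma cmeas_fhat (f : R -> R[i]) : @cmeas _ (measurableTypeR R) R f ->
  @cmeas _ (measurableTypeR R) R (fhat f).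
Proof.
move=> mf; apply: (@cmeas_cint _ (measurableTypeR R) R
  (fun z : measurableTypeR R * measurableTypeR R => f z.2 * cis (- (2 * pi * z.1) * z.2))).
have m1 : measurable_fun [set: measurableTypeR R * measurableTypeR R] fst by exact: measurable_fst.
have m2 : measurable_fun [set: measurableTypeR R * measurableTypeR R] snd by exact: measurable_snd.
have mlin : measurable_fun [set: measurableTypeR R] (fun y : R => - (2 * pi * y)).
  by apply: measurableT_comp => //; exact: measurable_funM.
apply: cmeasM.
  by have [mr mi] := mf; split; [exact: (measurableT_comp mr m2)|exact: (measurableT_comp mi m2)].
by apply: cmeas_cis; apply: measurable_funM => //; exact: (measurableT_comp mlin m1).
Qed.

Lemma square_integrable_cis (f : R -> R[i]) (b : R) : square_integrable f ->
  square_integrable (fun t => f t * cis (b * t)).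
Proof.
move=> /square_integrableP[mf lf]; apply/square_integrableP; split.
  by apply: cmeasM => //; exact: cmeas_linear_cis.
by under eq_integral do rewrite sqnormM sqnorm_cis mulr1.
Qed.

Section Block.
Variables (P : R) (P0 : 0 < P) (a : R).
Local Notation block := (`[a, a + P[%classic : set (measurableTypeR R)).

(** Modulating [f] by [- y] turns its Fourier coefficients into samples of [fhat f] on the shifted
    lattice [y + k / P]. *)
Lemma fhat_expo (f : L2fun R) (y : R) (k : int) :
  (forall t, ~ block t -> f t = 0) ->
  dot (\pi_(L2 R) (MkL2fun ((L2predP _).2 (square_integrable_cis (- (2 * pi * y)) (L2fun_sq f)))))
    (expo2 P0 a k) = ((Num.sqrt P)^-1)%:C * fhat f (y + k%:~R / P).
Proof.
move=> f0; rewrite expo_coef; congr (_ * _); apply: eq_cint => t.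
rewrite /restr /= indicE; have [ta|ta] := pselect (block t).
  rewrite mem_set // mulr1 -mulrA -cisD; congr (_ * cis _).
  by rewrite intrN; ring.
by rewrite f0 // !mul0r.
Qed.

Lemma block_parseval (f : L2fun R) (y : R) : (forall t, ~ block t -> f t = 0) ->
  (\sum_(n <oo) (sqnorm (fhat f (y + (int_of_nat n)%:~R / P)))%:E =
   P%:E * \int[mu]_t (sqnorm (f t))%:E)%E.
Proof.
have aeF := ae_filter_ringOfSetsType mu.
move=> f0; pose b := - (2 * pi * y).
pose fy := MkL2fun ((L2predP _).2 (square_integrable_cis b (L2fun_sq f))).
pose e n := expo2 P0 a (int_of_nat n).
have on : on_seq (L2ip R) e.
  move=> i j; rewrite -[LHS]/(dot _ _) expo_ip; congr (_%:R); congr nat_of_bool.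
  by apply/eqP/eqP => [/(can_inj int_of_natK)|->].
(* A [g] orthogonal to the exponentials of one block vanishes only there, but [fy] vanishes
   elsewhere. *)
have tot g : (forall n, L2ip R g (e n) = 0) -> L2ip R (\pi_(L2 R) fy) g = 0.
  elim/quotW: g => g g0; rewrite -[LHS]/(dot _ _) dot_piE.
  have h : {ae mu, forall t, restr block g t = 0}.
    by apply: (@expo_total R P P0 g a) => k; rewrite -[k]nat_of_intK; exact: g0.
  have [ii _] := L2_prod_int (L2fun_sq fy) (L2fun_sq g).
  transitivity (cint mu (cst 0)); last by rewrite /cint /Rintegral /= !integral0.
  apply: ae_eq_cint.
  - apply: cmeasM; first exact: L2fun_meas.
    by apply: cmeas_conj; exact: L2fun_meas.
  - exact: cmeas_cst.
  apply: filterS h => t; rewrite /restr indicE.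
  have [ta|ta] := pselect (block t).
    by rewrite mem_set // mulr1 => ->; rewrite conjc0 mulr0.
  by move=> _; rewrite /= f0 // !mul0r.
have pt := parseval (@L2_complete R) on tot.
have := parseval_nsq on pt; rewrite -[X in _ --> X]/(fine (nsq _ _)%:E) nsq_pi.
have -> : (\int[mu]_t (sqnorm (fy t))%:E = \int[mu]_t (sqnorm (f t))%:E)%E.
  by apply: eq_integral => t _; rewrite /= sqnormM sqnorm_cis mulr1.
have Ifin := L2fun_integral_fin f.
move=> cv; apply/cvg_lim => //.
have -> : (fun n => \sum_(0 <= i < n) (sqnorm (fhat f (y + (int_of_nat i)%:~R / P)))%:E)%E =
    (fun n => (P * \sum_(k < n) sqnorm (L2ip R (\pi_(L2 R) fy) (e k)))%:E).
  apply/funext => n; rewrite sumEFin big_mkord mulr_sumr; congr EFin; apply: eq_bigr => k _.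
  rewrite -[L2ip R _ _]/(dot _ _) /e fhat_expo // sqnormM.
  by rewrite sqnorm_real mulrA sqrtP2 // mulfV ?mul1r // gt_eqF.
rewrite -(fineK Ifin) -EFinM; apply: cvg_EFin; first exact: nearW.
exact: cvgMr.
Qed.

(** The only lattice shift of the cell that contains [y] has index [floor (y * P)]. *)
Lemma tile_sum (y : R) :
  (\sum_(n <oo) (\1_(`[0%R, P^-1[%classic : set R) (y - (int_of_nat n)%:~R / P)%R : R)%:E = 1%:E)%E.
Proof.
have E k : (\1_(`[0%R, P^-1[%classic : set R) (y - k%:~R / P) : R) = (k == Num.floor (y * P))%:R.
  rewrite indicE; congr (_%:R); congr nat_of_bool; rewrite mem_setE in_itv /=.
  rewrite eq_sym floor_eq intrD.
  have -> : y - k%:~R / P = (y * P - k%:~R) / P by rewrite mulrBl mulfK ?gt_eqF.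
  by rewrite pmulr_lge0 ?invr_gt0 // ltr_pdivrMr // mulVf ?gt_eqF // subr_ge0 ltrBlDl.
set n0 := nat_of_int (Num.floor (y * P)).
rewrite (@nneseriesD1 _ _ n0) //.
rewrite E nat_of_intK eqxx eseries0 ?adde0 // => k _ /=.
move=> kn; rewrite E; suff -> : (int_of_nat k == Num.floor (y * P)) = false by [].
by apply: contraNF kn => /eqP h; apply/eqP; rewrite /n0 -h int_of_natK.
Qed.

(** Insert the partition of unity [tile_sum], integrate term by term, translate each term back to
    the cell at 0 and sum again; nonnegativity permits both exchanges. *)
Lemma integral_tile (psi : R -> R) : measurable_fun [set: measurableTypeR R] psi ->
  (forall y, 0 <= psi y) ->
  (\int[mu]_y (psi y)%:E = \int[mu]_y ((\1_(`[0%R, P^-1[%classic : set R) y)%:E *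
     \sum_(n <oo) (psi (y + (int_of_nat n)%:~R / P))%:E))%E.
Proof.
move=> mpsi psi0; set J := `[0%R, P^-1[%classic : set (measurableTypeR R).
have mJ : measurable J by exact: measurable_itv.
have mI : measurable_fun [set: measurableTypeR R] (\1_J : measurableTypeR R -> R).
  exact: (@measurable_indic _ (measurableTypeR R) R setT _ mJ).
have msh (c : R) (g : R -> R) : measurable_fun [set: measurableTypeR R] g ->
    measurable_fun [set: measurableTypeR R] (fun y => g (y + c)).
  by move=> mg; exact: (measurableT_comp mg (measurable_translate c)).
transitivity (\int[mu]_y (\sum_(n <oo) (psi y * \1_J (y - (int_of_nat n)%:~R / P))%:E))%E.
  apply: eq_integral => y _; under eq_eseriesr do rewrite EFinM.
  by rewrite nneseriesZl ?tile_sum ?mule1 // => n _; rewrite lee_fin indicE.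
rewrite integral_nneseries //; last 2 first.
- by move=> n; apply/measurable_EFinP; apply: measurable_funM => //; exact: msh.
- by move=> n y _; rewrite lee_fin mulr_ge0 // indicE.
transitivity (\sum_(n <oo) \int[mu]_y (psi (y + (int_of_nat n)%:~R / P) * \1_J y)%:E)%E.
  apply: eq_eseriesr => n _; set c := _ / P.
  rewrite -(@ge0_integral_translate R c (fun y => (psi y * \1_J (y - c))%:E)) //.
  - by apply: eq_integral => y _; rewrite addrK.
  - by apply/measurable_EFinP; apply: measurable_funM => //; exact: msh.
  - by move=> y; rewrite lee_fin mulr_ge0 // indicE.
rewrite -integral_nneseries //; last 2 first.
- by move=> n; apply/measurable_EFinP; apply: measurable_funM => //; exact: msh.
- by move=> n y _; rewrite lee_fin mulr_ge0 // indicE.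
apply: eq_integral => y _; rewrite -nneseriesZl; last by move=> n _; rewrite lee_fin.
by apply: eq_eseriesr => n _; rewrite -EFinM mulrC.
Qed.

(* Parseval holds for each shifted lattice [y + k / P]; averaging it over
   [0 <= y < 1 / P] turns the sum into an integral over the line. *)
Lemma plancherel_block (f : L2fun R) : (forall t, ~ block t -> f t = 0) ->
  (\int[mu]_y (sqnorm (fhat f y))%:E = \int[mu]_t (sqnorm (f t))%:E)%E.
Proof.
move=> f0; rewrite (@integral_tile (fun y => sqnorm (fhat f y))); last 2 first.
- by apply/measurable_EFinP/cmeas_sqnorm/cmeas_fhat; exact: L2fun_meas.
- by move=> y; exact: sqnorm_ge0.
under eq_integral do rewrite block_parseval //.
have Ifin := L2fun_integral_fin f.
have I0 : (0 <= \int[mu]_t (sqnorm (f t))%:E)%E by exact: integral_sqnorm_ge0.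
have mJ : measurable (`[0%R, P^-1[%classic : set (measurableTypeR R)) by exact: measurable_itv.
rewrite ge0_integralZr //; last 2 first.
- by apply/measurable_EFinP; exact: (@measurable_indic _ (measurableTypeR R) R setT _ mJ).
- by rewrite mule_ge0 // lee_fin ltW.
rewrite (integral_indic mu measurableT mJ) setIT.
rewrite [X in (X * _)%E](_ : _ = (P^-1)%:E); last first.
  rewrite -[LHS]/(mu (`[0%R, P^-1[%classic : set (measurableTypeR R))) lebesgue_measure_itv /=.
  by rewrite lte_fin invr_gt0 P0 -EFinB subr0.
by rewrite muleA -EFinM mulVf ?gt_eqF // mul1e.
Qed.

End Block.
End Fourier.

Section PlancherelLower.
Context (R : realType).
Local Notation mu := (@lebesgue_measure R).
Local Notation RR := (measurableTypeR R).

Lemma restr_in (A : set RR) (f : R -> R[i]) t : A t -> restr A f t = f t.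
Proof. by move=> At; rewrite /restr indicE mem_set // mulr1. Qed.

Lemma restr_out (A : set RR) (f : R -> R[i]) t : ~ A t -> restr A f t = 0.
Proof. by move=> At; rewrite /restr indicE memNset // mulr0. Qed.

Lemma cintegrable_restr (A : set RR) (f : R -> R[i]) : measurable A -> cintegrable mu f ->
  cintegrable mu (restr A f).
Proof.
move=> mA iF; apply: (cintegrableM_bdd (B := 1) iF (cmeas_indic mA)) => t.
by rewrite sqnorm_real sqr_indic indicE; case: (_ \in _).
Qed.

Lemma cintegrable_cis (f : R -> R[i]) (b : R) : cintegrable mu f ->
  cintegrable mu (fun t => f t * cis (b * t)).
Proof.
by move=> iF; apply: (cintegrableM_bdd (B := 1) iF (cmeas_linear_cis b)) => t; rewrite sqnorm_cis.
Qed.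

Lemma fhatB (f g : R -> R[i]) y : cintegrable mu f -> cintegrable mu g ->
  fhat (fun t => f t - g t) y = fhat f y - fhat g y.
Proof.
move=> iF iG; set b := - (2 * pi * y).
have iG' := cintegrable_cis b iG.
have := cintD (cintegrable_cis b iF) (cintegrableZ (-1) iG').
rewrite (cintZ (-1) iG') mulN1r => <-.
by apply: eq_cint => t; rewrite mulN1r mulrBl.
Qed.

Lemma fhat_dominated (f_ : nat -> R -> R[i]) (f : R -> R[i]) y :
  cintegrable mu f -> (forall n, cintegrable mu (f_ n)) ->
  (forall n t, f_ n t = f t \/ f_ n t = 0) ->
  (forall t, \forall n \near \oo, f_ n t = f t) ->
  ccvg (fun n => fhat (f_ n) y) (fhat f y).
Proof.
move=> iF iF_ Fd Fc; set b := - (2 * pi * y); have [ir ii] := iF.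
apply: (@dominated_cint _ _ _ mu (fun n t => f_ n t * cis (b * t)) (fun t => f t * cis (b * t))
  (fun t => `|Re (f t)| + `|Im (f t)|)).
- by move=> n; exact: cintegrable_meas (cintegrable_cis _ (iF_ n)).
- exact: cintegrable_meas (cintegrable_cis _ iF).
- move=> t; split; apply: cvg_near_cst; near=> n;
    rewrite (_ : f_ n t = f t) //; near: n; exact: Fc.
- exact: (integrableD measurableT (integrable_norm ir) (integrable_norm ii)).
- have mle (x c : R) : `|c| <= 1 -> `|x * c| <= `|x| by move=> c1; rewrite normrM ler_piMr.
  move=> n t; have bnd z : `|Re (z * cis (b * t))| <= `|Re z| + `|Im z| /\
      `|Im (z * cis (b * t))| <= `|Re z| + `|Im z|.
    rewrite ReM ImM /=; split.
      by apply: le_trans (ler_normB _ _) _; apply: lerD; apply: mle; rewrite ?cos_max ?sin_max.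
    by apply: le_trans (ler_normD _ _) _; apply: lerD; apply: mle; rewrite ?cos_max ?sin_max.
  case: (Fd n t) => ->; first exact: bnd.
  by rewrite mul0r /= normr0 addr_ge0.
Unshelve. all: by end_near. Qed.

(* The factor 4 is not optimal; any constant would do for the dimension count. *)
Lemma plancherel_lower (h : R -> R[i]) : square_integrable h -> cintegrable mu h ->
  (\int[mu]_t (sqnorm (h t))%:E <= 4%:E * \int[mu]_y (sqnorm (fhat h y))%:E)%E.
Proof.
move=> sh ih; have mh := cintegrable_meas ih.
pose P n : R := n.+1%:R + n.+1%:R.
have P0 n : 0 < P n by rewrite addr_gt0.
pose B n : set RR := `[- n.+1%:R, - n.+1%:R + P n[%classic.
have mB n : measurable (B n) by exact: measurable_itv.
have BE n t : B n t <-> - n.+1%:R <= t < n.+1%:R.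
  by rewrite /B /P /= in_itv /= addKr.
have Bm n m t : (n <= m)%N -> B n t -> B m t.
  move=> nm /BE/andP[h1 h2]; apply/BE.
  have : n.+1%:R <= m.+1%:R :> R by rewrite ler_nat.
  by move=> h3; apply/andP; split; lra.
pose hn n := restr (B n) h.
have ihn n : cintegrable mu (hn n) by exact: cintegrable_restr.
have mhn n := cintegrable_meas (ihn n).
have hn_cases n t : hn n t = h t \/ hn n t = 0.
  by have [Bt|Bt] := pselect (B n t); [left; exact: restr_in|right; exact: restr_out].
have hn_eq t : \forall n \near \oo, hn n t = h t.
  near=> n; apply: restr_in; apply/BE.
  have : `|t| < n.+1%:R.
    apply: (@lt_trans _ _ n%:R); last by rewrite ltr_nat.
    by near: n; exact: nbhs_infty_gtr.
  by rewrite ltr_norml => /andP[h1 h2]; rewrite (ltW h1).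
have shn n : square_integrable (hn n).
  apply: square_integrable_le sh (mhn n) _ => t.
  by case: (hn_cases n t) => ->; rewrite ?sqnorm0 ?sqnorm_ge0.
(* The squared norm of the truncation error. *)
pose T n := (\int[mu]_t (sqnorm (h t - hn n t))%:E)%E.
have T0 : T @ \oo --> 0%E.
  have c1 : {ae mu, forall t, [set: RR] t -> (fun n => (sqnorm (h t - hn n t))%:E) @ \oo --> 0%E}.
    apply: aeW => t _; apply: cvg_near_cst; near=> n.
    by rewrite (_ : hn n t = h t) ?subrr ?sqnorm0 //; near: n; exact: hn_eq.
  have c2 : {ae mu, forall t n, [set: RR] t ->
      `|(sqnorm (h t - hn n t))%:E| <= (sqnorm (h t))%:E}%E.
    apply: aeW => t n _; rewrite gee0_abs lee_fin ?sqnorm_ge0 //.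
    by case: (hn_cases n t) => ->; rewrite ?subrr ?subr0 ?sqnorm0 ?sqnorm_ge0.
  have [_ _] := @dominated_convergence _ RR R mu setT measurableT
    (fun n t => (sqnorm (h t - hn n t))%:E) (cst 0%E) (fun t => (sqnorm (h t))%:E)
    (fun n => cmeas_sqnorm (cmeasB mh (mhn n))) (measurable_cst _)
    c1 (square_integrable_sqnorm sh) c2.
  by rewrite integral0.
(* The difference of two truncations lives on the larger block, where Plancherel is an equality;
   [tail] then lets [m] tend to infinity by Fatou. *)
have diff n m : (n <= m)%N ->
    (\int[mu]_y (sqnorm (fhat (hn m) y - fhat (hn n) y))%:E <= T n)%E.
  move=> nm; pose g t := hn m t - hn n t.
  have gE t : sqnorm (g t) <= sqnorm (h t - hn n t).
    rewrite /g; have [Bt|Bt] := pselect (B m t); first by rewrite {1}/hn restr_in.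
    have Bnt : ~ B n t by move=> /(Bm _ _ _ nm).
    by rewrite /hn !restr_out // subr0 sqnorm0 sqnorm_ge0.
  have sg : square_integrable g.
    apply: square_integrable_le sh (cmeasB (mhn m) (mhn n)) _ => t.
    apply: le_trans (gE t) _.
    by case: (hn_cases n t) => ->; rewrite ?subrr ?subr0 ?sqnorm0 ?sqnorm_ge0.
  have gB t : ~ B m t -> g t = 0.
    move=> Bt; have Bnt : ~ B n t by move=> /(Bm _ _ _ nm).
    by rewrite /g /hn !restr_out // subr0.
  under eq_integral do rewrite -fhatB //.
  have := @plancherel_block R (P m) (P0 m) (- m.+1%:R) (MkL2fun ((L2predP _).2 sg)) gB.
  move=> /= ->; apply: ge0_le_integral => //.
  - by move=> t _; rewrite lee_fin sqnorm_ge0.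
  - by apply: cmeas_sqnorm; exact: cmeasB.
  - by apply: cmeas_sqnorm; exact: cmeasB.
  - by move=> t _; rewrite lee_fin.
have mfh : @cmeas _ RR R (fhat h) by exact: cmeas_fhat.
have mfhn n : @cmeas _ RR R (fhat (hn n)) by exact: cmeas_fhat.
have tail n : (\int[mu]_y (sqnorm (fhat h y - fhat (hn n) y))%:E <= T n)%E.
  apply: (@fatou_le _ RR R mu (fun m y => sqnorm (fhat (hn m) y - fhat (hn n) y))
    (fun y => sqnorm (fhat h y - fhat (hn n) y))).
  - by move=> m; apply/measurable_EFinP/cmeas_sqnorm/cmeasB.
  - by move=> m t; exact: sqnorm_ge0.
  - move=> y; apply: ccvg_sqnorm.
    have [cr ci] := @fhat_dominated hn h y ih ihn hn_cases hn_eq.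
    split; [rewrite ReD; under eq_fun do rewrite ReD|rewrite ImD; under eq_fun do rewrite ImD].
      by apply: cvgD cr (cvg_cst _).
    by apply: cvgD ci (cvg_cst _).
  - by exists n => // m /= nm; exact: diff.
set I := (\int[mu]_t (sqnorm (h t))%:E)%E; set K := (\int[mu]_y (sqnorm (fhat h y))%:E)%E.
have K0 : (0 <= K)%E by exact: integral_sqnorm_ge0.
have alg (x y : \bar R) : (0 <= x)%E -> (0 <= y)%E ->
    (2%:E * y + 2%:E * (2%:E * x + 2%:E * y) <= 4%:E * x + 6%:E * y)%E.
  move=> x0 y0; rewrite ge0_muleDr ?mule_ge0 ?lee_fin // !muleA -!EFinM addeCA.
  rewrite -ge0_muleDl ?lee_fin // -EFinD (_ : 2 * 2 = 4 :> R); last by ring.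
  by rewrite (_ : 2 + 4 = 6 :> R) //; ring.
(* Two uses of [sqnormD], one on each side of the Fourier transform: the first gives [2 T n] and
   twice the squared norm of [hn n], the second bounds that norm by [2 K + 2 T n]. *)
have step n : (I <= 4%:E * K + 6%:E * T n)%E.
  have Tn0 : (0 <= T n)%E by exact: integral_sqnorm_ge0.
  have h1 : (I <= 2%:E * T n + 2%:E * \int[mu]_t (sqnorm (hn n t))%:E)%E.
    rewrite (_ : I = \int[mu]_t (sqnorm ((h t - hn n t) + hn n t))%:E)%E.
      by apply: integral_sqnormD => //; exact: cmeasB.
    by apply: eq_integral => t _; rewrite subrK.
  have h2 : (\int[mu]_t (sqnorm (hn n t))%:E = \int[mu]_y (sqnorm (fhat (hn n) y))%:E)%E.
    apply/esym/(@plancherel_block R (P n) (P0 n) (- n.+1%:R) (MkL2fun ((L2predP _).2 (shn n)))).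
    by move=> t; exact: restr_out.
  have h3 : (\int[mu]_y (sqnorm (fhat (hn n) y))%:E <= 2%:E * K + 2%:E * T n)%E.
    rewrite (_ : (\int[mu]_y (sqnorm (fhat (hn n) y))%:E =
        \int[mu]_y (sqnorm (fhat h y + (fhat (hn n) y - fhat h y)))%:E)%E); last first.
      by apply: eq_integral => y _; rewrite addrC subrK.
    apply: le_trans (integral_sqnormD mfh (cmeasB (mfhn n) mfh)) _.
    apply: leeD => //; apply: lee_wpmul2l; first by rewrite lee_fin.
    apply: le_trans (tail n); rewrite le_eqVlt; apply/orP; left; apply/eqP.
    by apply: eq_integral => y _; rewrite -sqnormN opprB.
  apply: le_trans h1 _; rewrite h2.
  apply: (@le_trans _ _ (2%:E * T n + 2%:E * (2%:E * K + 2%:E * T n)))%E.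
    by apply: leeD => //; apply: lee_wpmul2l h3; rewrite lee_fin.
  exact: alg.
(* For infinite [K] the claim is trivial; otherwise [step] passes to the limit. *)
have [Kfin|] := boolP (K \is a fin_num); last first.
  rewrite ge0_fin_numE // -leNgt leye_eq => /eqP ->.
  by rewrite mulry gtr0_sg // mul1e leey.
have cv : (fun n => 4%:E * K + 6%:E * T n)%E @ \oo --> (4%:E * K + 6%:E * 0)%E.
  apply: cvgeD; first by rewrite mule0 ?fin_num_adde_defl //.
    exact: cvg_cst.
  by apply: cvgeZl.
rewrite mule0 adde0 in cv.
have cvE : limn (fun n => 4%:E * K + 6%:E * T n)%E = (4%:E * K)%E by exact/cvg_lim.
rewrite -cvE; apply: lime_ge; first by apply/cvg_ex; exists (4%:E * K)%E.
exact: nearW.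
Unshelve. all: by end_near. Qed.

End PlancherelLower.

(** * Traces and the Fourier-Wigner transform *)

Section Translation.
Context (R : realType).
Local Notation mu := (@lebesgue_measure R).
Local Notation RR := (measurableTypeR R).

Lemma Rintegral_translate (c : R) (f : R -> R) : measurable_fun [set: RR] f ->
  \int[mu]_t f (t + c) = \int[mu]_t f t.
Proof.
move=> mf; rewrite /Rintegral; congr fine.
have mE : measurable_fun [set: RR] (EFin \o f) by exact/measurable_EFinP.
rewrite [LHS]integralE [RHS]integralE; congr (_ - _)%E.
  rewrite -(@ge0_integral_translate R c ((EFin \o f)^\+)%E).
  - by apply: eq_integral => t _; rewrite !funeposE.
  - exact: measurable_funepos.
  - by move=> t; exact: funepos_ge0.
rewrite -(@ge0_integral_translate R c ((EFin \o f)^\-)%E).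
- by apply: eq_integral => t _; rewrite !funenegE.
- exact: measurable_funeneg.
- by move=> t; exact: funeneg_ge0.
Qed.

Lemma cint_translate (c : R) (f : R -> R[i]) : @cmeas _ RR R f ->
  cint mu (fun t => f (t + c)) = cint mu f.
Proof.
move=> [mr mi]; apply: complex_ext => /=.
  exact: (Rintegral_translate c mr).
exact: (Rintegral_translate c mi).
Qed.

Definition rhoL (x y : R) (f : L2fun R) : L2fun R := MkL2fun (rho_fun_L2 x y 1 f).

Lemma rho_piE x y (f : L2fun R) : rho x y 1 (\pi_(L2 R) f) = \pi_(L2 R) (rhoL x y f).
Proof. exact: rho_pi. Qed.

(** The factor [exp(pi i x y)] in [rho] symmetrizes the phase, so that taking the adjoint leaves no
    scalar behind. *)
Lemma rho_adjoint x y (f g : L2 R) : dot (rho x y 1 f) g = dot f (rho (- x) (- y) 1 g).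
Proof.
elim/quotW: f => f; elim/quotW: g => g; rewrite !rho_piE !dot_piE.
have mf := L2fun_meas f; have mg := L2fun_meas g.
have mt : measurable_fun [set: RR] (translate (- x)) by exact: measurable_translate.
have mgt : @cmeas _ RR R (fun t => g (t - x)).
  by have [gr gi] := mg; split; [exact: (measurableT_comp gr mt)|exact: (measurableT_comp gi mt)].
rewrite -[LHS](cint_translate (- x)); last first.
  apply: cmeasM; last exact: cmeas_conj.
  exact: L2fun_meas (rhoL x y f).
apply: eq_cint => t; rewrite /= /rho_fun !mul1r subrK !conjcM conjc_cis.
have -> : - (pi * (- x * - y + 2 * - y * t)) = pi * (x * y + 2 * y * (t - x)) by ring.
ring.
Qed.

Lemma adjoint_rho x y (g : L2 R) : adjoint (rho x y 1) g = rho (- x) (- y) 1 g.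
Proof.
rewrite /adjoint; case: xgetP => [h _ /= hP|/(_ (rho (- x) (- y) 1 g)) /=]; last first.
  by case; move=> f; exact: rho_adjoint.
apply/eqP; rewrite -subr_eq0; apply/eqP/(@ip_eq0 _ _ (L2ip R)).
rewrite -[LHS]/(nsq (L2ip R) _); set z := h - _.
have : L2ip R z z = 0 by rewrite {2}/z ipBr -[L2ip R z h]/(dot z h) -hP rho_adjoint subrr.
by rewrite /nsq => ->.
Qed.

Lemma nsq_rho x y (f : L2 R) : nsq (L2ip R) (rho x y 1 f) = nsq (L2ip R) f.
Proof.
elim/quotW: f => f; apply/eqP; rewrite -(inj_eq (@EFin_inj _)) rho_piE !nsq_pi; apply/eqP.
have mf := L2fun_meas f.
rewrite -(@ge0_integral_translate R x (fun t => (sqnorm (f t))%:E)).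
- by apply: eq_integral => t _; rewrite /= /rho_fun mul1r sqnormM sqnorm_cis mul1r.
- exact: cmeas_sqnorm.
- by move=> t; rewrite lee_fin sqnorm_ge0.
Qed.

End Translation.

Section Trace.
Context (R : realType).
Local Notation mu := (@lebesgue_measure R).

Lemma sqnorm_cvg (z : nat -> R[i]^o) (w : R[i]^o) :
  (fun n => sqnorm (w - z n)) @ \oo --> (0 : R) -> z @ \oo --> w.
Proof.
move=> h; apply/cvgrPdist_lt => eps eps0.
(* Radii in [R[i]] are complex numbers; a positive one is real. *)
have [e0 eE] : 0 < Re eps /\ eps = (Re eps)%:C.
  by case: eps eps0 => a b; rewrite ltcE /= => /andP[/eqP -> ?].
have e2 : 0 < Re eps ^+ 2 by rewrite exprn_gt0.
move/cvgrPdist_lt: h => /(_ _ e2).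
apply: filterS => n; rewrite sub0r normrN ger0_norm ?sqnorm_ge0 // => hn.
rewrite eE normc_def ltcR -[X in _ < X]gtr0_norm // -sqrtr_sqr ltr_sqrt //.
Qed.

Lemma cvg_bigsum I (s : seq I) (z : I -> nat -> R[i]^o) (w : I -> R[i]^o) :
  (forall i, z i @ \oo --> w i) ->
  (fun n => \sum_(i <- s) z i n) @ \oo --> \sum_(i <- s) w i.
Proof.
move=> zw; elim: s => [|i s ih].
  by rewrite big_nil; under eq_fun do rewrite big_nil; exact: cvg_cst.
have E : (fun n => \sum_(j <- i :: s) z j n) = (fun n => z i n + \sum_(j <- s) z j n).
  by apply/funext => n; rewrite big_cons.
by rewrite E big_cons; apply: (cvgD (zw i) ih).
Qed.

(** In any orthonormal basis the series splits into [N] series, each of which is the Parseval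
    expansion of one [dot (v i) (k i)]. *)
Lemma trace_rank_sum (N : nat) (v k : 'I_N -> L2 R) (Y : L2 R -> L2 R) :
  (forall f, Y f = \sum_(i < N) dot f (k i) *: v i) ->
  trace Y = \sum_(i < N) dot (v i) (k i).
Proof.
move=> YE; set c := \sum_(i < N) _.
have cc e : orthonormal_basis e ->
    series (fun n => dot (Y (e n)) (e n) : R[i]^o) @ \oo --> (c : R[i]^o).
  move=> [on tot].
  have pt i : tends (L2ip R) (partial_sum (L2ip R) e (v i)) (v i).
    apply: (parseval (@L2_complete R) on) => g g0.
    by rewrite (tot g g0) ip0r.
  have -> : series (fun n => dot (Y (e n)) (e n) : R[i]^o) =
     (fun n => \sum_(i < N) (\sum_(j < n) dot (v i) (e j) * dot (e j) (k i)) : R[i]^o).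
    apply/funext => n; rewrite /series /= big_mkord exchange_big /=.
    apply: eq_bigr => j _; rewrite YE -[LHS]/(L2ip R _ _) ip_suml.
    by apply: eq_bigr => i _; rewrite ipZl mulrC.
  apply: cvg_bigsum => i; apply: sqnorm_cvg.
  exact: (parseval_ip (k i) (pt i)).
(* Without an orthonormal basis, [xget] could return any complex number. *)
have [e eb] := L2_has_orthonormal_basis R.
rewrite /trace; case: xgetP => [c' _ /= h|/(_ c) /= h]; last by case: h.
by apply: (cvg_unique _ (h e eb) (cc e eb)).
Qed.

(** The span of an orthonormal [v] contains the range of [X], and each coordinate [dot (X f) (v i)]
    is a bounded linear functional of [f], to which Riesz applies. *)
Lemma finite_rank_representation (X : L2 R -> L2 R) :
  (forall a x y, X (a *: x + y) = a *: X x + X y) -> bounded_op X -> finite_rank X ->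
  exists (N : nat) (v : nat -> L2 R) (g : 'I_N -> L2 R),
    orthonormal (L2ip R) v N /\ forall f, X f = \sum_(i < N) dot f (g i) *: v i.
Proof.
move=> Xlin [M XM] [n [u Xu]].
pose G k := if insub k is Some i then u i else 0 : L2 R.
have [m [H [on GH _ _]]] := gram_schmidt (L2ip R) G n.
have Xspan f : in_span H m (X f).
  have [c ->] := Xu f; apply: (in_span_trans GH).
  exists (fun k => if insub k is Some i then c i else 0); apply: eq_bigr => i _.
  by rewrite /G valK.
have Xn f : nsq (L2ip R) (X f) <= M ^+ 2 * nsq (L2ip R) f.
  have := XM f; rewrite /norm2 -/(nsq (L2ip R) _) -/(nsq (L2ip R) f) => h.
  rewrite -[nsq _ (X f)]sqr_sqrtr ?nsq_ge0 // -[nsq _ f]sqr_sqrtr ?nsq_ge0 // -exprMn.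
  by rewrite ler_sqr ?nnegrE ?sqrtr_ge0 // (le_trans _ h) ?sqrtr_ge0.
have [e [eon etot]] := L2_has_orthonormal_basis R.
have /choice[g gE] (i : 'I_m) : exists g, forall f, dot (X f) (H i) = dot f g.
  apply: (@riesz R (L2 R) (L2ip R) e (fun f => dot (X f) (H i)) (M ^+ 2 * nsq (L2ip R) (H i))
    (@L2_complete R) eon) => //.
    by move=> a x y; rewrite Xlin -[LHS]/(L2ip R _ _) ipDl ipZl.
  move=> x; apply: le_trans (cauchy_schwarz (L2ip R) _ _) _.
  by rewrite mulrAC ler_wpM2r ?nsq_ge0.
exists m, H, g; split => // f.
rewrite [LHS](partial_sum_span on (Xspan f)); apply: eq_bigr => i _.
by rewrite -gE.
Qed.

Lemma fourier_wigner_rank_sum (X : L2 R -> L2 R) (N : nat) (v g : 'I_N -> L2 R) (w : R * R) :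
  (forall f, X f = \sum_(i < N) dot f (g i) *: v i) ->
  fourier_wigner X w = \sum_(i < N) dot (v i) (rho w.1 w.2 1 (g i)).
Proof.
move=> XE; apply: trace_rank_sum => f /=; rewrite XE; apply: eq_bigr => i _.
by rewrite adjoint_rho rho_adjoint !opprK.
Qed.

End Trace.

(** * The transform of a finite rank operator through the slices of its kernel *)

Section Wigner.
Context (R : realType) (N : nat).
Local Notation mu := (@lebesgue_measure R).
Local Notation RR := (measurableTypeR R).
Implicit Types u r : 'I_N -> L2fun R.

(** Stated for functions instead of classes, because [shear] evaluates them pointwise. *)
Definition wigner u r (x y : R) : R[i] :=
  \sum_(i < N) dot (\pi_(L2 R) (u i)) (rho x y 1 (\pi_(L2 R) (r i))).

(* The slice [t |-> K (t, t + x)] of the integral kernel [K] of the operator. *)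
Definition shear u r (x t : R) : R[i] := \sum_(i < N) u i t * conjc (r i (t + x)).

Lemma translate_sq (f : L2fun R) x : square_integrable (fun t => f (t + x)).
Proof.
have := L2fun_sq (rhoL x 0 f); congr square_integrable; apply/funext => t.
by rewrite /= /rho_fun mulr0 mulr0 mul0r addr0 mulr0 cis0 !mul1r.
Qed.

Lemma shear_integrable u r x : cintegrable mu (shear u r x).
Proof.
apply: cintegrable_sum => i.
exact: (L2_prod_int (L2fun_sq (u i)) (translate_sq (r i) x)).
Qed.

Lemma wigner_fhat u r x y : wigner u r x y = cis (- (pi * (x * y))) * fhat (shear u r x) y.
Proof.
rewrite /wigner /fhat -cintZ; last exact: cintegrable_cis (shear_integrable u r x).
under eq_bigr do rewrite rho_piE dot_piE.
rewrite -cint_sum; last by move=> i; exact: (L2_prod_int (L2fun_sq _) (L2fun_sq _)).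
apply: eq_cint => t; rewrite /shear mulr_suml mulr_sumr; apply: eq_bigr => i _.
rewrite /= /rho_fun mul1r conjcM conjc_cis.
have -> : - (pi * (x * y + 2 * y * t)) = - (pi * (x * y)) + - (2 * pi * y) * t by ring.
by rewrite cisD; ring.
Qed.

Lemma sqnorm_wigner u r x y : sqnorm (wigner u r x y) = sqnorm (fhat (shear u r x) y).
Proof. by rewrite wigner_fhat sqnormM sqnorm_cis mul1r. Qed.

Lemma cmeas_comp d1 (T1 : measurableType d1) (f : R -> R[i]) (phi : T1 -> RR) :
  @cmeas _ RR R f -> measurable_fun [set: T1] phi -> cmeas (fun z => f (phi z)).
Proof.
by move=> [mr mi] mp; split; [exact: (measurableT_comp mr mp)|exact: (measurableT_comp mi mp)].
Qed.

Lemma cmeas_shear u r : cmeas (fun z : RR * RR => shear u r z.1 z.2).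
Proof.
have m1 : measurable_fun [set: RR * RR] (fun z => z.1 : RR) by exact: measurable_fst.
have m2 : measurable_fun [set: RR * RR] (fun z => z.2 : RR) by exact: measurable_snd.
have m12 : measurable_fun [set: RR * RR] (fun z => z.2 + z.1 : RR) by exact: measurable_funD.
apply: cmeas_sum => i; apply: cmeasM.
  exact: (cmeas_comp (L2fun_meas (u i)) m2).
exact: (cmeas_conj (cmeas_comp (L2fun_meas (r i)) m12)).
Qed.

Lemma cmeas_wigner u r : cmeas (fun w : RR * RR => wigner u r w.1 w.2).
Proof.
have m1 : measurable_fun [set: RR * RR] (fun z => z.1 : RR) by exact: measurable_fst.
have m2 : measurable_fun [set: RR * RR] (fun z => z.2 : RR) by exact: measurable_snd.
have n1 : measurable_fun [set: (RR * RR) * RR] (fun z => z.1 : RR * RR) by exact: measurable_fst.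
have n2 : measurable_fun [set: (RR * RR) * RR] (fun z => z.2 : RR) by exact: measurable_snd.
have n11 := measurableT_comp m1 n1; have n12 := measurableT_comp m2 n1.
under eq_fun do rewrite wigner_fhat; apply: cmeasM.
  apply: cmeas_cis; apply: measurableT_comp => //; apply: measurable_funM => //.
  exact: measurable_funM.
apply: (@cmeas_cint _ (RR * RR)%type R
  (fun z : (RR * RR) * RR => shear u r z.1.1 z.2 * cis (- (2 * pi * z.1.2) * z.2))).
apply: cmeasM.
  have n112 : measurable_fun [set: (RR * RR) * RR] (fun z => (z.1.1, z.2) : RR * RR).
    exact: measurable_fun_pair.
  have [mr mi] := cmeas_shear u r.
  by split; [exact: (measurableT_comp mr n112)|exact: (measurableT_comp mi n112)].
apply: cmeas_cis; apply: measurable_funM => //; apply: measurableT_comp => //.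
exact: measurable_funM.
Qed.

(** The squared Hilbert-Schmidt norm, as the trace of a product of two Gram matrices. After Tonelli,
    for fixed [t] the slice in [x] is, up to conjugation, a translate of the combination of the
    [r i] with coefficients [conjc (u i t)]; its squared norm is a Hermitian form in these
    coefficients. *)
Lemma integral_shear u r : 
  (\int[mu]_x \int[mu]_t (sqnorm (shear u r x t))%:E =
   (Re (\sum_(i < N) \sum_(j < N) dot (\pi_(L2 R) (u i)) (\pi_(L2 R) (u j)) *
      dot (\pi_(L2 R) (r j)) (\pi_(L2 R) (r i))))%:E)%E.
Proof.
pose gg i j : R[i] := dot (\pi_(L2 R) (r j)) (\pi_(L2 R) (r i)).
have mk := cmeas_sqnorm (cmeas_shear u r).
have k0 (z : RR * RR) : (0 <= (sqnorm (shear u r z.1 z.2))%:E)%E by rewrite lee_fin sqnorm_ge0.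
rewrite (fubini_tonelli (m1 := mu) (m2 := mu)
  (fun z : RR * RR => (sqnorm (shear u r z.1 z.2))%:E) mk k0).
pose q t : R[i] := \sum_(i < N) \sum_(j < N) gg i j * (u i t * conjc (u j t)).
have iq : cintegrable mu q.
  apply: cintegrable_sum => i; apply: cintegrable_sum => j; apply: cintegrableZ.
  exact: (L2_prod_int (L2fun_sq _) (L2fun_sq _)).
have inner t : (\int[mu]_x (sqnorm (shear u r x t))%:E = (Re (q t))%:E)%E.
  pose s : L2fun R := \sum_(i < N) conjc (u i t) *: r i.
  transitivity (\int[mu]_x (sqnorm (s x))%:E)%E.
    rewrite -(@ge0_integral_translate R t (fun x => (sqnorm (s x))%:E)); last 2 first.
    - exact/cmeas_sqnorm/L2fun_meas.
    - by move=> x; rewrite lee_fin sqnorm_ge0.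
    apply: eq_integral => x _; rewrite -sqnorm_conj /shear conjc_sum; congr (sqnorm _)%:E.
    rewrite /s L2fun_sumE; apply: eq_bigr => i _; rewrite conjcM conjcK addrC.
    by rewrite -[RHS]/(conjc (u i t) * r i (x + t)).
  rewrite -nsq_pi; congr (_%:E); rewrite /s -pi_sum.
  under [X in nsq _ X]eq_bigr do rewrite -piZ.
  rewrite /nsq ip_suml; congr (Re _).
  rewrite /q exchange_big /=; apply: eq_bigr => j _.
  rewrite dotZl -[dot _ _]/(L2ip R _ _) ip_sumr mulr_sumr; apply: eq_bigr => i _.
  by rewrite ipZr conjcK -[L2ip R _ _]/(gg i j); ring.
under eq_integral do rewrite inner.
transitivity ((Re (cint mu q))%:E).
  by rewrite /= /Rintegral fineK //; apply: integrable_fin_num => //; case: iq.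
congr (Re _)%:E; rewrite /q cint_sum; last first.
  move=> i; apply: cintegrable_sum => j; apply: cintegrableZ.
  exact: (L2_prod_int (L2fun_sq _) (L2fun_sq _)).
apply: eq_bigr => i _; rewrite cint_sum; last first.
  by move=> j; apply: cintegrableZ; exact: (L2_prod_int (L2fun_sq _) (L2fun_sq _)).
apply: eq_bigr => j _; rewrite cintZ; last exact: (L2_prod_int (L2fun_sq _) (L2fun_sq _)).
by rewrite -dot_piE mulrC.
Qed.

(** Orthonormality of [u] reduces the Gram expression to the sum of the squared norms of the [r i];
    Plancherel is applied slice by slice in [x]. *)
Lemma wigner_lower u r :
  (forall i j, dot (\pi_(L2 R) (u i)) (\pi_(L2 R) (u j)) = (i == j)%:R) ->
  ((\sum_(i < N) nsq (L2ip R) (\pi_(L2 R) (r i)))%:E <=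
   4%:E * \int[mu \x mu]_w (sqnorm (wigner u r w.1 w.2))%:E)%E.
Proof.
have aeF := ae_filter_ringOfSetsType mu.
move=> on; pose I x := (\int[mu]_t (sqnorm (shear u r x t))%:E)%E.
have IE : (\int[mu]_x I x = (\sum_(i < N) nsq (L2ip R) (\pi_(L2 R) (r i)))%:E)%E.
  rewrite integral_shear Re_sum; congr EFin; apply: eq_bigr => i _.
  rewrite (bigD1 i) //= on eqxx mul1r big1 ?addr0 // => j ji.
  by rewrite on eq_sym (negbTE ji) mul0r.
have mk := cmeas_sqnorm (cmeas_shear u r).
have k0 (z : RR * RR) : (0 <= (sqnorm (shear u r z.1 z.2))%:E)%E by rewrite lee_fin sqnorm_ge0.
have mI : measurable_fun [set: RR] I := measurable_fun_fubini_tonelli_F (m2 := mu) _ mk k0.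
have I0 x : (0 <= I x)%E by exact: integral_sqnorm_ge0.
have mw := cmeas_sqnorm (cmeas_wigner u r).
have w0 (z : RR * RR) : (0 <= (sqnorm (wigner u r z.1 z.2))%:E)%E by rewrite lee_fin sqnorm_ge0.
rewrite (fubini_tonelli1 (m1 := mu) (m2 := mu)
  (fun w : RR * RR => (sqnorm (wigner u r w.1 w.2))%:E) mw w0).
rewrite -IE /fubini_F /=.
have mJ : measurable_fun [set: RR] (fun x => \int[mu]_y (sqnorm (wigner u r x y))%:E)%E :=
  measurable_fun_fubini_tonelli_F (m2 := mu) _ mw w0.
rewrite -ge0_integralZl_EFin //; last by move=> x _; exact: integral_sqnorm_ge0.
apply: ae_ge0_le_integral => //.
- by move=> x _; rewrite mule_ge0 // integral_sqnorm_ge0.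
- exact: measurable_funeM.
(* Plancherel asks for a slice in L2; the finite double integral grants this for almost every [x]
   only. *)
have iI : mu.-integrable [set: RR] I.
  apply/integrableP; split => //; under eq_integral do rewrite gee0_abs //.
  by rewrite IE ltry.
have := integrable_ae measurableT iI; apply: filterS => x Ifin _.
under [X in (_ <= _ * X)%E]eq_integral do rewrite sqnorm_wigner.
apply: plancherel_lower; last exact: shear_integrable.
apply/square_integrableP; split; first exact: cintegrable_meas (shear_integrable u r x).
by have := Ifin Logic.I; rewrite ge0_fin_numE.
Qed.

End Wigner.

Section FinfunInnerProduct.
Context (R : realType) (V : lmodType R[i]) (d : inner_product V) (N : nat).
Local Notation W := {ffun 'I_N -> V}.
Implicit Types F G : W.

Definition ffdot F G : R[i] := \sum_(i < N) d (F i) (G i).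

Lemma ffdotDl F G K : ffdot (F + G) K = ffdot F K + ffdot G K.
Proof. by rewrite -big_split; apply: eq_bigr => i _; rewrite ffunE ipDl. Qed.

Lemma ffdotZl a F K : ffdot (a *: F) K = a * ffdot F K.
Proof. by rewrite mulr_sumr; apply: eq_bigr => i _; rewrite ffunE ipZl. Qed.

Lemma ffdotC F G : ffdot G F = conjc (ffdot F G).
Proof. by rewrite conjc_sum; apply: eq_bigr => i _; exact: ipC. Qed.

Lemma ffdotE F : Re (ffdot F F) = \sum_(i < N) nsq d (F i).
Proof. by rewrite Re_sum. Qed.

Lemma ffdot_ge0 F : 0 <= Re (ffdot F F).
Proof. by rewrite ffdotE sumr_ge0 // => i _; exact: nsq_ge0. Qed.

Lemma ffdot_eq0 F : Re (ffdot F F) = 0 -> F = 0.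
Proof.
rewrite ffdotE => /eqP; rewrite psumr_eq0 => [/allP h|i _]; last exact: nsq_ge0.
apply/ffunP => i; rewrite ffunE; apply: (@ip_eq0 _ _ d).
by apply/eqP; apply: h; rewrite mem_index_enum.
Qed.

Definition ffip : inner_product W :=
  @InnerProduct R W ffdot ffdotDl ffdotZl ffdotC ffdot_ge0 ffdot_eq0.

End FinfunInnerProduct.

(** * The dimension count *)

Section Modulation.
Context (R : realType).
Local Notation mu := (@lebesgue_measure R).
Local Notation RR := (measurableTypeR R).

(** Subtracting the multiple of [2 * pi] that brings [x] into [-pi, pi[ reduces the claim to the
    injectivity of [cos] on [0, pi]. *)
Lemma cos_eq1 (x : R) : cos x = 1 -> exists k : int, x = k%:~R * (2 * pi).
Proof.
move=> cx; have pi0 := pi_gt0 R.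
pose k := Num.floor ((x + pi) / (2 * pi)).
have p2 : 0 < 2 * pi :> R by rewrite mulr_gt0.
have h1 : k%:~R * (2 * pi) <= x + pi by rewrite -ler_pdivlMr // floor_le.
have h2 : x + pi < (k + 1)%:~R * (2 * pi) by rewrite -ltr_pdivrMr // floorD1_gt.
rewrite intrD mulrDl mul1r in h2.
exists k; pose y := x - k%:~R * (2 * pi).
have cy : cos `|y| = cos 0.
  rewrite cos_norm cos0 -cx; have := cis_2pi k y.
  by rewrite /y subrK => /(congr1 (@complex.Re R)).
have y1 : `|y| <= pi by rewrite ler_norml /y; apply/andP; split; lra.
have y0 : `|y| = 0 by apply: cos_inj cy; rewrite in_itv /= ?lexx ?normr_ge0 ?y1 ?ltW.
by apply/eqP; rewrite -subr_eq0 -normr_eq0; apply/eqP.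
Qed.

Lemma countable_cis_level (b : R) (z : R[i]) : b != 0 ->
  countable [set t : R | cis (b * t) = z].
Proof.
move=> b0; have [[t0 t0z]|none] := pselect (exists t0, cis (b * t0) = z); last first.
  rewrite (_ : [set _ | _] = set0); first exact: countable0.
  by rewrite -subset0 => t tz; apply: none; exists t.
pose A : set R := [set t0 + k%:~R * (2 * pi) / b | k in [set: int]].
apply: (@sub_countable _ _ _ A).
  apply: subset_card_le => t /= tz.
  have : cos (b * t - b * t0) = 1.
    have -> : cos (b * t - b * t0) = Re (cis (b * t) * cis (- (b * t0))) by rewrite -cisD.
    by rewrite tz -t0z mulrC cisNK.
  move=> /cos_eq1[k kE]; exists k => //.
  have -> : k%:~R * (2 * pi) / b = t - t0 by rewrite -kE; field.
  by rewrite addrC subrK.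
by apply: sub_countable (card_image_le _ _) _; exact: countableP.
Qed.

(** The polynomial has finitely many roots, and [t |-> cis (b * t)] takes each value on an at most
    countable set. *)
Lemma trig_poly_zeros_null (p : {poly R[i]}) (b : R) : b != 0 -> p != 0 ->
  {ae mu, forall t : R, p.[cis (b * t)] != 0}.
Proof.
move=> b0 p0.
have [rs pE] := closed_field_poly_normal p.
exists [set t : R | p.[cis (b * t)] = 0].
have cnt : countable [set t : R | p.[cis (b * t)] = 0].
  pose D : set R[i] := [set` rs].
  apply: (@sub_countable _ _ _ (\bigcup_(z in D) [set t : R | cis (b * t) = z])).
    apply: subset_card_le => t /= /eqP; rewrite -/(root p _) pE rootZ ?lead_coef_eq0 //.
    by rewrite root_prod_XsubC => zr; exists (cis (b * t)).
  apply: bigcup_countable => [|z _]; last exact: countable_cis_level.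
  by apply: finite_set_countable; exact: finite_seq.
split.
- by apply: countable_measurable => //; move=> t; exact: measurable_set1.
- exact: countable_lebesgue_measure0.
- by move=> t /= /negP; rewrite negbK => /eqP.
Qed.

End Modulation.

Section Counting.
Context (R : realType) (N : nat) (v : 'I_N -> L2 R).
Hypothesis v_on : forall i j, dot (v i) (v j) = (i == j)%:R.
Local Notation mu := (@lebesgue_measure R).
Local Notation RR := (measurableTypeR R).
Local Notation W := {ffun 'I_N -> L2 R}.
Local Notation d := (ffip (L2ip R) N).
Implicit Types G H : W.

(** The cross-ambiguity function of the tuples [v] and [G]. *)
Definition ambiguity G (x y : R) : R[i] := \sum_(i < N) dot (v i) (rho x y 1 (G i)).

Lemma ambiguity_wigner G x y :
  ambiguity G x y = wigner (fun i => repr (v i)) (fun i => repr (G i)) x y.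
Proof. by apply: eq_bigr => i _; rewrite !reprK. Qed.

(** Once [rho] is moved to the [v i], [G] stands alone in the second slot of an inner product of
    tuples: this gives both the Bessel bound and conjugate-linearity in [G]. *)
Lemma ambiguity_ip G x y :
  ambiguity G x y = d [ffun i => rho (- x) (- y) 1 (v i)] G.
Proof. by apply: eq_bigr => i _; rewrite ffunE -[RHS]/(dot _ _) rho_adjoint !opprK. Qed.

Lemma ambiguity_bessel (H : nat -> W) n x y : orthonormal d H n ->
  \sum_(k < n) sqnorm (ambiguity (H k) x y) <= N%:R.
Proof.
move=> on; under eq_bigr do rewrite ambiguity_ip.
apply: le_trans (bessel _ on) _; rewrite /nsq ffdotE.
under eq_bigr do rewrite ffunE nsq_rho /nsq -[L2ip R _ _]/(dot _ _) v_on eqxx.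
by rewrite sumr_const card_ord.
Qed.

Lemma ambiguity_lower G :
  ((nsq d G)%:E <= 4%:E * \int[mu \x mu]_w (sqnorm (ambiguity G w.1 w.2))%:E)%E.
Proof.
under eq_integral do rewrite ambiguity_wigner.
have -> : nsq d G = \sum_(i < N) nsq (L2ip R) (\pi_(L2 R) (repr (G i))).
  by rewrite /nsq ffdotE; apply: eq_bigr => i _; rewrite reprK.
by apply: wigner_lower => i j; rewrite !reprK.
Qed.

Lemma ambiguity_comb (c : nat -> R[i]) (G : nat -> W) n x y :
  ambiguity (\sum_(k < n) c k *: G k) x y = \sum_(k < n) conjc (c k) * ambiguity (G k) x y.
Proof.
rewrite ambiguity_ip ip_sumr; apply: eq_bigr => k _.
by rewrite ipZr -ambiguity_ip.
Qed.

Lemma cmeas_ambiguity G : cmeas (fun w : RR * RR => ambiguity G w.1 w.2).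
Proof. by under eq_fun do rewrite ambiguity_wigner; exact: cmeas_wigner. Qed.

(** Multiplication of every component by [exp(-2 pi i s t)]. *)
Definition modulate (s : R) G : W := [ffun i => rho 0 (- s) 1 (G i)].

(** A case of the Weyl commutation relations: the operators [rho] compose up to a unimodular
    scalar. *)
Lemma rho_modulate x y s (g : L2 R) :
  rho x y 1 (rho 0 (- s) 1 g) = cis (- (pi * (s * x))) *: rho x (y - s) 1 g.
Proof.
elim/quotW: g => g; rewrite [rho 0 _ _ _]rho_piE !rho_piE piZ; apply: L2_ae_eq; apply: aeW => t.
rewrite -[RHS]/(cis _ * rho_fun x (y - s) 1 g t) /= /rho_fun !mul1r addr0 !mulrA -!cisD.
by congr (cis _ * _); ring.
Qed.

Lemma ambiguity_modulate s G x y :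
  ambiguity (modulate s G) x y = cis (pi * (s * x)) * ambiguity G x (y - s).
Proof.
rewrite /ambiguity mulr_sumr; apply: eq_bigr => i _.
by rewrite ffunE rho_modulate -[LHS]/(L2ip R _ _) ipZr conjc_cis opprK.
Qed.

Lemma modulate_independent (delta : R) G n : 0 < delta -> G <> 0 ->
  independent (fun k => modulate (k%:R * delta) G) n.
Proof.
have aeF := ae_filter_ringOfSetsType mu.
move=> delta0 G0 c cG k kn; apply/eqP/negP => /negP ck; apply: G0.
pose p := \poly_(k < n) c k.
have p0 : p != 0.
  by apply: contra_neq ck => p0; have := coef_poly n c k; rewrite -/p p0 kn coef0.
pose b := - (2 * pi * delta).
have b0 : b != 0 by rewrite oppr_eq0 !mulf_neq0 ?gt_eqF ?pi_gt0.
apply/ffunP => i; rewrite ffunE.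
have := congr1 (fun F : W => F i) cG; rewrite sum_ffunE ffunE.
pose g : L2fun R := repr (G i).
have -> : \sum_(j < n) (c j *: modulate (j%:R * delta) G) i =
    \pi_(L2 R) (\sum_(j < n) c j *: rhoL 0 (- (j%:R * delta)) g).
  rewrite -pi_sum; apply: eq_bigr => j _.
  by rewrite !ffunE -[G i]reprK rho_piE piZ.
rewrite -[X in _ = X -> _](raddf0 (\pi_(L2 R))) => /L2_eqP/asboolP h.
suff : \pi_(L2 R) g = 0 by rewrite reprK.
apply: L2_pi0.
apply: filterS2 h (trig_poly_zeros_null b0 p0) => t.
rewrite L2fun_sumE => h1 h2; apply/eqP.
have : p.[cis (b * t)] * g t == 0.
  rewrite /p horner_poly mulr_suml -[X in _ == X]h1; apply/eqP; apply: eq_bigr => j _.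
  rewrite -[RHS]/(c j * rho_fun 0 (- (j%:R * delta)) 1 g t) /rho_fun mul1r addr0 mulrA cisX.
  by congr (_ * cis _ * _); rewrite /b; ring.
by rewrite mulf_eq0 (negbTE h2).
Qed.

(** For fixed [x] the modulus is that of the Fourier transform of an integrable function, hence
    continuous in [y]. Continuity along sequences is the form in which [overhang_cvg] consumes
    it. *)
Lemma ambiguity_near G x y (s : nat -> R) : s @ \oo --> (0 : R) -> ambiguity G x y != 0 ->
  \forall j \near \oo, ambiguity G x (y + s j) != 0.
Proof.
move=> s0 Gn; set h := shear (fun i => repr (v i)) (fun i => repr (G i)) x.
have sE z : sqnorm (ambiguity G x z) = sqnorm (fhat h z).
  by rewrite ambiguity_wigner sqnorm_wigner.
have ih : cintegrable mu h by exact: shear_integrable.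
have mh := cintegrable_meas ih; have [ir ii] := ih.
have ig : mu.-integrable [set: RR] (EFin \o (fun t => `|Re (h t)| + `|Im (h t)|)) :=
  integrableD measurableT (integrable_norm ir) (integrable_norm ii).
have mle (a c : R) : `|c| <= 1 -> `|a * c| <= `|a| by move=> c1; rewrite normrM ler_piMr.
have cv : ccvg (fun j => fhat h (y + s j)) (fhat h y).
  apply: (@dominated_cint _ RR R mu (fun j t => h t * cis (- (2 * pi * (y + s j)) * t))
    (fun t => h t * cis (- (2 * pi * y) * t)) (fun t => `|Re (h t)| + `|Im (h t)|)).
  - by move=> j; apply: cmeasM => //; exact: cmeas_linear_cis.
  - by apply: cmeasM => //; exact: cmeas_linear_cis.
  - move=> t.
    have lin : (fun j => - (2 * pi * (y + s j)) * t) @ \oo --> - (2 * pi * y) * t.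
      apply: cvgMl; apply: cvgN; apply: cvgMr; rewrite -[X in _ --> X]addr0.
      by apply: cvgD => //; exact: cvg_cst.
    have cc : (fun j => cos (- (2 * pi * (y + s j)) * t)) @ \oo --> cos (- (2 * pi * y) * t).
      by apply: (continuous_cvg _ _ lin); exact: continuous_cos.
    have cs : (fun j => sin (- (2 * pi * (y + s j)) * t)) @ \oo --> sin (- (2 * pi * y) * t).
      by apply: (continuous_cvg _ _ lin); exact: continuous_sin.
    split.
      rewrite ReM; under eq_fun do rewrite ReM.
      by apply: cvgB; apply: cvgMr.
    rewrite ImM; under eq_fun do rewrite ImM.
    by apply: cvgD; apply: cvgMr.
  - exact: ig.
  - move=> j t; rewrite ReM ImM /=; split.
      by apply: le_trans (ler_normB _ _) _; apply: lerD; apply: mle; rewrite ?cos_max ?sin_max.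
    by apply: le_trans (ler_normD _ _) _; apply: lerD; apply: mle; rewrite ?cos_max ?sin_max.
have Gp : 0 < sqnorm (fhat h y).
  rewrite -sE lt_def sqnorm_ge0 andbT; apply: contra_neq Gn; exact: sqnorm_eq0.
have := ccvg_sqnorm cv => /cvgr_gt /(_ _ Gp); apply: filterS => j.
by rewrite -sE; apply: contraL => /eqP ->; rewrite sqnorm0 ltxx.
Qed.

End Counting.

(** * Translates of the support and the bound on the number of modulates *)

Section Overlap.
Context (R : realType) (N : nat) (v : 'I_N -> L2 R).
Hypothesis v_on : forall i j, dot (v i) (v j) = (i == j)%:R.
Local Notation mu := (@lebesgue_measure R).
Local Notation mu2 := (mu \x mu)%E.
Local Notation RR := (measurableTypeR R).
Local Notation W := {ffun 'I_N -> L2 R}.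
Local Notation d := (ffip (L2ip R) N).
Variable G : W.

Definition wsupp : set (RR * RR) := [set w | ambiguity v G w.1 w.2 != 0].
Local Notation chi := (\1_wsupp : RR * RR -> R).
Hypothesis G_supp : (mu2 wsupp < +oo)%E.

Definition vshift (c : R) (w : RR * RR) : RR * RR := (w.1, w.2 + c).

Lemma measurable_vshift c : measurable_fun [set: RR * RR] (vshift c).
Proof.
apply: measurable_fun_pair; first exact: measurable_fst.
by apply: measurable_funD => //; exact: measurable_snd.
Qed.

Lemma integral_vshift (c : R) (f : RR * RR -> R) : measurable_fun [set: RR * RR] f ->
  (forall w, 0 <= f w) ->
  (\int[mu2]_w (f (vshift c w))%:E = \int[mu2]_w (f w)%:E)%E.
Proof.
move=> mf f0.
have mE : measurable_fun [set: RR * RR] (EFin \o f) by exact/measurable_EFinP.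
have mEc : measurable_fun [set: RR * RR] (EFin \o (f \o vshift c)).
  by apply/measurable_EFinP; exact: (measurableT_comp mf (measurable_vshift c)).
have e0 w : (0 <= (EFin \o f) w)%E by rewrite lee_fin.
have e0c w : (0 <= (EFin \o (f \o vshift c)) w)%E by rewrite lee_fin; exact: f0.
rewrite (fubini_tonelli1 (m1 := mu) (m2 := mu) (EFin \o f) mE e0).
rewrite (fubini_tonelli1 (m1 := mu) (m2 := mu) (EFin \o (f \o vshift c)) mEc e0c).
apply: eq_integral => x _; rewrite /fubini_F.
apply: (@ge0_integral_translate R c (fun y => (f (x, y))%:E)).
  by apply/measurable_EFinP; exact: (measurableT_comp mf (pair1_measurable x)).
by move=> y; rewrite lee_fin.
Qed.

Lemma measurable_wsupp : measurable wsupp.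
Proof.
have ms : measurable_fun [set: RR * RR] (fun w : RR * RR => sqnorm (ambiguity v G w.1 w.2)).
  by apply/measurable_EFinP; exact: (cmeas_sqnorm (cmeas_ambiguity v G)).
have -> : wsupp = (fun w : RR * RR => sqnorm (ambiguity v G w.1 w.2)) @^-1` (~` [set 0]).
  apply/seteqP; split => w; rewrite /wsupp /= => h.
    by move=> /sqnorm_eq0 h0; move: h; rewrite h0 eqxx.
  by apply/eqP => h0; apply: h; rewrite h0 sqnorm0.
rewrite -[X in measurable X]setTI; apply: ms => //.
by apply: measurableC; exact: measurable_set1.
Qed.

Lemma measurable_chi : measurable_fun [set: RR * RR] chi.
Proof. exact: (@measurable_indic _ (RR * RR)%type R setT _ measurable_wsupp). Qed.

Lemma measurable_chi_shift c : measurable_fun [set: RR * RR] (fun w => chi (vshift c w)).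
Proof. exact: (measurableT_comp measurable_chi (measurable_vshift c)). Qed.

(* The integral of [overhang c] is the measure of the part of the support that
   its translate misses. *)
Definition overhang (c : R) (w : RR * RR) : R := chi w * (1 - chi (vshift c w)).

Lemma overhang_ge0 c w : 0 <= overhang c w.
Proof. by rewrite mulr_ge0 // ?subr_ge0 indicE; case: (_ \in _). Qed.

Lemma measurable_overhang c : measurable_fun [set: RR * RR] (overhang c).
Proof.
apply: measurable_funM; first exact: measurable_chi.
by apply: measurable_funB => //; exact: measurable_chi_shift.
Qed.

Lemma integrable_chi : mu2.-integrable [set: RR * RR] (EFin \o chi).
Proof.
apply/integrableP; split; first by apply/measurable_EFinP; exact: measurable_chi.
under eq_integral do rewrite /= ger0_norm //.
by rewrite (integral_indic mu2 measurableT measurable_wsupp) setIT.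
Qed.

(** A point of the support stays in it under all sufficiently small vertical shifts, so the overhang
    is eventually 0 at each point; it is dominated by [chi], which is integrable because the support
    has finite measure. *)
Lemma overhang_cvg (k : nat) :
  (fun j => \int[mu2]_w (overhang (k%:R / j.+1%:R) w)%:E)%E @ \oo --> 0%E.
Proof.
have c1 : {ae mu2, forall w, [set: RR * RR] w ->
    (fun j => (overhang (k%:R / j.+1%:R) w)%:E) @ \oo --> 0%E}.
  apply: aeW => w _; apply: cvg_near_cst.
  have [wE|wE] := pselect (wsupp w); last first.
    by apply: nearW => j; rewrite /overhang indicE memNset // mul0r.
  have s0 : (fun j => k%:R / j.+1%:R) @ \oo --> (0 : R).
    rewrite -[X in _ --> X](mulr0 (k%:R : R)); apply: cvgMr.
    exact: cvg_harmonic.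
  have := ambiguity_near s0 wE; apply: filterS => j h.
  rewrite /overhang [chi (vshift _ _)]indicE mem_set ?subrr ?mulr0 //.
have c2 : {ae mu2, forall w j, [set: RR * RR] w ->
    `|(overhang (k%:R / j.+1%:R) w)%:E| <= (chi w)%:E}%E.
  apply: aeW => w j _; rewrite gee0_abs lee_fin ?overhang_ge0 //.
  by rewrite ler_piMr // ?indicE // lerBlDr lerDl indicE.
have [_ _] := @dominated_convergence _ (RR * RR)%type R mu2 setT measurableT
  (fun j w => (overhang (k%:R / j.+1%:R) w)%:E) (cst 0%E) (EFin \o chi)
  (fun j => (measurable_EFinP _ _).2 (measurable_overhang _)) (measurable_cst _)
  c1 integrable_chi c2.
by rewrite integral0.
Qed.

Lemma rank_bound (n : nat) : G <> 0 ->
  (n%:R%:E <= 4%:E * (N%:R%:E * (mu2 wsupp + 1)))%E.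
Proof.
move=> G0.
(* Finitely many overhangs tend to 0, so one spacing makes their sum at most 1; this is the [+ 1] of
   the bound. *)
have [j Hj] : exists j, (\sum_(k < n) \int[mu2]_w (overhang (k%:R / j.+1%:R) w)%:E <= 1)%E.
  have cv : (fun j => \sum_(k < n) \int[mu2]_w (overhang (k%:R / j.+1%:R) w)%:E)%E @ \oo
      --> (\sum_(k < n) 0)%E.
    apply: cvg_nnesum => k _; last exact: overhang_cvg.
    by apply: nearW => j; apply: integral_ge0 => w _; rewrite lee_fin overhang_ge0.
  rewrite big1 // in cv.
  move/fine_cvgP: cv => [[A _ hA] /cvgr_lt/(_ _ ltr01)[B _ hB]].
  exists (maxn A B); rewrite -(fineK (hA _ (leq_maxl A B))) lee_fin ltW //.
  exact: (hB _ (leq_maxr A B)).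
pose delta : R := j.+1%:R^-1.
have delta0 : 0 < delta by rewrite invr_gt0.
have [m [H [on _ HG mn]]] := gram_schmidt d (fun k => modulate (k%:R * delta) G) n.
have {mn}mn : m = n by apply: mn; exact: modulate_independent.
rewrite mn in on HG.
(* A majorant of the indicator of the union of the translates: at a point of the [k]-th translate,
   [chi w] and the [k]-th term add up to 1. *)
pose chi' (w : RR * RR) : R := chi w + \sum_(k < n) chi (vshift (- (k%:R * delta)) w) * (1 - chi w).
have mcc k : measurable_fun [set: RR * RR]
    (fun w => chi (vshift (- (k%:R * delta)) w) * (1 - chi w)).
  apply: measurable_funM; first exact: measurable_chi_shift.
  by apply: measurable_funB => //; exact: measurable_chi.
have chi0 w : 0 <= chi w by rewrite indicE.
have chi1 w : chi w <= 1 by rewrite indicE; case: (_ \in _).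
have cc0 k w : 0 <= chi (vshift (- (k%:R * delta)) w) * (1 - chi w).
  by rewrite mulr_ge0 // subr_ge0.
have pointwise w : \sum_(k < n) sqnorm (ambiguity v (H k) w.1 w.2) <= N%:R * chi' w.
  have chi'0 : 0 <= chi' w by rewrite addr_ge0 // sumr_ge0.
  have [[k kE]|none] := pselect (exists k : 'I_n, wsupp (vshift (- (k%:R * delta)) w)).
    apply: le_trans (ambiguity_bessel v_on w.1 w.2 on) _.
    rewrite ler_peMr // /chi' (bigD1 k) //= [chi (vshift _ _)]indicE mem_set // mul1r.
    set S := \sum_(_ < _ | _) _.
    have : 0 <= S by apply: sumr_ge0 => *; exact: cc0.
    by lra.
  (* Off all the translates the ambiguity of every modulate vanishes, hence that of their
     combination [H k]. *)
  rewrite big1 ?mulr_ge0 // => k _.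
  have [c ->] := HG k (ltn_ord k).
  rewrite (ambiguity_comb v c (fun k => modulate (k%:R * delta) G)) big1 ?sqnorm0 // => l _.
  rewrite ambiguity_modulate; apply/eqP; rewrite !mulf_eq0.
  apply/orP; right; apply/orP; right; apply/negP => /negP h.
  by apply: none; exists l.
have I0 k : (0 <= \int[mu2]_w (sqnorm (ambiguity v (H k) w.1 w.2))%:E)%E.
  by apply: integral_ge0 => w _; rewrite lee_fin sqnorm_ge0.
have mA k := cmeas_sqnorm (cmeas_ambiguity v (H k)).
apply: (@le_trans _ _ (4%:E *
    \int[mu2]_w (\sum_(k < n) (sqnorm (ambiguity v (H k) w.1 w.2))%:E)))%E.
  rewrite ge0_integral_sum //; last by move=> k w _; rewrite lee_fin sqnorm_ge0.
  rewrite ge0_sume_distrr //.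
  (* The number of modulates enters as the sum of the squared norms of an orthonormal family. *)
  have -> : (n%:R : R) = \sum_(k < n) nsq d (H k).
    rewrite -[n in LHS]card_ord -sumr_const; apply: eq_bigr => k _.
    by rewrite /nsq on // eqxx.
  by rewrite -sumEFin; apply: lee_sum => k _; exact: ambiguity_lower.
apply: lee_wpmul2l; first by rewrite lee_fin.
have mchi' : measurable_fun [set: RR * RR] chi'.
  apply: measurable_funD; first exact: measurable_chi.
  exact: measurable_sum.
apply: (@le_trans _ _ (\int[mu2]_w (N%:R%:E * (chi' w)%:E)))%E.
  apply: ge0_le_integral => //.
  - by move=> w _; apply: sume_ge0 => k _; rewrite lee_fin sqnorm_ge0.
  - by apply: emeasurable_sum => k; exact: mA.
  - by apply: measurable_funeM; exact/measurable_EFinP.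
  - by move=> w _; rewrite sumEFin lee_fin.
have chi'0 w : 0 <= chi' w by rewrite addr_ge0 // sumr_ge0.
rewrite ge0_integralZl_EFin; [|exact: measurableT|by move=> w _; rewrite lee_fin|
  exact/measurable_EFinP|by []].
apply: lee_wpmul2l; first by rewrite lee_fin.
under eq_integral do rewrite EFinD -sumEFin.
rewrite ge0_integralD //; last 3 first.
- by apply/measurable_EFinP; exact: measurable_chi.
- by move=> w _; apply: sume_ge0 => k _; rewrite lee_fin.
- by apply: emeasurable_sum => k; exact/measurable_EFinP.
rewrite (integral_indic mu2 measurableT measurable_wsupp) setIT.
apply: leeD; first exact: lexx.
rewrite ge0_integral_sum; [|exact: measurableT|by move=> k; exact/measurable_EFinP|
  by move=> k w _; rewrite lee_fin].
apply: le_trans Hj; apply: lee_sum => k _.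
(* Shifting back by [k * delta] turns the part of the translate outside the support into the part of
   the support that leaves it, which is the overhang. *)
rewrite -(integral_vshift (k%:R * delta) (mcc k) (cc0 k)).
rewrite le_eqVlt; apply/orP; left; apply/eqP; apply: eq_integral => w _.
have -> : vshift (- (k%:R * delta)) (vshift (k%:R * delta) w) = w.
  by rewrite /vshift /= addrK; case: w.
by [].
Qed.

End Overlap.

Theorem theorem1p2 (R : realType) (X : {linear L2 R -> L2 R})
    (X_bounded : bounded_op X) (X_finite_rank : finite_rank X)
    (X_support : ((@lebesgue_measure R \x @lebesgue_measure R)
                    [set w : R * R | fourier_wigner X w != 0%R] < +oo)%E) :
  forall phi : L2 R, X phi = 0.
Proof.
have [N [v' [g [v'_on XE]]]] :=
  finite_rank_representation (fun a x y => linearP X a x y) X_bounded X_finite_rank.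
pose v (i : 'I_N) := v' i; pose G : {ffun 'I_N -> L2 R} := [ffun i => g i].
have v_on i j : dot (v i) (v j) = (i == j)%:R.
  exact: (v'_on i j (ltn_ord i) (ltn_ord j)).
have XG w : fourier_wigner X w = ambiguity v G w.1 w.2.
  rewrite (fourier_wigner_rank_sum w (v := v) XE).
  by apply: eq_bigr => i _; rewrite ffunE.
have suppE : [set w : R * R | fourier_wigner X w != 0] = wsupp v G.
  by apply/seteqP; split => w /=; rewrite XG.
have G_supp : ((@lebesgue_measure R \x @lebesgue_measure R) (wsupp v G) < +oo)%E.
  by rewrite -suppE.
have [G0|G0] := pselect (G = 0).
  move=> phi; rewrite XE big1 // => i _.
  have gi : g i = 0 by have := congr1 (fun F : {ffun 'I_N -> L2 R} => F i) G0; rewrite !ffunE.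
  by rewrite gi -[dot _ _]/(L2ip R _ _) ip0r scale0r.
exfalso.
set E := ((@lebesgue_measure R \x @lebesgue_measure R) (wsupp v G))%E in G_supp.
have E0 : (0 <= E)%E by exact: measure_ge0.
have Efin : E \is a fin_num by rewrite ge0_fin_numE.
(* The first natural number beyond the bound, which does not depend on the number of modulates. *)
pose n := (Num.truncn (4 * (N%:R * (fine E + 1)))).+1.
have := rank_bound v_on G_supp n G0; rewrite -/E -(fineK Efin) -EFinD -!EFinM lee_fin.
apply/negP; rewrite -ltNge.
exact: truncnS_gt.
Qed.
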